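(* Let $N\ge n\ge1$ and let $F=(f_1,\dots,f_N):\mathbb{B}^n\to\mathbb{B}^N$ be a minimum proper holomorphic map in which each component is a monomial $f_i=c_iz^{\alpha_i}$ with $\alpha_i$ a multi-index and $c_i\in\mathbb{R}$. Fix $\theta\in(0,\pi/4)$ and define $M^{N+1}_F=\big(f_1,\dots,f_N,1-\sqrt{1-\sum_{i=1}^Nf_i^2}\big)$, and for $2\le k\le N+1$, $M^{N+k}_F=\big(\cos\theta f_1,\sqrt{-1}\sin\theta f_1,\dots,\cos\theta f_{k-1},\sqrt{-1}\sin\theta f_{k-1},f_k,\dots,f_N,1-\sqrt{1-\cos(2\theta)\sum_{j=1}^{k-1}f_j^2-\sum_{j=k}^Nf_j^2}\big)$ (with the block $f_k,\dots,f_N$ empty when $k=N+1$). Then for each $1\le k\le N+1$, $M^{N+k}_F$ is a minimum proper holomorphic map from $\mathbb{B}^n$ to $D^{IV}_{N+k}$.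
   Context: $\mathbb{B}^n=\{z\in\mathbb{C}^n:|z|^2<1\}$; $D^{IV}_m=\{Z\in\mathbb{C}^m: Z\overline{Z}^t<2,\ 1-Z\overline{Z}^t+\tfrac14|ZZ^t|^2>0\}$ (row vectors). $\sqrt{\cdot}$ is the branch with $\sqrt1=1$ (radicands are $1-w$ with $|w|<1$). Proper means preimages of compact sets are compact. A proper holomorphic map $F:\mathbb{B}^n\to\mathbb{B}^N$ is minimum if it is not of the form $\phi\circ(G,0)\circ\psi$ with $\psi\in\mathrm{Aut}(\mathbb{B}^n)$, $\phi\in\mathrm{Aut}(\mathbb{B}^N)$ and $G:\mathbb{B}^n\to\mathbb{B}^{N-1}$ holomorphic. Maps $F_1,F_2:\mathbb{B}^n\to D^{IV}_m$ are equivalent if $F_1=\phi\circ F_2\circ\psi$ with $\psi\in\mathrm{Aut}(\mathbb{B}^n)$, $\phi\in\mathrm{Aut}(D^{IV}_m)$; a holomorphic map $F:\mathbb{B}^n\to D^{IV}_m$ is minimum if there is no holomorphic $G:\mathbb{B}^n\to D^{IV}_{m-1}$ with $F$ equivalent to $(G,0)$. *)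

(* Defs.v *)
From Stdlib Require Import Reals List.
From mathcomp Require Import ssreflect ssrfun ssrbool eqtype ssrnat fintype bigop.
Set Implicit Arguments. Unset Strict Implicit. Unset Printing Implicit Defensive.
Local Open Scope R_scope.

Record C := mkC { Re : R; Im : R }.
Definition C0 : C := mkC 0 0.
Definition C1 : C := mkC 1 0.
Definition Ci : C := mkC 0 1.
Definition RtoC (r : R) : C := mkC r 0.
Definition Cadd (z w : C) : C := mkC (Re z + Re w) (Im z + Im w).
Definition Copp (z : C) : C := mkC (- Re z) (- Im z).
Definition Csub (z w : C) : C := Cadd z (Copp w).
Definition Cmul (z w : C) : C :=
  mkC (Re z * Re w - Im z * Im w) (Re z * Im w + Im z * Re w).
Definition Cconj (z : C) : C := mkC (Re z) (- Im z).
Definition Cnorm2 (z : C) : R := Re z * Re z + Im z * Im z.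
Definition Cabs (z : C) : R := sqrt (Cnorm2 z).
Fixpoint Cpow (z : C) (k : nat) : C :=
  match k with O => C1 | S k' => Cmul z (Cpow z k') end.
(* principal square root (sqrt 1 = 1; Re >= 0, cut along the negative axis) *)
Definition Csqrt (z : C) : C :=
  mkC (sqrt ((Cabs z + Re z) / 2))
      (if Rle_dec 0 (Im z) then sqrt ((Cabs z - Re z) / 2)
       else - sqrt ((Cabs z - Re z) / 2)).

Definition vec (n : nat) := 'I_n -> C.
Definition vadd n (z w : vec n) : vec n := fun i => Cadd (z i) (w i).
Definition vsub n (z w : vec n) : vec n := fun i => Csub (z i) (w i).
Definition vnorm2 n (z : vec n) : R := \big[Rplus/0]_(i < n) Cnorm2 (z i).
Definition vbil n (z : vec n) : C := \big[Cadd/C0]_(i < n) Cmul (z i) (z i).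
Definition mxapp m n (A : 'I_m -> 'I_n -> C) (h : vec n) : vec m :=
  fun i => \big[Cadd/C0]_(j < n) Cmul (A i j) (h j).

Definition ball n (z : vec n) : Prop := vnorm2 z < 1.
Definition D4 m (Z : vec m) : Prop :=
  vnorm2 Z < 2 /\ 1 - vnorm2 Z + / 4 * Cnorm2 (vbil Z) > 0.

Definition is_open n (U : vec n -> Prop) : Prop :=
  forall z, U z -> exists eps, 0 < eps /\
    forall w, vnorm2 (vsub w z) < eps * eps -> U w.
Definition compact n (K : vec n -> Prop) : Prop :=
  forall (I : Type) (U : I -> vec n -> Prop),
    (forall i, is_open (U i)) ->
    (forall z, K z -> exists i, U i z) ->
    exists l : list I, forall z, K z -> exists i, In i l /\ U i z.

Definition holo_at n m (F : vec n -> vec m) (z : vec n) : Prop :=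
  exists A : 'I_m -> 'I_n -> C,
    forall eps, 0 < eps -> exists delta, 0 < delta /\
      forall h : vec n, 0 < vnorm2 h -> vnorm2 h < delta * delta ->
        vnorm2 (vsub (vsub (F (vadd z h)) (F z)) (mxapp A h))
          <= eps * eps * vnorm2 h.
Definition holo_on n m (D : vec n -> Prop) (F : vec n -> vec m) : Prop :=
  forall z, D z -> holo_at F z.
Definition maps_into n m (D1 : vec n -> Prop) (D2 : vec m -> Prop)
  (F : vec n -> vec m) : Prop := forall z, D1 z -> D2 (F z).
Definition proper_map n m (D1 : vec n -> Prop) (D2 : vec m -> Prop)
  (F : vec n -> vec m) : Prop :=
  forall K : vec m -> Prop, (forall w, K w -> D2 w) -> compact K ->
    compact (fun z => D1 z /\ K (F z)).
Definition is_aut n (D : vec n -> Prop) (phi : vec n -> vec n) : Prop :=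
  exists psi : vec n -> vec n,
    holo_on D phi /\ holo_on D psi /\ maps_into D D phi /\ maps_into D D psi /\
    (forall z, D z -> psi (phi z) = z) /\ (forall z, D z -> phi (psi z) = z).

Definition padzero n p q (G : vec n -> vec p) : vec n -> vec q :=
  fun z (i : 'I_q) =>
    match (insub (nat_of_ord i) : option 'I_p) with
    | Some j => G z j
    | None => C0
    end.

Definition minimum_ball n N (F : vec n -> vec N) : Prop :=
  ~ exists (psi : vec n -> vec n) (phi : vec N -> vec N) (G : vec n -> vec N.-1),
      is_aut (@ball n) psi /\ is_aut (@ball N) phi /\
      holo_on (@ball n) G /\ maps_into (@ball n) (@ball N.-1) G /\
      forall z, ball z -> F z = phi (padzero (q:=N) G (psi z)).

Definition minimum_IV n m (F : vec n -> vec m) : Prop :=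
  ~ exists (psi : vec n -> vec n) (phi : vec m -> vec m) (G : vec n -> vec m.-1),
      is_aut (@ball n) psi /\ is_aut (@D4 m) phi /\
      holo_on (@ball n) G /\ maps_into (@ball n) (@D4 m.-1) G /\
      forall z, ball z -> F z = phi (padzero (q:=m) G (psi z)).

Definition monom n (alpha : 'I_n -> nat) (z : vec n) : C :=
  \big[Cmul/C1]_(j < n) Cpow (z j) (alpha j).

(* the maps M^{N+k}_F, 1 <= k <= N+1 (k = 1 gives M^{N+1}_F).
   0-indexed: positions 2j, 2j+1 (j < k-1) carry cos th f_j, i sin th f_j;
   position j + (k-1) (k-1 <= j < N) carries f_j; the last position N+k-1
   carries 1 - sqrt(1 - cos(2 th) sum_{j<k-1} f_j^2 - sum_{j>=k-1} f_j^2). *)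
Definition Mmap n N (F : vec n -> vec N) (th : R) (k : nat) : vec n -> vec (N + k) :=
  fun z (i : 'I_(N + k)) =>
    let f (j : nat) : C :=
      match (insub j : option 'I_N) with Some j' => F z j' | None => C0 end in
    let p := nat_of_ord i in
    if (p < 2 * (k - 1))%N then
      (if ~~ odd p then Cmul (RtoC (cos th)) (f p./2)
       else Cmul (Cmul Ci (RtoC (sin th))) (f p./2))
    else if (p < N + k - 1)%N then f (p - (k - 1))%N
    else Csub C1 (Csqrt (Csub (Csub C1
           (Cmul (RtoC (cos (2 * th)))
              (\big[Cadd/C0]_(j < N | (j < k - 1)%N) Cmul (F z j) (F z j))))
           (\big[Cadd/C0]_(j < N | (k - 1 <= j)%N) Cmul (F z j) (F z j)))).
Arguments Mmap {n N} F th k _ _.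

(* Main.v *)
From HB Require Import structures.
From Coquelicot Require Import Coquelicot.
From Stdlib Require Import Reals Lra Psatz ClassicalEpsilon FunctionalExtensionality.
From Stdlib Require List.
From mathcomp Require Import ssreflect ssrfun ssrbool eqtype ssrnat seq fintype bigop.
Require Import Defs.
Local Open Scope R_scope.

(* Suppose M = phi o (G, 0) o psi, and let sigma be the reflection of D^IV in its last
   coordinate.  Then T = phi o sigma o phi^-1 is an involutive automorphism of D^IV that
   fixes the image of M pointwise.  A constant component of F would place F(B^n) in an affine
   hyperplane, which an automorphism of the ball moves to w_N = 0; so F(0) = 0, hence M(0) = 0
   and T fixes 0.  By a Schwarz lemma argument T is linear, T = A near 0.  The components of F
   are linearly independent (again by minimality) and independent of 1 - sqrt(1 - S), so A
   fixes the last basis vector e, the basis vectors of the unpaired components, and the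
   vectors cos(th) e_a + i sin(th) e_b.  Comparing points t (e + eps x), x real, of D^IV with
   their images shows that A is real off e; hence A fixes e_a and e_b separately and A = 1,
   whereas A is conjugate to sigma.  Properness and M(B^n) in D^IV come from the identity
   1 - |M|^2 + |M M^t|^2 / 4 = 1 - |F|^2.

   The complex analysis used (mean value property, Schwarz lemma) is derived from
   Goursat's lemma for pointwise differentiable functions. *)

(** * Goursat's lemma and circle means *)

(** In place of a description of Aut(D^IV), the proof exploits that T is an involution: A A = 1, so
    z -> A T(z W) has derivative W at 0, which is extremal for real W with |W|^2 = 2, and the
    one-variable Schwarz lemma does the work of Cartan's uniqueness theorem. Independence of
    components alone cannot give A = 1: a paired component enters M only through cos(th) e_a + i
    sin(th) e_b, and a complex matrix may fix that vector while moving e_a and e_b. Linear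
    automorphisms of D^IV are phases times real orthogonal matrices, and A e = e pins the phase;
    only the reality that results is proved. The range of th gives nonzero sin(th) and cos(th),
    which separate e_a from e_b, and cos(2 th) > 0, which makes S grow on the real diagonal. Real
    coefficients split a complex relation among the f_j into two real ones, which a real reflection
    of the ball turns into w_N = 0. *)

Definition circulation (P Q : R -> R -> R) (x y w h : R) : R :=
  RInt (Q (x + w)) y (y + h) - RInt (Q x) y (y + h)
  - RInt (fun s => P s (y + h)) x (x + w) + RInt (fun s => P s y) x (x + w).

Lemma continuity_2d_pt_slice1 (f : R -> R -> R) x y :
  continuity_2d_pt f x y -> continuous (fun s => f s y) x.
Proof.
  move=> H P [e He]; have [d Hd] := H e.
  exists d => s Hs; apply: He; apply: Hd => //.
  by rewrite Rminus_diag Rabs_R0; apply: cond_pos.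
Qed.

Lemma continuity_2d_pt_slice2 (f : R -> R -> R) x y :
  continuity_2d_pt f x y -> continuous (fun t => f x t) y.
Proof.
  move=> H P [e He]; have [d Hd] := H e.
  exists d => s Hs; apply: He; apply: Hd => //.
  by rewrite Rminus_diag Rabs_R0; apply: cond_pos.
Qed.

Lemma ex_RInt_slice1 (f : R -> R -> R) x1 x2 y : x1 <= x2 ->
  (forall s, x1 <= s <= x2 -> continuity_2d_pt f s y) ->
  ex_RInt (fun s => f s y) x1 x2.
Proof.
  move=> Hx Hf; apply: ex_RInt_continuous => s.
  rewrite Rmin_left // Rmax_right // => Hs.
  exact/continuity_2d_pt_slice1/Hf.
Qed.

Lemma ex_RInt_slice2 (f : R -> R -> R) x y1 y2 : y1 <= y2 ->
  (forall t, y1 <= t <= y2 -> continuity_2d_pt f x t) ->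
  ex_RInt (f x) y1 y2.
Proof.
  move=> Hx Hf; apply: ex_RInt_continuous => s.
  rewrite Rmin_left // Rmax_right // => Hs.
  exact/continuity_2d_pt_slice2/Hf.
Qed.

(** [circulation] is the counterclockwise integral of P ds + Q dt along the boundary of a rectangle;
    the four quarters traverse each inner edge twice, in opposite directions. *)
Lemma circulation_split (P Q : R -> R -> R) x y w h : 0 <= w -> 0 <= h ->
  (forall s t, x <= s <= x + 2 * w -> y <= t <= y + 2 * h ->
     continuity_2d_pt P s t /\ continuity_2d_pt Q s t) ->
  circulation P Q x y (2 * w) (2 * h) =
  circulation P Q x y w h + circulation P Q (x + w) y w h +
  (circulation P Q x (y + h) w h + circulation P Q (x + w) (y + h) w h).
Proof.
  move=> Hw Hh Hc; rewrite /circulation.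
  have HQ s : x <= s <= x + 2 * w ->
    RInt (Q s) y (y + h) + RInt (Q s) (y + h) (y + h + h) = RInt (Q s) y (y + h + h).
  { move=> Hs; apply: (RInt_Chasles (V := R_CompleteNormedModule));
      apply: ex_RInt_slice2; try lra; move=> t Ht; apply Hc; lra. }
  have HP t : y <= t <= y + 2 * h ->
    RInt (fun s => P s t) x (x + w) + RInt (fun s => P s t) (x + w) (x + w + w)
    = RInt (fun s => P s t) x (x + w + w).
  { move=> Ht; apply: (RInt_Chasles (V := R_CompleteNormedModule));
      apply: ex_RInt_slice1; try lra; move=> s Hs; apply Hc; lra. }
  have -> : x + 2 * w = x + w + w by lra.
  have -> : y + 2 * h = y + h + h by lra.
  have H1 := HQ x ltac:(lra); have H2 := HQ (x + w) ltac:(lra).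
  have H3 := HQ (x + w + w) ltac:(lra).
  have H4 := HP y ltac:(lra); have H5 := HP (y + h) ltac:(lra).
  have H6 := HP (y + h + h) ltac:(lra).
  lra.
Qed.

Lemma RInt_increment_bound (f g : R -> R) a b l M : a <= b ->
  ex_RInt f a b -> ex_RInt g a b ->
  (forall t, a <= t <= b -> Rabs (f t - g t - l) <= M) ->
  Rabs (RInt f a b - RInt g a b - (b - a) * l) <= (b - a) * M.
Proof.
  move=> Hab Hf Hg H.
  have Hc : ex_RInt (fun _ : R => l) a b by apply: ex_RInt_const.
  have Hfg : ex_RInt (fun t => f t - g t) a b
    by apply: (ex_RInt_minus (V := R_NormedModule)).
  have <- : RInt (fun t => f t - g t - l) a b = RInt f a b - RInt g a b - (b - a) * l.
  { rewrite (RInt_minus (V := R_CompleteNormedModule) (fun t => f t - g t)) //.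
    rewrite (RInt_minus (V := R_CompleteNormedModule)) //.
    by rewrite RInt_const. }
  apply: abs_RInt_le_const => //.
  exact: (ex_RInt_minus (V := R_NormedModule)).
Qed.

Lemma differentiable_pt_lim_continuity_2d f x y a b :
  differentiable_pt_lim f x y a b -> continuity_2d_pt f x y.
Proof. by move=> H; apply: differentiable_continuity_pt; exists a, b. Qed.

(** The form is closed at (u, v): dP/dt and dQ/ds share the value [l]. Hence the linear parts of the
    two pairs of opposite sides both contribute l w h, with opposite signs, and only the
    differentiability errors remain. *)
Lemma circulation_local (P Q : R -> R -> R) u v p q l eps :
  differentiable_pt_lim P u v p l -> differentiable_pt_lim Q u v l q -> 0 < eps ->
  exists d, 0 < d /\ forall x y w h, 0 <= w < d -> 0 <= h < d ->
    x <= u <= x + w -> y <= v <= y + h ->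
    (forall s t, x <= s <= x + w -> y <= t <= y + h ->
       continuity_2d_pt P s t /\ continuity_2d_pt Q s t) ->
    Rabs (circulation P Q x y w h) <= 2 * eps * ((w + h) * (w + h)).
Proof.
  move=> HP HQ He; have [d1 H1] := HP (mkposreal _ He); have [d2 H2] := HQ (mkposreal _ He).
  exists (Rmin d1 d2); split; first by apply: Rmin_pos; apply: cond_pos.
  move=> x y w h Hw Hh Hu Hv Hc.
  have L1 := Rmin_l d1 d2; have L2 := Rmin_r d1 d2.
  have Hm s t : x <= s <= x + w -> y <= t <= y + h ->
    Rabs (s - u) < Rmin d1 d2 /\ Rabs (t - v) < Rmin d1 d2 /\
    Rmax (Rabs (s - u)) (Rabs (t - v)) <= w + h.
  { move=> Hs Ht; split; first (apply: Rabs_def1; lra).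
    split; first (apply: Rabs_def1; lra).
    apply: Rmax_lub; apply: Rabs_le; lra. }
  have EP s t : x <= s <= x + w -> y <= t <= y + h ->
    Rabs (P s t - P u v - (p * (s - u) + l * (t - v))) <= eps * (w + h).
  { move=> Hs Ht; have [A [B D]] := Hm s t Hs Ht.
    apply: Rle_trans (H1 s t _ _) _; try lra.
    apply: Rmult_le_compat_l => /=; lra. }
  have EQ s t : x <= s <= x + w -> y <= t <= y + h ->
    Rabs (Q s t - Q u v - (l * (s - u) + q * (t - v))) <= eps * (w + h).
  { move=> Hs Ht; have [A [B D]] := Hm s t Hs Ht.
    apply: Rle_trans (H2 s t _ _) _; try lra.
    apply: Rmult_le_compat_l => /=; lra. }
  have B1 : Rabs (RInt (Q (x + w)) y (y + h) - RInt (Q x) y (y + h)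
      - (y + h - y) * (l * w)) <= (y + h - y) * (2 * eps * (w + h)).
  { apply: RInt_increment_bound; try lra.
    - apply: ex_RInt_slice2; try lra; move=> t Ht; apply Hc; lra.
    - apply: ex_RInt_slice2; try lra; move=> t Ht; apply Hc; lra.
    - move=> t Ht; have := EQ (x + w) t; have := EQ x t.
      move=> /(_ ltac:(lra) Ht) /Rabs_le_between A /(_ ltac:(lra) Ht) /Rabs_le_between B.
      apply: Rabs_le; lra. }
  have B2 : Rabs (RInt (fun s => P s (y + h)) x (x + w) - RInt (fun s => P s y) x (x + w)
      - (x + w - x) * (l * h)) <= (x + w - x) * (2 * eps * (w + h)).
  { apply: RInt_increment_bound; try lra.
    - apply: ex_RInt_slice1; try lra; move=> t Ht; apply Hc; lra.
    - apply: ex_RInt_slice1; try lra; move=> t Ht; apply Hc; lra.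
    - move=> s Hs; have := EP s (y + h); have := EP s y.
      move=> /(_ Hs ltac:(lra)) /Rabs_le_between A /(_ Hs ltac:(lra)) /Rabs_le_between B.
      apply: Rabs_le; lra. }
  rewrite /circulation; move/Rabs_le_between: B1 => B1; move/Rabs_le_between: B2 => B2.
  apply: Rabs_le; nra.
Qed.

(* Goursat's bisection: if the circulation exceeded K times the area on the whole rectangle,
   it would do so on a nested sequence of rectangles of the same shape. *)
Lemma circulation_zero (P Q : R -> R -> R) a b c d : a < b -> c < d ->
  (forall s t, a <= s <= b -> c <= t <= d -> exists p q l,
     differentiable_pt_lim P s t p l /\ differentiable_pt_lim Q s t l q) ->
  circulation P Q a c (b - a) (d - c) = 0.
Proof.
  move=> Hab Hcd HD.
  have Hc s t : a <= s <= b -> c <= t <= d ->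
    continuity_2d_pt P s t /\ continuity_2d_pt Q s t.
  { move=> Hs Ht; have [p [q [l [H1 H2]]]] := HD s t Hs Ht.
    split; [exact: differentiable_pt_lim_continuity_2d H1
           |exact: differentiable_pt_lim_continuity_2d H2]. }
  case: (Req_dec (circulation P Q a c (b - a) (d - c)) 0) => // Hnz; exfalso.
  pose W n := (b - a) / 2 ^ n; pose H n := (d - c) / 2 ^ n.
  have p2 n : 0 < 2 ^ n by apply: pow_lt; lra.
  have WS n : W n = 2 * W n.+1 by rewrite /W /=; field; have := p2 n; lra.
  have HS n : H n = 2 * H n.+1 by rewrite /H /=; field; have := p2 n; lra.
  have Wp n : 0 < W n by apply: Rdiv_lt_0_compat => //; lra.
  have Hp n : 0 < H n by apply: Rdiv_lt_0_compat => //; lra.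
  pose area := (b - a) * (d - c).
  have Ha : 0 < area by rewrite /area; nra.
  (* The factor 2 makes the inequality in [Bad] strict on the initial rectangle. *)
  pose K := Rabs (circulation P Q a c (b - a) (d - c)) / (2 * area).
  have HK : 0 < K by apply: Rdiv_lt_0_compat; [apply: Rabs_pos_lt|lra].
  pose Bad n (z : R * R) := a <= z.1 /\ z.1 + W n <= b /\ c <= z.2 /\ z.2 + H n <= d /\
    K * (W n * H n) < Rabs (circulation P Q z.1 z.2 (W n) (H n)).
  have step n (z : R * R) : Bad n z -> exists z', Bad n.+1 z' /\
     (z.1 <= z'.1 /\ z'.1 + W n.+1 <= z.1 + W n) /\
     (z.2 <= z'.2 /\ z'.2 + H n.+1 <= z.2 + H n).
  { case: z => x y /= [B1 [B2 [B3 [B4 B5]]]]; simpl in *.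
    apply: NNPP => Hno.
    have w1 := Wp n.+1; have h1 := Hp n.+1; have w2 := WS n; have h2 := HS n.
    have small x' y' : (x' = x \/ x' = x + W n.+1) -> (y' = y \/ y' = y + H n.+1) ->
       Rabs (circulation P Q x' y' (W n.+1) (H n.+1)) <= K * (W n.+1 * H n.+1).
    { move=> Hx Hy; apply: Rnot_lt_le => Hlt; apply: Hno; exists (x', y').
      rewrite /Bad /=; repeat split; try lra. }
    have S1 := small x y (or_introl erefl) (or_introl erefl).
    have S2 := small _ y (or_intror erefl) (or_introl erefl).
    have S3 := small x _ (or_introl erefl) (or_intror erefl).
    have S4 := small _ _ (or_intror erefl) (or_intror erefl).
    move: B5; rewrite w2 h2 circulation_split; try lra; last first.
      by move=> s t Hs Ht; apply: Hc; lra.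
    move/Rabs_le_between: S1 => S1; move/Rabs_le_between: S2 => S2.
    move/Rabs_le_between: S3 => S3; move/Rabs_le_between: S4 => S4.
    apply: Rle_not_lt; apply: Rabs_le; lra. }
  have start : Bad 0%N (a, c).
  { rewrite /Bad /W /H /=; repeat split; try lra.
    rewrite !Rdiv_1_r -/area.
    have -> : K * area = Rabs (circulation P Q a c (b - a) (d - c)) / 2
      by rewrite /K; field; lra.
    have := Rabs_pos_lt _ Hnz; lra. }
  pose next n (s : {z | Bad n z}) : {z' | Bad n.+1 z'} :=
    let w := constructive_indefinite_description _ (step n (sval s) (proj2_sig s)) in
    exist _ (sval w) (proj1 (proj2_sig w)).
  pose sq := fix sq n : {z | Bad n z} :=
    match n with O => exist _ (a, c) start | S n' => next n' (sq n') end.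
  pose X n := (sval (sq n)).1; pose Y n := (sval (sq n)).2.
  have HB n : Bad n (X n, Y n).
  { rewrite /X /Y; case: (sq n) => -[x y] /= Hz; exact: Hz. }
  have Hst n : (X n <= X n.+1 /\ X n.+1 + W n.+1 <= X n + W n) /\
               (Y n <= Y n.+1 /\ Y n.+1 + H n.+1 <= Y n + H n).
  { rewrite /X /Y /= /next /=.
    by case: (constructive_indefinite_description _ _) => z' /= [_]. }
  have limit (Z : nat -> R) (V : nat -> R) : (forall n, 0 < V n) ->
    (forall n, Z n <= Z n.+1 /\ Z n.+1 + V n.+1 <= Z n + V n) ->
    exists u, forall n, Z n <= u <= Z n + V n.
  { move=> HV HZ.
    have mono n k : Z n <= Z (n + k)%N /\ Z (n + k)%N + V (n + k)%N <= Z n + V n.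
    { elim: k => [|k IH]; first by rewrite addn0; lra.
      rewrite addnS; have := HZ (n + k)%N; lra. }
    have cross n m : Z n <= Z m + V m.
    { case: (leqP n m) => Hnm.
      - have := mono n (m - n)%N; rewrite subnKC //; have := HV m; lra.
      - have := mono m (n - m)%N; rewrite subnKC; last exact: ltnW.
        have := HV n; lra. }
    have [||u [Hu1 Hu2]] := completeness (fun r => exists n, r = Z n).
    { by exists (Z O + V O) => r [n ->]. }
    { by exists (Z O), O. }
    exists u => n; split; first by apply: Hu1; exists n.
    by apply: Hu2 => r [m ->]. }
  have [u Hu] := limit X W Wp (fun n => proj1 (Hst n)).
  have [v Hv] := limit Y H Hp (fun n => proj2 (Hst n)).
  have [p [q [l [D1 D2]]]] : exists p q l,
     differentiable_pt_lim P u v p l /\ differentiable_pt_lim Q u v l q.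
  { have [A1 [A2 [A3 [A4 _]]]] := HB O; have := Hu O; have := Hv O; simpl in *.
    move=> ? ?; apply: HD; lra. }
  pose S := (b - a) + (d - c).
  have Sp : 0 < S by rewrite /S; lra.
  (* All rectangles are similar, so (w + h)^2 = (S^2 / area) w h at every stage; this [e] turns the
     local bound 2 e (w + h)^2 into half of K w h, below the lower bound kept by [Bad]. *)
  pose e := K * area / (4 * (S * S)).
  have ep : 0 < e by apply: Rdiv_lt_0_compat; nra.
  have [dl [dp Hloc]] := circulation_local P Q u v p q l e D1 D2 ep.
  have [n Hn] : exists n, S / 2 ^ n < dl.
  { have [n Hn] := pow_lt_1_zero (/ 2) ltac:(rewrite Rabs_pos_eq; lra) (dl / S)
      ltac:(apply: Rdiv_lt_0_compat; lra).
    exists n; have := Hn n (Nat.le_refl n).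
    rewrite Rabs_pos_eq; last by apply: pow_le; lra.
    rewrite pow_inv => Hlt.
    have -> : dl = S * (dl / S) by field; lra.
    rewrite /Rdiv; apply: Rmult_lt_compat_l => //. }
  have [A1 [A2 [A3 [A4 A5]]]] := HB n; simpl in *.
  have Hw : W n + H n = S / 2 ^ n by rewrite /W /H /S; field; have := p2 n; lra.
  have w0 := Wp n; have h0 := Hp n.
  have := Hloc (X n) (Y n) (W n) (H n) ltac:(lra) ltac:(lra) (Hu n) (Hv n)
    ltac:(move=> s t Hs Ht; apply: Hc; lra).
  apply: Rlt_not_le.
  apply: Rle_lt_trans A5; rewrite Hw /e.
  have -> : W n * H n = area / (2 ^ n * 2 ^ n) by rewrite /W /H /area; field; have := p2 n; lra.
  have -> : 2 * (K * area / (4 * (S * S))) * (S / 2 ^ n * (S / 2 ^ n))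
     = (K * (area / (2 ^ n * 2 ^ n))) / 2 by field; split; [have := p2 n; lra|lra].
  have : 0 < K * (area / (2 ^ n * 2 ^ n)); last lra.
  apply: Rmult_lt_0_compat => //; apply: Rdiv_lt_0_compat => //.
  have := p2 n; nra.
Qed.

Lemma sq_cos_sin r t : (r * cos t) * (r * cos t) + (r * sin t) * (r * sin t) = r * r.
Proof. have := sin2_cos2 t; rewrite /Rsqr; nra. Qed.

Lemma differentiable_polar f s t a b :
  differentiable_pt_lim f (exp s * cos t) (exp s * sin t) a b ->
  differentiable_pt_lim (fun s t => f (exp s * cos t) (exp s * sin t)) s t
    (a * (exp s * cos t) + b * (exp s * sin t))
    (a * (- (exp s * sin t)) + b * (exp s * cos t)).
Proof.
  move=> H.
  have G g l1 l2 : differentiable_pt_lim (fun x y => x * y) (exp s) (g t) (g t) (exp s) ->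
     derivable_pt_lim g t l2 -> l1 = exp s * l2 ->
     differentiable_pt_lim (fun s t => exp s * g t) s t (exp s * g t) l1.
  { move=> M D ->.
    have := differentiable_pt_lim_comp _ (fun s _ => exp s) (fun _ t => g t) s t _ _ _ _ _ _ M
      (differentiable_pt_lim_proj1_0 exp s t _ (derivable_pt_lim_exp s)).
    have D2 : differentiable_pt_lim (fun _ t => g t) s t 0 l2.
    { move=> e; have [d Hd] := differentiable_pt_lim_proj1_0 g t s _ D e.
      exists d => u v Hu Hv; have := Hd v u Hv Hu.
      by rewrite Rmax_comm Rplus_comm !Rmult_0_l. }
    move/(_ _ _ D2); congr differentiable_pt_lim; ring. }
  have M x y : differentiable_pt_lim (fun x y => x * y) x y y x.
  { move=> e; exists e => u v Hu Hv.
    have -> : u * v - x * y - (y * (u - x) + x * (v - y)) = (u - x) * (v - y) by ring.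
    rewrite Rabs_mult; apply: Rmult_le_compat; try apply: Rabs_pos; first lra.
    exact: Rmax_r. }
  apply: (differentiable_pt_lim_comp f (fun s t => exp s * cos t)
    (fun s t => exp s * sin t)) H _ _.
  - apply: (G cos) (derivable_pt_lim_cos t) _; [exact: M|ring].
  - apply: (G sin) (derivable_pt_lim_sin t) _; [exact: M|ring].
Qed.

(** In the conformal coordinates e^s (cos t, sin t) the Cauchy-Riemann equations say that v ds + u
    dt is closed. On the rectangle of (s, t) over the annulus, the sides t = 0 and t = 2 pi cancel
    by periodicity, and the other two are the circle integrals. *)
Lemma annulus_mean (u v : R -> R -> R) r1 r2 : 0 < r1 < r2 ->
  (forall x y, r1 * r1 <= x * x + y * y <= r2 * r2 -> exists a b,
     differentiable_pt_lim u x y a (- b) /\ differentiable_pt_lim v x y b a) ->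
  RInt (fun t => u (r1 * cos t) (r1 * sin t)) 0 (2 * PI) =
  RInt (fun t => u (r2 * cos t) (r2 * sin t)) 0 (2 * PI).
Proof.
  move=> Hr H.
  pose Q s t := u (exp s * cos t) (exp s * sin t).
  pose P s t := v (exp s * cos t) (exp s * sin t).
  have hl : ln r1 < ln r2 by apply: ln_increasing; lra.
  have hp := PI_RGT_0.
  have key : forall s t, ln r1 <= s <= ln r2 -> 0 <= t <= 2 * PI ->
    exists p q l, differentiable_pt_lim P s t p l /\ differentiable_pt_lim Q s t l q;
    last first.
  { have := circulation_zero P Q (ln r1) (ln r2) 0 (2 * PI) hl ltac:(lra) key.
    rewrite /circulation !Rplus_minus.
    have -> : (fun s => P s (2 * PI)) = (fun s => P s 0).
    { apply: functional_extensionality => s.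
      by rewrite /P cos_2PI sin_2PI cos_0 sin_0. }
    rewrite /Q !exp_ln; lra. }
  move=> s t Hs Ht.
  have [|a [b [D1 D2]]] := H (exp s * cos t) (exp s * sin t).
  { rewrite sq_cos_sin.
    have E1 : r1 <= exp s by rewrite -(exp_ln r1); [case: (Req_dec (ln r1) s) => [->|Hn]; [lra|left; apply: exp_increasing; lra]|lra].
    have E2 : exp s <= r2 by rewrite -(exp_ln r2); [case: (Req_dec s (ln r2)) => [->|Hn]; [lra|left; apply: exp_increasing; lra]|lra].
    nra. }
  have K2 := differentiable_polar _ _ _ _ _ D2.
  have K1 := differentiable_polar _ _ _ _ _ D1.
  do 3 eexists; split; first exact: K2.
  rewrite /Q.
  have -> : b * - (exp s * sin t) + a * (exp s * cos t)
     = a * (exp s * cos t) + - b * (exp s * sin t) by ring.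
  exact: K1.
Qed.

Lemma circle_mean_continuous (u : R -> R -> R) :
  (forall x y, x * x + y * y <= 1 -> continuity_2d_pt u x y) ->
  forall r0 eps, 0 <= r0 <= 1 -> 0 < eps -> exists d, 0 < d /\
    forall r, 0 <= r <= 1 -> Rabs (r - r0) < d ->
    Rabs (RInt (fun t => u (r * cos t) (r * sin t)) 0 (2 * PI)
        - RInt (fun t => u (r0 * cos t) (r0 * sin t)) 0 (2 * PI)) <= eps.
Proof.
  move=> H r0 eps Hr0 He; have hp := PI_RGT_0.
  pose f r t := u (r * cos t) (r * sin t).
  have Hf r t : 0 <= r <= 1 -> continuity_2d_pt f r t.
  { move=> Hr e.
    have [d Hd] := H (r * cos t) (r * sin t) ltac:(rewrite sq_cos_sin; nra) e.
    have C1 : continuity_2d_pt (fun r t => r * cos t) r t.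
    { apply: continuity_2d_pt_mult; first exact: continuity_2d_pt_id1.
      apply: continuity_1d_2d_pt_comp; [exact: continuity_cos|exact: continuity_2d_pt_id2]. }
    have C2 : continuity_2d_pt (fun r t => r * sin t) r t.
    { apply: continuity_2d_pt_mult; first exact: continuity_2d_pt_id1.
      apply: continuity_1d_2d_pt_comp; [exact: continuity_sin|exact: continuity_2d_pt_id2]. }
    have [d1 H1] := C1 d; have [d2 H2] := C2 d.
    exists (mkposreal _ (Rmin_pos _ _ (cond_pos d1) (cond_pos d2))) => x y /= Hx Hy.
    have L1 := Rmin_l d1 d2; have L2 := Rmin_r d1 d2.
    apply: Hd; [apply: H1|apply: H2]; lra. }
  have e2 : 0 < eps / (2 * PI) by apply: Rdiv_lt_0_compat; lra.
  have [d Hd] := uniform_continuity_2d_1d' f 0 (2 * PI) r0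
    (fun t _ => Hf r0 t Hr0) (mkposreal _ e2).
  exists d; split; first exact: cond_pos.
  move=> r Hr Hrd.
  have I1 : ex_RInt (f r) 0 (2 * PI) by apply: ex_RInt_slice2; [lra|move=> t _; exact: Hf].
  have I2 : ex_RInt (f r0) 0 (2 * PI) by apply: ex_RInt_slice2; [lra|move=> t _; exact: Hf].
  have := RInt_increment_bound (f r) (f r0) 0 (2 * PI) 0 (eps / (2 * PI)) ltac:(lra) I1 I2.
  rewrite Rmult_0_r !Rminus_0_r.
  have -> : 2 * PI * (eps / (2 * PI)) = eps by field; lra.
  apply=> t Ht; rewrite Rminus_0_r; left.
  move/Rabs_lt_between: Hrd => Hrd.
  apply: (Hd t r0 t r) => //; try (have := cond_pos d; lra).
  rewrite Rminus_diag Rabs_R0; exact: cond_pos.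
Qed.

(* The exceptional circle of radius sqrt rho costs nothing: the mean is continuous in the
   radius, and locally constant off that circle. *)
Lemma circle_mean (u v : R -> R -> R) rho : rho < 1 ->
  (forall x y, x * x + y * y <= 1 -> continuity_2d_pt u x y) ->
  (forall x y, 0 < x * x + y * y <= 1 -> x * x + y * y <> rho -> exists a b,
     differentiable_pt_lim u x y a (- b) /\ differentiable_pt_lim v x y b a) ->
  RInt (fun t => u (cos t) (sin t)) 0 (2 * PI) = 2 * PI * u 0 0.
Proof.
  move=> Hrho Hc Hd; have hp := PI_RGT_0.
  pose J r := RInt (fun t => u (r * cos t) (r * sin t)) 0 (2 * PI).
  have J0 : J 0 = 2 * PI * u 0 0.
  { rewrite /J -[RHS](_ : RInt (fun _ : R => u 0 0) 0 (2 * PI) = _).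
      by congr (RInt _ 0 (2 * PI)); apply: functional_extensionality => t; rewrite !Rmult_0_l.
    rewrite RInt_const /scal /= /mult /=; ring. }
  have J1 : J 1 = RInt (fun t => u (cos t) (sin t)) 0 (2 * PI).
  { by rewrite /J; congr (RInt _ 0 (2 * PI)); apply: functional_extensionality => t;
      rewrite !Rmult_1_l. }
  rewrite -J0 -J1.
  have Jc := circle_mean_continuous u Hc.
  have Ja r1 r2 : 0 < r1 < r2 -> r2 <= 1 -> (rho < r1 * r1 \/ r2 * r2 < rho) -> J r1 = J r2.
  { move=> Hr Hr2 Hrr; apply: (annulus_mean _ v) => // x y Hxy; apply: Hd; nra. }
  have Jr p q : 0 <= p < q -> q <= 1 -> (forall r, p < r < q -> J r = J q) -> J p = J q.
  { move=> Hp Hq Hpq; apply: cond_eq => eps He.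
    have [d [dp Hdd]] := Jc p (eps / 2) ltac:(lra) ltac:(lra).
    pose r := p + Rmin d (q - p) / 2.
    have L1 := Rmin_l d (q - p); have L2 := Rmin_r d (q - p).
    have L3 : 0 < Rmin d (q - p) by apply: Rmin_pos; lra.
    rewrite -(Hpq r) /r; last lra.
    rewrite Rabs_minus_sym; apply: Rle_lt_trans (Hdd _ _ _) _; try lra.
    apply: Rabs_def1; lra. }
  have Jl p q : 0 <= p < q -> q <= 1 -> (forall r, p < r < q -> J r = J p) -> p > 0 -> J q = J p.
  { move=> Hp Hq Hpq Hp0; apply: cond_eq => eps He.
    have [d [dp Hdd]] := Jc q (eps / 2) ltac:(lra) ltac:(lra).
    pose r := q - Rmin d (q - p) / 2.
    have L1 := Rmin_l d (q - p); have L2 := Rmin_r d (q - p).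
    have L3 : 0 < Rmin d (q - p) by apply: Rmin_pos; lra.
    rewrite -(Hpq r) /r; last lra.
    rewrite Rabs_minus_sym; apply: Rle_lt_trans (Hdd _ _ _) _; try lra.
    apply: Rabs_def1; lra. }
  case: (Rle_lt_dec rho 0) => Hr0.
  { symmetry; apply: Jr; try lra; move=> r Hr; apply: Ja; try lra; left; nra. }
  (* The radius r0 / 2 stands for the open interval inside the exceptional circle: the integral is
     carried from 0 to r0 / 2, from there up to r0, and from r0 to 1. *)
  pose r0 := sqrt rho.
  have r0p : 0 < r0 by apply: sqrt_lt_R0.
  have r0s : r0 * r0 = rho by apply: sqrt_sqrt; lra.
  have r01 : r0 < 1 by nra.
  have E1 : J 0 = J (r0 / 2).
  { apply: Jr; try lra; move=> r Hr; apply: Ja; try lra; right; nra. }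
  have E2 : J r0 = J (r0 / 2).
  { apply: Jl; try lra; move=> r Hr; symmetry; apply: Ja; try lra; right; nra. }
  have E3 : J r0 = J 1.
  { apply: Jr; try lra; move=> r Hr; apply: Ja; try lra; left; nra. }
  lra.
Qed.

(** * Complex arithmetic and limits *)

Set Implicit Arguments. Unset Strict Implicit. Unset Printing Implicit Defensive.

HB.instance Definition _ := Monoid.isComLaw.Build R 0 Rplus
  (fun x y z => esym (Rplus_assoc x y z)) Rplus_comm Rplus_0_l.
HB.instance Definition _ := Monoid.isMulLaw.Build R 0 Rmult Rmult_0_l Rmult_0_r.
HB.instance Definition _ := Monoid.isAddLaw.Build R Rmult Rplus
  (fun x y z => Rmult_plus_distr_r x y z) (fun x y z => Rmult_plus_distr_l x y z).

Lemma Ceq z w : Re z = Re w -> Im z = Im w -> z = w.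
Proof. by case: z => a b; case: w => c d /= -> ->. Qed.

Ltac creal := apply: Ceq => /=.

Lemma CaddA : associative Cadd. Proof. move=> x y z; creal; ring. Qed.
Lemma CaddC : commutative Cadd. Proof. move=> x y; creal; ring. Qed.
Lemma Cadd0 : left_id C0 Cadd. Proof. move=> x; creal; ring. Qed.
Lemma CmulA : associative Cmul. Proof. move=> x y z; creal; ring. Qed.
Lemma CmulC : commutative Cmul. Proof. move=> x y; creal; ring. Qed.
Lemma Cmul1 : left_id C1 Cmul. Proof. move=> x; creal; ring. Qed.
Lemma Cmul0l : left_zero C0 Cmul. Proof. move=> x; creal; ring. Qed.
Lemma Cmul0r : right_zero C0 Cmul. Proof. move=> x; creal; ring. Qed.
Lemma CmulDl : left_distributive Cmul Cadd. Proof. move=> x y z; creal; ring. Qed.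
Lemma CmulDr : right_distributive Cmul Cadd. Proof. move=> x y z; creal; ring. Qed.
HB.instance Definition _ := Monoid.isComLaw.Build C C0 Cadd CaddA CaddC Cadd0.
HB.instance Definition _ := Monoid.isComLaw.Build C C1 Cmul CmulA CmulC Cmul1.
HB.instance Definition _ := Monoid.isMulLaw.Build C C0 Cmul Cmul0l Cmul0r.
HB.instance Definition _ := Monoid.isAddLaw.Build C Cmul Cadd CmulDl CmulDr.

Definition Cinv (z : C) : C := mkC (Re z / Cnorm2 z) (- Im z / Cnorm2 z).
Definition Cdiv (z w : C) : C := Cmul z (Cinv w).

Lemma Cnorm2_ge0 z : 0 <= Cnorm2 z. Proof. rewrite /Cnorm2; nra. Qed.
Lemma Cnorm2_eq0 z : Cnorm2 z = 0 -> z = C0.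
Proof. by rewrite /Cnorm2 => H; creal; nra. Qed.
Lemma Cnorm2_pos z : z <> C0 -> 0 < Cnorm2 z.
Proof.
  move=> H; have := Cnorm2_ge0 z; case/Rle_lt_or_eq_dec => // /esym /Cnorm2_eq0; done.
Qed.

Lemma C_field_theory : field_theory C0 C1 Cadd Cmul Csub Copp Cdiv Cinv eq.
Proof.
  constructor; last 1 first.
  - move=> z /Cnorm2_pos; rewrite /Cnorm2 => H; creal; rewrite /Cnorm2; field; lra.
  - constructor => *; by [exact: Cadd0|exact: CaddC|exact: CaddA|exact: Cmul1|exact: CmulC
      |exact: CmulA|exact: CmulDl|creal; ring].
  - by move=> /(f_equal Re) /=; lra.
  - by [].
Qed.
Add Field C_field : C_field_theory.

Lemma Cnorm2M z w : Cnorm2 (Cmul z w) = Cnorm2 z * Cnorm2 w.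
Proof. rewrite /Cnorm2 /=; ring. Qed.
Lemma Cnorm2_opp z : Cnorm2 (Copp z) = Cnorm2 z.
Proof. rewrite /Cnorm2 /=; ring. Qed.
Lemma Cnorm2_conj z : Cnorm2 (Cconj z) = Cnorm2 z.
Proof. rewrite /Cnorm2 /=; ring. Qed.
Lemma Cnorm2_RtoC r : Cnorm2 (RtoC r) = r * r.
Proof. rewrite /Cnorm2 /=; ring. Qed.
Lemma Cnorm2_0 : Cnorm2 C0 = 0. Proof. rewrite /Cnorm2 /=; ring. Qed.
Lemma Cnorm2_1 : Cnorm2 C1 = 1. Proof. rewrite /Cnorm2 /=; ring. Qed.
Lemma Cnorm2_neq0 z : 0 < Cnorm2 z -> z <> C0.
Proof. by move=> H E; move: H; rewrite E Cnorm2_0; lra. Qed.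
Lemma Cnorm2_inv z : z <> C0 -> Cnorm2 (Cinv z) = / Cnorm2 z.
Proof. move/Cnorm2_pos; rewrite /Cnorm2 /= /Cnorm2 => H; field; lra. Qed.
Lemma Cmul_conj z : Cmul z (Cconj z) = RtoC (Cnorm2 z).
Proof. rewrite /Cnorm2; creal; ring. Qed.
Lemma Cnorm2_add z w : Cnorm2 (Cadd z w) <= 2 * Cnorm2 z + 2 * Cnorm2 w.
Proof.
  have := Rle_0_sqr (Re z - Re w); have := Rle_0_sqr (Im z - Im w).
  rewrite /Rsqr /Cnorm2 /=; lra.
Qed.
Lemma CmulI z w : Cmul z w = C0 -> z <> C0 -> w = C0.
Proof.
  move=> H Hz; have -> : w = Cmul (Cinv z) (Cmul z w) by field.
  by rewrite H; ring.
Qed.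
Lemma Csub_eq0 z w : Csub z w = C0 -> z = w.
Proof. move=> H; have -> : z = Cadd (Csub z w) w by ring. rewrite H; ring. Qed.

Lemma sumR_split I (r : seq I) (P : pred I) (F G : I -> R) :
  \big[Rplus/0]_(i <- r | P i) (F i + G i) =
  \big[Rplus/0]_(i <- r | P i) F i + \big[Rplus/0]_(i <- r | P i) G i.
Proof. exact: big_split. Qed.
Lemma sumR_distr I (r : seq I) (P : pred I) (F : I -> R) a :
  a * \big[Rplus/0]_(i <- r | P i) F i = \big[Rplus/0]_(i <- r | P i) (a * F i).
Proof. exact: big_distrr. Qed.
Lemma sumR_D1 n (j : 'I_n) (F : 'I_n -> R) :
  \big[Rplus/0]_(i < n) F i = F j + \big[Rplus/0]_(i < n | i != j) F i.
Proof. exact: bigD1. Qed.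
Lemma sumC_split I (r : seq I) (P : pred I) (F G : I -> C) :
  \big[Cadd/C0]_(i <- r | P i) Cadd (F i) (G i) =
  Cadd (\big[Cadd/C0]_(i <- r | P i) F i) (\big[Cadd/C0]_(i <- r | P i) G i).
Proof. exact: big_split. Qed.
Lemma sumC_distr I (r : seq I) (P : pred I) (F : I -> C) a :
  Cmul a (\big[Cadd/C0]_(i <- r | P i) F i) = \big[Cadd/C0]_(i <- r | P i) Cmul a (F i).
Proof. exact: big_distrr. Qed.
Lemma sumC_D1 n (j : 'I_n) (F : 'I_n -> C) :
  \big[Cadd/C0]_(i < n) F i = Cadd (F j) (\big[Cadd/C0]_(i < n | i != j) F i).
Proof. exact: bigD1. Qed.
Lemma sumC_exchange I J (r : seq I) (s : seq J) (F : I -> J -> C) :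
  \big[Cadd/C0]_(i <- r) \big[Cadd/C0]_(j <- s) F i j =
  \big[Cadd/C0]_(j <- s) \big[Cadd/C0]_(i <- r) F i j.
Proof. exact: exchange_big. Qed.
Lemma sumC_delta n (j : 'I_n) (F : 'I_n -> C) :
  \big[Cadd/C0]_(i < n) Cmul (if i == j then C1 else C0) (F i) = F j.
Proof.
  rewrite (sumC_D1 j) eqxx big1 => [|i /negbTE ->]; ring.
Qed.

Lemma Re_sum I (r : seq I) (P : pred I) (F : I -> C) :
  Re (\big[Cadd/C0]_(i <- r | P i) F i) = \big[Rplus/0]_(i <- r | P i) Re (F i).
Proof. by apply: (big_morph Re). Qed.
Lemma Im_sum I (r : seq I) (P : pred I) (F : I -> C) :
  Im (\big[Cadd/C0]_(i <- r | P i) F i) = \big[Rplus/0]_(i <- r | P i) Im (F i).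
Proof. by apply: (big_morph Im). Qed.
Lemma sum_opp I (r : seq I) (P : pred I) (F : I -> C) :
  Copp (\big[Cadd/C0]_(i <- r | P i) F i) = \big[Cadd/C0]_(i <- r | P i) Copp (F i).
Proof. by apply: (big_morph Copp) => [x y|]; ring. Qed.
Lemma sum_sub I (r : seq I) (P : pred I) (F G : I -> C) :
  \big[Cadd/C0]_(i <- r | P i) Csub (F i) (G i) =
  Csub (\big[Cadd/C0]_(i <- r | P i) F i) (\big[Cadd/C0]_(i <- r | P i) G i).
Proof. by rewrite sumC_split /Csub sum_opp. Qed.
Lemma sum_RtoC I (r : seq I) (P : pred I) (F : I -> R) :
  RtoC (\big[Rplus/0]_(i <- r | P i) F i) = \big[Cadd/C0]_(i <- r | P i) RtoC (F i).
Proof. by apply: (big_morph RtoC) => [x y|//]; creal; ring. Qed.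
Lemma sum_conj I (r : seq I) (P : pred I) (F : I -> C) :
  Cconj (\big[Cadd/C0]_(i <- r | P i) F i) = \big[Cadd/C0]_(i <- r | P i) Cconj (F i).
Proof. by apply: (big_morph Cconj) => [x y|]; creal; ring. Qed.

Lemma sumR_ge0 I (r : seq I) (P : pred I) (F : I -> R) : (forall i, P i -> 0 <= F i) ->
  0 <= \big[Rplus/0]_(i <- r | P i) F i.
Proof. by move=> H; apply: (big_ind (fun x => 0 <= x)) => //; [lra|move=> *; lra]. Qed.
Lemma sumR_le I (r : seq I) (P : pred I) (F G : I -> R) : (forall i, P i -> F i <= G i) ->
  \big[Rplus/0]_(i <- r | P i) F i <= \big[Rplus/0]_(i <- r | P i) G i.
Proof. by move=> H; apply: (big_ind2 (fun x y => x <= y)) => //; [lra|move=> *; lra]. Qed.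
Lemma sumR_term_le n (F : 'I_n -> R) j : (forall i, 0 <= F i) ->
  F j <= \big[Rplus/0]_(i < n) F i.
Proof.
  move=> H; rewrite (sumR_D1 j) -{1}[F j]Rplus_0_r; apply: Rplus_le_compat_l.
  by apply: sumR_ge0.
Qed.
Lemma sumR_eq0 n (F : 'I_n -> R) : (forall i, 0 <= F i) ->
  \big[Rplus/0]_(i < n) F i = 0 -> forall i, F i = 0.
Proof. by move=> H H0 i; have := H i; have := sumR_term_le i H; lra. Qed.
Lemma sumR_const n (c : R) : \big[Rplus/0]_(i < n) c = INR n * c.
Proof.
  elim: n => [|n IH]; first by rewrite big_ord0 /=; ring.
  by rewrite (big_ord_recl n) IH S_INR /=; ring.
Qed.

Lemma vnorm2_ge0 n (z : vec n) : 0 <= vnorm2 z.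
Proof. by apply: sumR_ge0 => i _; apply: Cnorm2_ge0. Qed.
Lemma vnorm2_coord n (z : vec n) i : Cnorm2 (z i) <= vnorm2 z.
Proof. by apply: (sumR_term_le (F := fun i => Cnorm2 (z i))) => j; apply: Cnorm2_ge0. Qed.
Lemma vnorm2_eq0 n (z : vec n) : vnorm2 z = 0 -> z = fun _ => C0.
Proof.
  move=> H; apply: functional_extensionality => i; apply: Cnorm2_eq0.
  by apply: (sumR_eq0 (F := fun i => Cnorm2 (z i))) => // j; apply: Cnorm2_ge0.
Qed.
Lemma vnorm2_0 n : vnorm2 (fun _ : 'I_n => C0) = 0.
Proof. by rewrite /vnorm2 big1 // => i _; rewrite Cnorm2_0. Qed.
Lemma vnorm2_scale n a (z : vec n) : vnorm2 (fun i => Cmul a (z i)) = Cnorm2 a * vnorm2 z.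
Proof. by rewrite /vnorm2 sumR_distr; apply: eq_bigr => i _; rewrite Cnorm2M. Qed.
Lemma vnorm2_add n (z w : vec n) : vnorm2 (vadd z w) <= 2 * vnorm2 z + 2 * vnorm2 w.
Proof.
  rewrite /vnorm2 !sumR_distr -sumR_split; apply: sumR_le => i _; exact: Cnorm2_add.
Qed.
Lemma vsubxx n (z : vec n) : vnorm2 (vsub z z) = 0.
Proof.
  rewrite -[RHS](vnorm2_0 n); congr vnorm2; apply: functional_extensionality => i.
  by rewrite /vsub; ring.
Qed.
Lemma vsub_eq n (w z : vec n) : vnorm2 (vsub w z) = 0 -> w = z.
Proof.
  move/vnorm2_eq0 => H; apply: functional_extensionality => i.
  by apply: Csub_eq0; rewrite -/(vsub w z i) H.
Qed.
Lemma vsub0 n (z : vec n) : vsub z (fun _ => C0) = z.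
Proof. by apply: functional_extensionality => i; rewrite /vsub; ring. Qed.
Lemma vaddK n (z w : vec n) : vadd z (vsub w z) = w.
Proof. by apply: functional_extensionality => i; rewrite /vadd /vsub; ring. Qed.
Lemma vsub_vadd n (z h : vec n) : vsub (vadd z h) z = h.
Proof. by apply: functional_extensionality => i; rewrite /vadd /vsub; ring. Qed.

(** The squared norm of B a - S conj(b) equals B (A B - |S|^2), which settles B > 0; for B = 0 the
    vector b vanishes. *)
Lemma cauchy_schwarz n (a b : 'I_n -> C) :
  Cnorm2 (\big[Cadd/C0]_(j < n) Cmul (a j) (b j)) <= vnorm2 a * vnorm2 b.
Proof.
  set S := \big[Cadd/C0]_(j < n) _; set A := vnorm2 a; set B := vnorm2 b.
  have HA : 0 <= A by apply: vnorm2_ge0. have HB : 0 <= B by apply: vnorm2_ge0.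
  have : 0 <= vnorm2 (fun j => Csub (Cmul (RtoC B) (a j)) (Cmul S (Cconj (b j)))) by apply: vnorm2_ge0.
  have -> : vnorm2 (fun j => Csub (Cmul (RtoC B) (a j)) (Cmul S (Cconj (b j))))
     = B * B * A + Cnorm2 S * B - 2 * B * Re (Cmul (Cconj S) S).
  { rewrite {4}/S sumC_distr Re_sum /A /B /vnorm2 -/(vnorm2 b) -/B.
    rewrite [B * B * _]sumR_distr.
    have -> : Cnorm2 S * B = \big[Rplus/0]_(i < n) (Cnorm2 S * Cnorm2 (b i)) by rewrite -sumR_distr.
    rewrite -sumR_split /Rminus Ropp_mult_distr_l [- (2 * B) * _]sumR_distr -sumR_split.
    apply: eq_bigr => i _; rewrite /Cnorm2 /=; ring. }
  have -> : Re (Cmul (Cconj S) S) = Cnorm2 S by rewrite /Cnorm2 /=; ring.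
  move=> H; have HS := Cnorm2_ge0 S.
  case: (Rle_lt_or_eq_dec 0 B HB) => HB0; first nra.
  have Hb := vnorm2_eq0 (esym HB0).
  have -> : S = C0.
  { by rewrite /S Hb big1 // => i _; ring. }
  rewrite Cnorm2_0 -HB0; lra.
Qed.

(** * Neighbourhood filters and complex limits *)

Definition nb n (z : vec n) (P : vec n -> Prop) : Prop :=
  exists d, 0 < d /\ forall w, vnorm2 (vsub w z) < d * d -> P w.

Global Instance nb_filter n (z : vec n) : Filter (nb z).
Proof.
  constructor.
  - by exists 1; split; [lra|].
  - move=> P Q [d [Hd HP]] [e [He HQ]]; exists (Rmin d e); split; first exact: Rmin_pos.
    move=> w Hw; have L1 := Rmin_l d e; have L2 := Rmin_r d e.
    have L : 0 < Rmin d e by apply: Rmin_pos.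
    split; [apply: HP|apply: HQ]; nra.
  - by move=> P Q H [d [Hd HP]]; exists d; split=> // w Hw; apply/H/HP.
Qed.

Lemma nb_self n (z : vec n) (P : vec n -> Prop) : nb z P -> P z.
Proof. by case=> d [Hd H]; apply: H; rewrite vsubxx; nra. Qed.

Lemma nb_intro n (z : vec n) (P : vec n -> Prop) e : 0 < e ->
  (forall w, vnorm2 (vsub w z) < e -> P w) -> nb z P.
Proof.
  move=> He H; exists (sqrt e); split; first exact: sqrt_lt_R0.
  by move=> w; rewrite sqrt_sqrt; [exact: H|lra].
Qed.

Lemma filter_mono T (F : (T -> Prop) -> Prop) {FF : Filter F} (P Q : T -> Prop) :
  F P -> (forall x, P x -> Q x) -> F Q.
Proof. by move=> HP H; apply: (filter_imp P). Qed.

Lemma filter_forall_ord T (F : (T -> Prop) -> Prop) {FF : Filter F} n (P : 'I_n -> T -> Prop) :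
  (forall i, F (P i)) -> F (fun x => forall i, P i x).
Proof.
  move=> H.
  suff: forall s : seq 'I_n, F (fun x => forall i, i \in s -> P i x).
  { move/(_ (enum 'I_n))=> Hs; apply: (filter_mono (FF := FF) Hs) => x Hx i; apply: Hx; exact: mem_enum. }
  elim=> [|i s IH]; first by apply: filter_forall.
  apply: (filter_imp (fun x => P i x /\ forall j, j \in s -> P j x)); last exact: filter_and.
  by move=> x [H1 H2] j; rewrite inE => /orP [/eqP ->|/H2].
Qed.

Definition rlim T (f : T -> R) (F : (T -> Prop) -> Prop) (l : R) := filterlim f F (locally l).

Definition clim T (f : T -> C) (F : (T -> Prop) -> Prop) (l : C) : Prop :=
  rlim (fun x => Re (f x)) F (Re l) /\ rlim (fun x => Im (f x)) F (Im l).

Lemma rlim_const T F {FF : Filter F} (c : R) : rlim (fun _ : T => c) F c.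
Proof. exact: filterlim_const. Qed.
Lemma rlim_add T F {FF : Filter F} (f g : T -> R) a b :
  rlim f F a -> rlim g F b -> rlim (fun x => f x + g x) F (a + b).
Proof. by move=> H1 H2; apply: (filterlim_comp_2 f g Rplus H1 H2); exact: (filterlim_plus (V := R_NormedModule)). Qed.
Lemma rlim_mul T F {FF : Filter F} (f g : T -> R) a b :
  rlim f F a -> rlim g F b -> rlim (fun x => f x * g x) F (a * b).
Proof. by move=> H1 H2; apply: (filterlim_comp_2 f g Rmult H1 H2); exact: (filterlim_mult (K := R_AbsRing)). Qed.
Lemma rlim_comp T F {FF : Filter F} (f : T -> R) (g : R -> R) a :
  rlim f F a -> continuity_pt g a -> rlim (fun x => g (f x)) F (g a).
Proof. by move=> H1 /continuity_pt_filterlim H2; exact: (filterlim_comp _ _ _ f g F _ _ H1 H2). Qed.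
Lemma rlim_opp T F {FF : Filter F} (f : T -> R) a :
  rlim f F a -> rlim (fun x => - f x) F (- a).
Proof. by move=> H1; apply: (filterlim_comp _ _ _ f Ropp F _ _ H1); exact: (filterlim_opp (V := R_NormedModule)). Qed.
Lemma rlim_inv T F {FF : Filter F} (f : T -> R) a :
  rlim f F a -> a <> 0 -> rlim (fun x => / f x) F (/ a).
Proof.
  move=> H1 Ha; apply: rlim_comp => //; apply: derivable_continuous_pt.
  exact: (derivable_pt_inv id a Ha (derivable_pt_id a)).
Qed.
Lemma rlim_gt T F {FF : Filter F} (f : T -> R) a b :
  rlim f F a -> b < a -> F (fun x => b < f x).
Proof. by move=> H Hb; apply: (H (fun y => b < y)); apply: open_gt. Qed.
Lemma rlim_lt T F {FF : Filter F} (f : T -> R) a b :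
  rlim f F a -> a < b -> F (fun x => f x < b).
Proof. by move=> H Hb; apply: (H (fun y => y < b)); apply: open_lt. Qed.

Lemma clim_const T F {FF : Filter F} c : clim (fun _ : T => c) F c.
Proof. split; exact: rlim_const. Qed.
Lemma clim_add T F {FF : Filter F} (f g : T -> C) a b :
  clim f F a -> clim g F b -> clim (fun x => Cadd (f x) (g x)) F (Cadd a b).
Proof. by move=> [? ?] [? ?]; split; apply: rlim_add. Qed.
Lemma clim_opp T F {FF : Filter F} (f : T -> C) a :
  clim f F a -> clim (fun x => Copp (f x)) F (Copp a).
Proof. by move=> [? ?]; split; apply: rlim_opp. Qed.
Lemma clim_sub T F {FF : Filter F} (f g : T -> C) a b :
  clim f F a -> clim g F b -> clim (fun x => Csub (f x) (g x)) F (Csub a b).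
Proof. by move=> H1 H2; apply: clim_add => //; apply: clim_opp. Qed.
Lemma clim_mul T F {FF : Filter F} (f g : T -> C) a b :
  clim f F a -> clim g F b -> clim (fun x => Cmul (f x) (g x)) F (Cmul a b).
Proof.
  move=> [? ?] [? ?]; split; last by apply: rlim_add; apply: rlim_mul.
  by apply: rlim_add; [|apply: rlim_opp]; apply: rlim_mul.
Qed.
Lemma rlim_Cnorm2 T F {FF : Filter F} (f : T -> C) a :
  clim f F a -> rlim (fun x => Cnorm2 (f x)) F (Cnorm2 a).
Proof. by move=> [? ?]; apply: rlim_add; apply: rlim_mul. Qed.
Lemma clim_inv T F {FF : Filter F} (f : T -> C) a :
  clim f F a -> a <> C0 -> clim (fun x => Cinv (f x)) F (Cinv a).
Proof.
  move=> H /Cnorm2_pos Ha; have H2 := rlim_Cnorm2 (FF := FF) H.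
  have H3 := rlim_inv (FF := FF) H2 ltac:(lra).
  by case: H => ? ?; split; apply: rlim_mul => //; apply: rlim_opp.
Qed.
Lemma clim_sum T F {FF : Filter F} I (r : seq I) (P : pred I) (f : I -> T -> C) a :
  (forall i, clim (f i) F (a i)) ->
  clim (fun x => \big[Cadd/C0]_(i <- r | P i) f i x) F (\big[Cadd/C0]_(i <- r | P i) a i).
Proof.
  move=> H; elim: r => [|i r IH].
  - rewrite big_nil; have -> : (fun x => \big[Cadd/C0]_(i <- [::] | P i) f i x) = fun _ : T => C0
      by apply: functional_extensionality => x; rewrite big_nil.
    exact: clim_const.
  - have -> : (fun x => \big[Cadd/C0]_(i <- i :: r | P i) f i x) =
      fun x => Cadd (if P i then f i x else C0) (\big[Cadd/C0]_(i <- r | P i) f i x).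
    { apply: functional_extensionality => x; rewrite big_cons; case: (P i) => //; ring. }
    have -> : \big[Cadd/C0]_(i <- i :: r | P i) a i =
      Cadd (if P i then a i else C0) (\big[Cadd/C0]_(i <- r | P i) a i).
    { rewrite big_cons; case: (P i) => //; ring. }
    apply: clim_add => //; case: (P i) => //; exact: clim_const.
Qed.

Lemma Rabs_lt_sq a b e : 0 < e -> a * a + b * b < e * e -> Rabs a < e /\ Rabs b < e.
Proof. by move=> He H; have := Rle_0_sqr a; have := Rle_0_sqr b; rewrite /Rsqr => *;
  split; apply: Rabs_def1; nra. Qed.

Lemma clim_eps T F {FF : Filter F} (f : T -> C) l :
  clim f F l <-> forall e, 0 < e -> F (fun x => Cnorm2 (Csub (f x) l) < e).
Proof.
  split=> [H e He|H].
  - apply: (rlim_lt (f := fun x => Cnorm2 (Csub (f x) l)) (a := 0)) => //.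
    have := rlim_Cnorm2 (FF := FF) (clim_sub H (clim_const l)).
    have -> : Cnorm2 (Csub l l) = 0 by rewrite /Cnorm2 /=; ring.
    by move=> /(_ _ _).
  - have G e : 0 < e -> F (fun x => Rabs (Re (f x) - Re l) < e /\ Rabs (Im (f x) - Im l) < e).
    { move=> He; apply: (filter_mono (FF := FF) (H (e * e) ltac:(nra))) => x; exact: Rabs_lt_sq. }
    split; apply/filterlim_locally => e.
    + by apply: (filter_mono (FF := FF) (G e (cond_pos e))) => x [].
    + by apply: (filter_mono (FF := FF) (G e (cond_pos e))) => x [].
Qed.

Lemma clim_ext T F {FF : Filter F} (f g : T -> C) l :
  F (fun x => f x = g x) -> clim f F l -> clim g F l.
Proof.
  move=> E /clim_eps H; apply/clim_eps => e He.
  apply: (filter_mono (FF := FF) (filter_and _ _ E (H e He))) => x [-> //].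
Qed.

Lemma clim_coord n (z : vec n) i : clim (fun w : vec n => w i) (nb z) (z i).
Proof.
  apply/clim_eps => e He; apply: (nb_intro He) => w; apply: Rle_lt_trans.
  exact: (vnorm2_coord (vsub w z)).
Qed.

(** * Complex differentiability *)

(* Caratheodory's form of differentiability, which turns the product and chain rules into
   algebra; it is equivalent to the epsilon-delta form of [holo_at]. *)
Definition has_grad n (f : vec n -> C) (z : vec n) (a : 'I_n -> C) : Prop :=
  exists Phi : 'I_n -> vec n -> C,
    (forall j, clim (Phi j) (nb z) (a j)) /\
    nb z (fun w => f w = Cadd (f z) (\big[Cadd/C0]_(j < n) Cmul (Phi j w) (Csub (w j) (z j)))).

Definition cdiff n (f : vec n -> C) (z : vec n) : Prop := exists a, has_grad f z a.

Lemma clim_cst_sub n (z : vec n) j : clim (fun w : vec n => Csub (w j) (z j)) (nb z) C0.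
Proof.
  have -> : C0 = Csub (z j) (z j) by ring.
  apply: clim_sub; [exact: clim_coord|exact: clim_const].
Qed.

Lemma has_grad_clim n (f : vec n -> C) z a : has_grad f z a -> clim f (nb z) (f z).
Proof.
  move=> [Phi [H1 H2]].
  have E : nb z (fun w => Cadd (f z) (\big[Cadd/C0]_(j < n) Cmul (Phi j w) (Csub (w j) (z j))) = f w).
  { by apply: (filter_mono (FF := nb_filter z) H2) => w ->. }
  apply: (clim_ext E).
  have {2}-> : f z = Cadd (f z) (\big[Cadd/C0]_(j < n) Cmul (a j) C0).
  { rewrite big1 => [|i _]; ring. }
  apply: clim_add; first exact: clim_const.
  apply: clim_sum => j; apply: clim_mul => //; exact: clim_cst_sub.
Qed.

Lemma cdiff_clim n (f : vec n -> C) z : cdiff f z -> clim f (nb z) (f z).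
Proof. by case=> a /has_grad_clim. Qed.

Lemma has_grad_ext n (f g : vec n -> C) z a :
  nb z (fun w => f w = g w) -> has_grad f z a -> has_grad g z a.
Proof.
  move=> E [Phi [H1 H2]]; exists Phi; split=> //.
  have Ez := nb_self E.
  by apply: (filter_mono (FF := nb_filter z) (filter_and _ _ E H2)) => w [-> ->]; rewrite Ez.
Qed.

Lemma has_grad_const n c (z : vec n) : has_grad (fun _ => c) z (fun _ => C0).
Proof.
  exists (fun _ _ => C0); split; first by move=> j; exact: clim_const.
  apply: filter_forall => w; rewrite big1 => [|i _]; ring.
Qed.

Lemma has_grad_coord n (z : vec n) i :
  has_grad (fun w => w i) z (fun j => if j == i then C1 else C0).
Proof.
  exists (fun j _ => if j == i then C1 else C0); split; first by move=> j; exact: clim_const.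
  apply: filter_forall => w; rewrite sumC_delta; ring.
Qed.

Lemma has_grad_add n (f g : vec n -> C) z a b : has_grad f z a -> has_grad g z b ->
  has_grad (fun w => Cadd (f w) (g w)) z (fun j => Cadd (a j) (b j)).
Proof.
  move=> [P [H1 H2]] [Q [H3 H4]]; exists (fun j w => Cadd (P j w) (Q j w)); split.
  { by move=> j; apply: clim_add. }
  apply: (filter_mono (FF := nb_filter z) (filter_and _ _ H2 H4)) => w [-> ->].
  have -> : \big[Cadd/C0]_(j < n) Cmul (Cadd (P j w) (Q j w)) (Csub (w j) (z j)) =
    Cadd (\big[Cadd/C0]_(j < n) Cmul (P j w) (Csub (w j) (z j)))
         (\big[Cadd/C0]_(j < n) Cmul (Q j w) (Csub (w j) (z j))).
  { by rewrite -sumC_split; apply: eq_bigr => j _; ring. }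
  ring.
Qed.

Lemma has_grad_mul n (f g : vec n -> C) z a b : has_grad f z a -> has_grad g z b ->
  has_grad (fun w => Cmul (f w) (g w)) z (fun j => Cadd (Cmul (f z) (b j)) (Cmul (g z) (a j))).
Proof.
  move=> Hf Hg; have Cf := has_grad_clim Hf.
  case: Hf => [P [H1 H2]]; case: Hg => [Q [H3 H4]].
  exists (fun j w => Cadd (Cmul (f w) (Q j w)) (Cmul (g z) (P j w))); split.
  { move=> j; apply: clim_add; apply: clim_mul => //; exact: clim_const. }
  apply: (filter_mono (FF := nb_filter z) (filter_and _ _ H2 H4)) => w [E1 ->].
  have -> : \big[Cadd/C0]_(j < n) Cmul (Cadd (Cmul (f w) (Q j w)) (Cmul (g z) (P j w))) (Csub (w j) (z j)) =
    Cadd (Cmul (f w) (\big[Cadd/C0]_(j < n) Cmul (Q j w) (Csub (w j) (z j))))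
         (Cmul (g z) (\big[Cadd/C0]_(j < n) Cmul (P j w) (Csub (w j) (z j)))).
  { by rewrite !sumC_distr -sumC_split; apply: eq_bigr => j _; ring. }
  rewrite E1; ring.
Qed.

Lemma filterlim_coords n m (F : vec n -> vec m) z (l : vec m) :
  (forall i, clim (fun w => F w i) (nb z) (l i)) -> filterlim F (nb z) (nb l).
Proof.
  move=> HF.
  move=> P [d [Hd HP]].
    have H : forall i, nb z (fun w => Cnorm2 (Csub (F w i) (l i)) < d * d / (INR m + 1)).
    { move=> i; apply: (proj1 (clim_eps _ _) (HF i)).
      have := pos_INR m => ?; apply: Rdiv_lt_0_compat; nra. }
    apply: (filter_mono (FF := nb_filter z) (filter_forall_ord H)) => w Hw; apply: HP.
    apply: Rle_lt_trans (_ : INR m * (d * d / (INR m + 1)) < d * d).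
    - rewrite -sumR_const; apply: sumR_le => i _; left; exact: Hw.
    - have Hm := pos_INR m.
      have -> : INR m * (d * d / (INR m + 1)) = d * d - d * d / (INR m + 1) by field; lra.
      have : 0 < d * d / (INR m + 1) by apply: Rdiv_lt_0_compat; nra.
      lra.
Qed.

Lemma has_grad_comp n m (F : vec n -> vec m) (G : vec m -> C) z (A : 'I_m -> 'I_n -> C) b :
  (forall i, has_grad (fun w => F w i) z (A i)) -> has_grad G (F z) b ->
  has_grad (fun w => G (F w)) z (fun j => \big[Cadd/C0]_(i < m) Cmul (b i) (A i j)).
Proof.
  move=> HF [Q [H3 H4]].
  have CF := filterlim_coords (fun i => has_grad_clim (HF i)).
  pose P i := proj1_sig (constructive_indefinite_description _ (HF i)).
  have HP i : (forall j, clim (P i j) (nb z) (A i j)) /\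
    nb z (fun w => F w i = Cadd (F z i) (\big[Cadd/C0]_(j < n) Cmul (P i j w) (Csub (w j) (z j)))).
  { exact: proj2_sig (constructive_indefinite_description _ (HF i)). }
  exists (fun j w => \big[Cadd/C0]_(i < m) Cmul (Q i (F w)) (P i j w)); split.
  { move=> j; apply: clim_sum => i; apply: clim_mul; last by apply HP.
    case: (H3 i) => L1 L2; split.
    - exact: (filterlim_comp _ _ _ F (fun y => Re (Q i y)) _ _ _ CF L1).
    - exact: (filterlim_comp _ _ _ F (fun y => Im (Q i y)) _ _ _ CF L2). }
  have HG := CF _ H4; rewrite /filtermap in HG.
  have HPP := filter_forall_ord (FF := nb_filter z) (fun i => proj2 (HP i)).
  apply: (filter_mono (FF := nb_filter z) (filter_and _ _ HG HPP)) => w [-> E]; congr Cadd.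
  transitivity (\big[Cadd/C0]_(i < m) Cmul (Q i (F w))
     (\big[Cadd/C0]_(j < n) Cmul (P i j w) (Csub (w j) (z j)))).
  { apply: eq_bigr => i _; rewrite E; ring. }
  transitivity (\big[Cadd/C0]_(i < m) \big[Cadd/C0]_(j < n)
     Cmul (Q i (F w)) (Cmul (P i j w) (Csub (w j) (z j)))).
  { by apply: eq_bigr => i _; rewrite sumC_distr. }
  rewrite sumC_exchange; apply: eq_bigr => j _.
  rewrite [RHS]CmulC sumC_distr; apply: eq_bigr => i _; ring.
Qed.

Lemma cdiff_ext n (f g : vec n -> C) z : nb z (fun w => f w = g w) -> cdiff f z -> cdiff g z.
Proof. by move=> H [a Ha]; exists a; apply: has_grad_ext Ha. Qed.
Lemma cdiff_const n c (z : vec n) : cdiff (fun _ => c) z.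
Proof. by exists (fun _ => C0); apply: has_grad_const. Qed.
Lemma cdiff_coord n (z : vec n) i : cdiff (fun w => w i) z.
Proof. by eexists; apply: has_grad_coord. Qed.
Lemma cdiff_add n (f g : vec n -> C) z : cdiff f z -> cdiff g z ->
  cdiff (fun w => Cadd (f w) (g w)) z.
Proof. by move=> [a Ha] [b Hb]; eexists; apply: has_grad_add; eassumption. Qed.
Lemma cdiff_mul n (f g : vec n -> C) z : cdiff f z -> cdiff g z ->
  cdiff (fun w => Cmul (f w) (g w)) z.
Proof. by move=> [a Ha] [b Hb]; eexists; apply: has_grad_mul; eassumption. Qed.
Lemma cdiff_opp n (f : vec n -> C) z : cdiff f z -> cdiff (fun w => Copp (f w)) z.
Proof.
  move=> H; have -> : (fun w => Copp (f w)) = fun w => Cmul (Copp C1) (f w).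
  { by apply: functional_extensionality => w; ring. }
  by apply: cdiff_mul => //; apply: cdiff_const.
Qed.
Lemma cdiff_sub n (f g : vec n -> C) z : cdiff f z -> cdiff g z ->
  cdiff (fun w => Csub (f w) (g w)) z.
Proof. by move=> H1 H2; apply: cdiff_add => //; apply: cdiff_opp. Qed.
Lemma cdiff_scal n (f : vec n -> C) z a : cdiff f z -> cdiff (fun w => Cmul a (f w)) z.
Proof. by move=> H; apply: cdiff_mul => //; apply: cdiff_const. Qed.
Lemma cdiff_sum n I (r : seq I) (P : pred I) (f : I -> vec n -> C) z :
  (forall i, cdiff (f i) z) -> cdiff (fun w => \big[Cadd/C0]_(i <- r | P i) f i w) z.
Proof.
  move=> H; elim: r => [|i r IH].
  - have -> : (fun w => \big[Cadd/C0]_(i <- [::] | P i) f i w) = fun _ => C0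
      by apply: functional_extensionality => x; rewrite big_nil.
    exact: cdiff_const.
  - have -> : (fun w => \big[Cadd/C0]_(i <- i :: r | P i) f i w) =
      fun x => Cadd (if P i then f i x else C0) (\big[Cadd/C0]_(i <- r | P i) f i x).
    { apply: functional_extensionality => x; rewrite big_cons; case: (P i) => //; ring. }
    apply: cdiff_add => //; case: (P i) => //; exact: cdiff_const.
Qed.
Lemma choice_ord m T (P : 'I_m -> T -> Prop) :
  (forall i, exists x, P i x) -> exists f, forall i, P i (f i).
Proof.
  move=> H; exists (fun i => proj1_sig (constructive_indefinite_description _ (H i))) => i.
  exact: proj2_sig (constructive_indefinite_description _ (H i)).
Qed.
Lemma cdiff_comp n m (F : vec n -> vec m) (G : vec m -> C) z :
  (forall i, cdiff (fun w => F w i) z) -> cdiff G (F z) -> cdiff (fun w => G (F w)) z.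
Proof. by move=> /choice_ord [A HA] [b Hb]; eexists; apply: has_grad_comp; eassumption. Qed.

(** A chain rule for a function g given only through its difference quotient [Gam], which needs a
    limit at z. It serves the inverse, with quotient -1 / (f(w) f(z)), and the square root, with
    quotient 1 / (sqrt f(w) + sqrt f(z)). *)
Lemma cdiff_quotient n (f : vec n -> C) (g : C -> C) z (Gam : vec n -> C) l :
  cdiff f z -> clim Gam (nb z) l ->
  nb z (fun w => Csub (g (f w)) (g (f z)) = Cmul (Gam w) (Csub (f w) (f z))) ->
  cdiff (fun w => g (f w)) z.
Proof.
  move=> [a [P [H1 H2]]] HG E; exists (fun j => Cmul l (a j)), (fun j w => Cmul (Gam w) (P j w)); split.
  { by move=> j; apply: clim_mul. }
  apply: (filter_mono (FF := nb_filter z) (filter_and _ _ E H2)) => w [E1 E2].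
  have -> : \big[Cadd/C0]_(j < n) Cmul (Cmul (Gam w) (P j w)) (Csub (w j) (z j)) =
    Cmul (Gam w) (\big[Cadd/C0]_(j < n) Cmul (P j w) (Csub (w j) (z j))).
  { by rewrite sumC_distr; apply: eq_bigr => j _; ring. }
  have -> : g (f w) = Cadd (g (f z)) (Csub (g (f w)) (g (f z))) by ring.
  rewrite E1 E2; ring.
Qed.

Lemma cdiff_neq0 n (f : vec n -> C) z : cdiff f z -> f z <> C0 -> nb z (fun w => f w <> C0).
Proof.
  move=> /cdiff_clim H /Cnorm2_pos Hz.
  have H2 := rlim_gt (FF := nb_filter z) (rlim_Cnorm2 (FF := nb_filter z) H) Hz.
  by apply: (filter_mono (FF := nb_filter z) H2) => w /Cnorm2_neq0.
Qed.

Lemma cdiff_inv n (f : vec n -> C) z : cdiff f z -> f z <> C0 -> cdiff (fun w => Cinv (f w)) z.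
Proof.
  move=> H Hz; have Hc := cdiff_clim H.
  apply: (cdiff_quotient (Gam := fun w => Copp (Cmul (Cinv (f w)) (Cinv (f z)))) H).
  - apply: clim_opp; apply: clim_mul; [exact: (clim_inv Hc Hz)|exact: clim_const].
  - apply: (filter_mono (FF := nb_filter z) (cdiff_neq0 H Hz)) => w Hw; field; split=> //.
Qed.

Lemma Csqrt_sq z : Cmul (Csqrt z) (Csqrt z) = z.
Proof.
  have Ha : 0 <= Cnorm2 z by apply: Cnorm2_ge0.
  have Hs : Cabs z * Cabs z = Cnorm2 z by apply: sqrt_sqrt.
  have H0 : 0 <= Cabs z by apply: sqrt_pos.
  have HR : Rabs (Re z) <= Cabs z.
  { rewrite -(Rabs_pos_eq (Cabs z)) //; apply: Rsqr_le_abs_0; rewrite /Rsqr Hs /Cnorm2; nra. }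
  move/Rabs_le_between: HR => HR.
  set p := (Cabs z + Re z) / 2; set q := (Cabs z - Re z) / 2.
  have Hp : 0 <= p by rewrite /p; lra. have Hq : 0 <= q by rewrite /q; lra.
  have Sp := sqrt_sqrt p Hp; have Sq := sqrt_sqrt q Hq.
  have Hpq : sqrt p * sqrt q = Rabs (Im z) / 2.
  { rewrite -sqrt_mult //.
    have -> : p * q = (Rabs (Im z) / 2) * (Rabs (Im z) / 2).
    { have := Rsqr_abs (Im z); rewrite /Rsqr => E.
      have -> : (Rabs (Im z) / 2) * (Rabs (Im z) / 2) = (Im z * Im z) / 4 by rewrite E; field.
      have : p * q = (Cabs z * Cabs z - Re z * Re z) / 4 by rewrite /p /q; field.
      rewrite Hs /Cnorm2 => ->; field. }
    rewrite sqrt_square //; have := Rabs_pos (Im z); lra. }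
  creal; rewrite -/p -/q; case: Rle_dec => Hi.
  - rewrite Sp Sq /p /q; lra.
  - have -> : sqrt p * sqrt p - - sqrt q * - sqrt q = sqrt p * sqrt p - sqrt q * sqrt q by ring.
    rewrite Sp Sq /p /q; lra.
  - rewrite (Rmult_comm (sqrt q)) Hpq Rabs_pos_eq //; lra.
  - have -> : sqrt p * - sqrt q + - sqrt q * sqrt p = - 2 * (sqrt p * sqrt q) by ring.
    rewrite Hpq Rabs_left; lra.
Qed.

Lemma Re_Csqrt_ge0 z : 0 <= Re (Csqrt z).
Proof. exact: sqrt_pos. Qed.

Lemma Re_Csqrt_pos z : 0 < Re z -> 0 < Re (Csqrt z).
Proof.
  move=> H; apply: sqrt_lt_R0; have : 0 <= Cabs z by apply: sqrt_pos. lra.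
Qed.

(** Principal roots have nonnegative real part, so sqrt f(w) + sqrt f(z) has real part at least Re
    sqrt f(z) > 0 for every w. This bound gives continuity of the root first and then its difference
    quotient, with no case analysis at the cut. *)
Lemma cdiff_sqrt n (f : vec n -> C) z : cdiff f z -> 0 < Re (f z) -> cdiff (fun w => Csqrt (f w)) z.
Proof.
  move=> H Hz; have Hc := cdiff_clim H; have Hs := Re_Csqrt_pos Hz.
  pose S w := Cadd (Csqrt (f w)) (Csqrt (f z)).
  have Hn w : Re (Csqrt (f z)) * Re (Csqrt (f z)) <= Cnorm2 (S w).
  { rewrite /S; move: (Csqrt (f w)) (Csqrt (f z)) (Re_Csqrt_ge0 (f w)) Hs => p q.
    have := Rle_0_sqr (Im p + Im q); rewrite /Rsqr /Cnorm2 /= => *; nra. }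
  have HnS w : S w <> C0 by apply: Cnorm2_neq0; have := Hn w; nra.
  have E w : Csub (Csqrt (f w)) (Csqrt (f z)) = Cmul (Cinv (S w)) (Csub (f w) (f z)).
  { rewrite -{2}(Csqrt_sq (f w)) -{2}(Csqrt_sq (f z)).
    have := HnS w; rewrite /S => ?; by field. }
  have L : clim (fun w => Csqrt (f w)) (nb z) (Csqrt (f z)).
  { apply/clim_eps => e He.
    set s := Re (Csqrt (f z)) in Hs Hn.
    have He2 : 0 < e * (s * s) by do 2 apply: Rmult_lt_0_compat => //.
    apply: (filter_mono (FF := nb_filter z) (proj1 (clim_eps _ _) Hc _ He2)) => w Hw.
    rewrite E Cnorm2M Cnorm2_inv //.
    have HS := Hn w; have Hss : 0 < s * s by nra.
    apply: (Rmult_lt_reg_l (Cnorm2 (S w))); first lra.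
    rewrite -Rmult_assoc Rinv_r ?Rmult_1_l; [nra|lra]. }
  apply: (cdiff_quotient (Gam := fun w => Cinv (S w)) H).
  - apply: clim_inv; last exact: HnS.
    by apply: clim_add => //; exact: clim_const.
  - by apply: filter_forall.
Qed.

Definition has_jac n m (F : vec n -> vec m) (z : vec n) (A : 'I_m -> 'I_n -> C) : Prop :=
  forall i, has_grad (fun w => F w i) z (A i).

Lemma has_grad_of_eps n (f : vec n -> C) (z : vec n) (a : 'I_n -> C) :
  (forall eps, 0 < eps -> exists delta, 0 < delta /\
      forall h : vec n, 0 < vnorm2 h -> vnorm2 h < delta * delta ->
       Cnorm2 (Csub (Csub (f (vadd z h)) (f z)) (\big[Cadd/C0]_(j < n) Cmul (a j) (h j)))
          <= eps * eps * vnorm2 h) -> has_grad f z a.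
Proof.
  move=> H.
  pose r w := Csub (Csub (f w) (f z)) (\big[Cadd/C0]_(j < n) Cmul (a j) (Csub (w j) (z j))).
  (* The remainder r(w) is spread over the coordinates along the conjugate increment; as the
     products of h_j and conj(h_j) sum to |h|^2, the expansion is exact. At w = z the convention / 0
     = 0 makes the correction vanish. *)
  pose Phi j w := Cadd (a j) (Cmul (Cmul (r w) (Cconj (Csub (w j) (z j)))) (RtoC (/ vnorm2 (vsub w z)))).
  exists Phi; split.
  - move=> j; apply/clim_eps => e He.
    have [d [Hd Hd2]] := H (sqrt (e / 2)) ltac:(apply: sqrt_lt_R0; lra).
    exists d; split=> // w Hw.
    have -> : Csub (Phi j w) (a j) = Cmul (Cmul (r w) (Cconj (Csub (w j) (z j)))) (RtoC (/ vnorm2 (vsub w z))).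
    { rewrite /Phi; ring. }
    rewrite !Cnorm2M Cnorm2_conj Cnorm2_RtoC.
    set V := vnorm2 (vsub w z).
    have [HV|HV] := Rle_lt_or_eq_dec _ _ (vnorm2_ge0 (vsub w z)); last first.
    { rewrite /V -HV Rinv_0; lra. }
    have := Hd2 (vsub w z) HV Hw; rewrite vaddK -/(r w) sqrt_sqrt -/V; last lra.
    rewrite -/V in HV => Hr.
    have Hj : Cnorm2 (Csub (w j) (z j)) <= V by exact: (vnorm2_coord (vsub w z)).
    have Hrp := Cnorm2_ge0 (r w); have Hjp := Cnorm2_ge0 (Csub (w j) (z j)).
    apply: Rle_lt_trans (_ : e / 2 < e); last lra.
    have -> : e / 2 = (e / 2 * V * V) * (/ V * / V) by field; lra.
    apply: Rmult_le_compat_r; first by have := Rinv_0_lt_compat V HV; nra.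
    nra.
  - apply: filter_forall => w.
    have -> : \big[Cadd/C0]_(j < n) Cmul (Phi j w) (Csub (w j) (z j)) =
      Cadd (\big[Cadd/C0]_(j < n) Cmul (a j) (Csub (w j) (z j)))
       (Cmul (Cmul (r w) (RtoC (/ vnorm2 (vsub w z)))) (RtoC (vnorm2 (vsub w z)))).
    { rewrite {2}/vnorm2 sum_RtoC sumC_distr -sumC_split; apply: eq_bigr => j _.
      rewrite /Phi /vsub -Cmul_conj; ring. }
    have [HV|HV] := Rle_lt_or_eq_dec _ _ (vnorm2_ge0 (vsub w z)); last first.
    { rewrite -HV; have -> := vsub_eq (esym HV).
      rewrite big1 => [|i _]; last by ring.
      have -> : RtoC 0 = C0 by []. ring. }
    have -> : Cmul (Cmul (r w) (RtoC (/ vnorm2 (vsub w z)))) (RtoC (vnorm2 (vsub w z))) = r w.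
    { creal; field; lra. }
    rewrite /r; ring.
Qed.

Lemma has_jac_of_eps n m (F : vec n -> vec m) (z : vec n) A :
  (forall eps, 0 < eps -> exists delta, 0 < delta /\
      forall h : vec n, 0 < vnorm2 h -> vnorm2 h < delta * delta ->
        vnorm2 (vsub (vsub (F (vadd z h)) (F z)) (mxapp A h))
          <= eps * eps * vnorm2 h) -> has_jac F z A.
Proof.
  move=> H i; apply: has_grad_of_eps => e He; have [d [Hd H2]] := H e He.
  exists d; split=> // h Hh Hh2; apply: Rle_trans (H2 h Hh Hh2).
  exact: (vnorm2_coord (vsub (vsub (F (vadd z h)) (F z)) (mxapp A h)) i).
Qed.

Lemma has_jac_eps n m (F : vec n -> vec m) (z : vec n) A : has_jac F z A ->
  forall eps, 0 < eps -> exists delta, 0 < delta /\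
      forall h : vec n, 0 < vnorm2 h -> vnorm2 h < delta * delta ->
        vnorm2 (vsub (vsub (F (vadd z h)) (F z)) (mxapp A h))
          <= eps * eps * vnorm2 h.
Proof.
  move=> H e He.
  have [Phi HP] := choice_ord H.
  (* Cauchy-Schwarz on each of the m rows bounds the squared error by m n c |h|^2; the added ones
     keep the quotient meaningful in dimension zero. *)
  pose c := e * e / ((INR m + 1) * (INR n + 1)).
  have Hm := pos_INR m; have Hn := pos_INR n.
  have Hc : 0 < c by apply: Rdiv_lt_0_compat; nra.
  have G1 i : nb z (fun w => forall j, Cnorm2 (Csub (Phi i j w) (A i j)) < c).
  { apply: filter_forall_ord => j; exact: (proj1 (clim_eps _ _) (proj1 (HP i) j)). }
  have [d [Hd G]] := filter_and _ _ (filter_forall_ord G1) (filter_forall_ord (fun i => proj2 (HP i))).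
  exists d; split=> // h _ Hh.
  have [K1 K2] := G (vadd z h) ltac:(rewrite vsub_vadd; exact: Hh).
  apply: Rle_trans (_ : INR m * (INR n * c * vnorm2 h) <= _); last first.
  { have Hv := vnorm2_ge0 h.
    have -> : INR m * (INR n * c * vnorm2 h) = (INR m * INR n * c) * vnorm2 h by ring.
    apply: Rmult_le_compat_r => //.
    apply: Rle_trans (_ : (INR m + 1) * (INR n + 1) * c <= _).
    - apply: Rmult_le_compat_r; nra.
    - right; rewrite /c; field; lra. }
  rewrite -sumR_const; apply: sumR_le => i _.
  have -> : vsub (vsub (F (vadd z h)) (F z)) (mxapp A h) i =
    \big[Cadd/C0]_(j < n) Cmul (Csub (Phi i j (vadd z h)) (A i j)) (h j).
  { rewrite /vsub /mxapp (K2 i).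
    have -> : \big[Cadd/C0]_(j < n) Cmul (Csub (Phi i j (vadd z h)) (A i j)) (h j)
      = Csub (\big[Cadd/C0]_(j < n) Cmul (Phi i j (vadd z h)) (Csub (vadd z h j) (z j)))
         (\big[Cadd/C0]_(j < n) Cmul (A i j) (h j)).
    { rewrite -sum_sub; apply: eq_bigr => j _; rewrite /vadd; ring. }
    ring. }
  apply: Rle_trans (cauchy_schwarz _ _) _.
  apply: Rmult_le_compat_r; first exact: vnorm2_ge0.
  rewrite -sumR_const; apply: sumR_le => j _; left; exact: K1.
Qed.

Lemma holo_at_jac n m (F : vec n -> vec m) z : holo_at F z <-> exists A, has_jac F z A.
Proof.
  split; first by case=> A /has_jac_of_eps HA; exists A.
  by case=> A HA; exists A; apply: has_jac_eps.
Qed.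

Lemma holo_at_cdiff n m (F : vec n -> vec m) z :
  holo_at F z <-> forall i, cdiff (fun w => F w i) z.
Proof.
  split; first by move/holo_at_jac => [A HA] i; exists (A i).
  by move/choice_ord => [A HA]; apply/holo_at_jac; exists A.
Qed.

Lemma has_jac_comp n m p (F : vec n -> vec m) (G : vec m -> vec p) z A B :
  has_jac F z A -> has_jac G (F z) B ->
  has_jac (fun w => G (F w)) z (fun i j => \big[Cadd/C0]_(l < m) Cmul (B i l) (A l j)).
Proof. by move=> HF HG i; apply: (has_grad_comp HF (HG i)). Qed.

(** * Schwarz lemma *)

(** One variable is encoded as [vec 1], so that the calculus of several variables applies as it
    stands. *)
Definition cdiff1 (f : C -> C) (z : C) : Prop :=
  cdiff (n := 1) (fun w => f (w ord0)) (fun _ => z).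
Definition ccont1 (f : C -> C) (z : C) : Prop :=
  clim (fun w : vec 1 => f (w ord0)) (nb (fun _ => z)) (f z).

Lemma cdiff1_cont f z : cdiff1 f z -> ccont1 f z.
Proof. exact: cdiff_clim. Qed.

Lemma cdiff1_comp f g z : cdiff1 g z -> cdiff1 f (g z) -> cdiff1 (fun w => f (g w)) z.
Proof.
  move=> Hg Hf.
  exact: (cdiff_comp (F := fun w : vec 1 => (fun _ => g (w ord0)) : vec 1)
     (G := fun w : vec 1 => f (w ord0)) (z := fun _ => z) (fun _ => Hg) Hf).
Qed.

Lemma ccont1_comp f g z : ccont1 g z -> ccont1 f (g z) -> ccont1 (fun w => f (g w)) z.
Proof.
  move=> Hg [H1 H2].
  have L := filterlim_coords (F := fun w : vec 1 => (fun _ => g (w ord0)) : vec 1)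
    (z := fun _ => z) (l := fun _ => g z) (fun _ => Hg).
  split.
  - exact: (filterlim_comp _ _ _ _ (fun y : vec 1 => Re (f (y ord0))) _ _ _ L H1).
  - exact: (filterlim_comp _ _ _ _ (fun y : vec 1 => Im (f (y ord0))) _ _ _ L H2).
Qed.

Lemma Rabs_le_sq a b : 0 <= b -> a * a <= b * b -> Rabs a <= b.
Proof. by move=> Hb H; apply: Rabs_le; nra. Qed.

Lemma vnorm2_1 (z : vec 1) : vnorm2 z = Cnorm2 (z ord0).
Proof. by rewrite /vnorm2 big_ord1. Qed.

Lemma cdiff1_real (f : C -> C) z : cdiff1 f z -> exists a b,
  differentiable_pt_lim (fun x y => Re (f (mkC x y))) (Re z) (Im z) a (- b) /\
  differentiable_pt_lim (fun x y => Im (f (mkC x y))) (Re z) (Im z) b a.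
Proof.
  move=> [a Ha].
  have HJ : has_jac (fun w : vec 1 => (fun _ : 'I_1 => f (w ord0)) : vec 1) (fun _ => z) (fun _ => a).
  { by move=> i. }
  have K eps : 0 < eps -> exists d, 0 < d /\ forall u v, Rabs (u - Re z) < d -> Rabs (v - Im z) < d ->
    Cnorm2 (Csub (Csub (f (mkC u v)) (f z)) (Cmul (a ord0) (mkC (u - Re z) (v - Im z))))
     <= (eps * Rmax (Rabs (u - Re z)) (Rabs (v - Im z))) * (eps * Rmax (Rabs (u - Re z)) (Rabs (v - Im z))).
  { move=> He; have [d [Hd H]] := has_jac_eps HJ (eps := eps / 2) ltac:(lra).
    exists (d / 2); split; first lra.
    move=> u v Hu Hv; set M := Rmax _ _.
    pose h : vec 1 := fun _ => mkC (u - Re z) (v - Im z).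
    have M1 : Rabs (u - Re z) <= M by apply: Rmax_l.
    have M2 : Rabs (v - Im z) <= M by apply: Rmax_r.
    have M3 : M < d / 2 by apply: Rmax_lub_lt.
    have M0 : 0 <= M by apply: Rle_trans M1; apply: Rabs_pos.
    have Nh : vnorm2 h <= 2 * (M * M).
    { rewrite vnorm2_1 /h /Cnorm2 /=.
      move/Rabs_le_between: M1 => M1; move/Rabs_le_between: M2 => M2; nra. }
    have E : vadd (fun _ => z) h = fun _ => mkC u v.
    { by apply: functional_extensionality => i; rewrite /vadd /h; creal; ring. }
    case: (Rle_lt_or_eq_dec _ _ (vnorm2_ge0 h)) => [Hh|Hh].
    - have := H h Hh ltac:(nra).
      rewrite {1}vnorm2_1 E /vsub /mxapp big_ord1 => Hle.
      apply: Rle_trans Hle _; nra.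
    - have Hz : h ord0 = C0 by rewrite (vnorm2_eq0 (esym Hh)).
      have Hu2 : mkC u v = z by move: (f_equal Re Hz) (f_equal Im Hz); rewrite /h /= => ? ?; creal; lra.
      rewrite Hu2 -/(h ord0) Hz.
      have -> : Cnorm2 (Csub (Csub (f z) (f z)) (Cmul (a ord0) C0)) = 0 by rewrite /Cnorm2 /=; ring.
      nra. }
  exists (Re (a ord0)), (Im (a ord0)); split=> e; have [d [Hd H]] := K e (cond_pos e);
    exists (mkposreal _ Hd) => u v Hu Hv; have := H u v Hu Hv; rewrite {1}/Cnorm2 /= => Hle;
    (apply: Rabs_le_sq; first by apply: Rmult_le_pos; [left; apply: cond_pos|apply: Rle_trans (Rmax_l _ _); apply: Rabs_pos]);
    apply: Rle_trans Hle; have -> : mkC (Re z) (Im z) = z by case: (z).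
  - match goal with |- _ <= ?A * ?A + ?B * ?B => have := Rle_0_sqr B; rewrite /Rsqr => HB;
      match goal with |- ?D * ?D <= _ => have -> : D = A by ring end; lra end.
  - match goal with |- _ <= ?A * ?A + ?B * ?B => have := Rle_0_sqr A; rewrite /Rsqr => HB;
      match goal with |- ?D * ?D <= _ => have -> : D = B by ring end; lra end.
Qed.

Lemma ccont1_real (f : C -> C) z : ccont1 f z ->
  continuity_2d_pt (fun x y => Re (f (mkC x y))) (Re z) (Im z).
Proof.
  move=> /clim_eps H e; have He := cond_pos e.
  have [d [Hd Hd2]] := H (e * e) ltac:(nra).
  exists (mkposreal (d / 2) ltac:(lra)) => u v /= Hu Hv.
  have := Hd2 (fun _ => mkC u v) _.
  have -> : mkC (Re z) (Im z) = z by case: (z).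
  move=> K; have {}K := K ltac:(rewrite vnorm2_1 /vsub /Cnorm2 /=;
     move/Rabs_lt_between: Hu => Hu; move/Rabs_lt_between: Hv => Hv; nra).
  exact: (proj1 (Rabs_lt_sq He K)).
Qed.

(** Slopes h(g(w)) / g(w) are known to be only continuous at the zero of g. Since the mean value
    property is proved through circles about 0, the whole circle through such a zero, of squared
    radius [rho], is exempted; a zero at the origin is exempt already. *)
Definition disc_holo (f : C -> C) (rho : R) : Prop :=
  rho < 1 /\ (forall z, Cnorm2 z <= 1 -> ccont1 f z) /\
  (forall z, 0 < Cnorm2 z <= 1 -> Cnorm2 z <> rho -> cdiff1 f z).

Lemma disc_mean f rho : disc_holo f rho ->
  RInt (fun t => Re (f (mkC (cos t) (sin t)))) 0 (2 * PI) = 2 * PI * Re (f C0).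
Proof.
  move=> [Hr [Hc Hd]].
  apply: (circle_mean (fun x y => Re (f (mkC x y))) (fun x y => Im (f (mkC x y))) rho) => //.
  - by move=> x y H; apply: (ccont1_real (z := mkC x y)); apply: Hc; rewrite /Cnorm2 /=.
  - by move=> x y H1 H2; apply: (cdiff1_real (z := mkC x y)); apply: Hd; rewrite /Cnorm2 /=.
Qed.

Lemma Cnorm2_cos_sin t : Cnorm2 (mkC (cos t) (sin t)) = 1.
Proof. rewrite /Cnorm2 /=; have := sin2_cos2 t; rewrite /Rsqr; lra. Qed.

Lemma disc_continuous f rho t : disc_holo f rho ->
  continuous (fun t => Re (f (mkC (cos t) (sin t)))) t.
Proof.
  move=> [_ [Hc _]].
  have := ccont1_real (Hc (mkC (cos t) (sin t)) ltac:(rewrite Cnorm2_cos_sin; lra)).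
  move=> H P [e He].
  have [d Hd] := H e.
  have [d1 H1] := proj1 (continuity_pt_filterlim cos t) (continuity_cos t) _ (locally_ball (cos t) d).
  have [d2 H2] := proj1 (continuity_pt_filterlim sin t) (continuity_sin t) _ (locally_ball (sin t) d).
  exists (mkposreal _ (Rmin_pos _ _ (cond_pos d1) (cond_pos d2))) => s Hs.
  apply: He; apply: Hd.
  - apply: H1; apply: Rlt_le_trans Hs (Rmin_l _ _).
  - apply: H2; apply: Rlt_le_trans Hs (Rmin_r _ _).
Qed.

Lemma disc_ex_RInt f rho a b : disc_holo f rho ->
  ex_RInt (fun t => Re (f (mkC (cos t) (sin t)))) a b.
Proof. move=> H; apply: ex_RInt_continuous => t _; exact: disc_continuous H. Qed.

Lemma disc_Re_le f rho B : disc_holo f rho ->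
  (forall z, Cnorm2 z = 1 -> Re (f z) <= B) -> Re (f C0) <= B.
Proof.
  move=> H HB; have hp := PI_RGT_0.
  have := RInt_le (fun t => Re (f (mkC (cos t) (sin t)))) (fun _ => B) 0 (2 * PI) ltac:(lra)
    (disc_ex_RInt _ _ H) (ex_RInt_const _ _ _) (fun t _ => HB _ (Cnorm2_cos_sin t)).
  rewrite (disc_mean H) RInt_const /scal /= /mult /=; nra.
Qed.

(** The gap B - Re f is continuous, nonnegative and of integral zero on the circle, so its primitive
    vanishes on [0, 2 pi] and so does its derivative at the inner point pi. The boundary point -1 =
    e^(i pi) is enough, because a caller can rotate any point into it. *)
Lemma disc_Re_rigid f rho B : disc_holo f rho ->
  (forall z, Cnorm2 z = 1 -> Re (f z) <= B) -> Re (f C0) = B -> Re (f (Copp C1)) = B.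
Proof.
  move=> H HB H0; have hp := PI_RGT_0.
  pose u t := Re (f (mkC (cos t) (sin t))).
  pose g t := B - u t.
  have gc t : continuous g t.
  { apply: (continuous_minus (V := R_NormedModule)); [exact: continuous_const|exact: disc_continuous H]. }
  have gI a b : ex_RInt g a b by apply: ex_RInt_continuous => t _; exact: gc.
  have g0 t : 0 <= g t by rewrite /g /u; have := HB _ (Cnorm2_cos_sin t); lra.
  have tot : RInt g 0 (2 * PI) = 0.
  { rewrite /g (RInt_minus (V := R_CompleteNormedModule)); [|exact: ex_RInt_const|exact: (disc_ex_RInt _ _ H)].
    rewrite RInt_const (disc_mean H) H0 /minus /plus /opp /scal /= /mult /=; ring. }
  have I0 x : 0 <= x <= 2 * PI -> RInt g 0 x = 0.
  { move=> Hx.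
    have A1 := RInt_ge_0 g 0 x ltac:(lra) (gI _ _) (fun t _ => g0 t).
    have A2 := RInt_ge_0 g x (2 * PI) ltac:(lra) (gI _ _) (fun t _ => g0 t).
    have := RInt_Chasles g 0 x (2 * PI) (gI _ _) (gI _ _); rewrite tot /plus /=; lra. }
  have D : is_derive (fun x => RInt g 0 x) PI (g PI).
  { apply: is_derive_RInt; last exact: gc.
    apply: filter_forall => x; exact: (RInt_correct (V := R_CompleteNormedModule)). }
  have Z : is_derive (fun x => RInt g 0 x) PI 0.
  { apply: (is_derive_ext_loc (fun _ => 0)); last exact: (is_derive_const (V := R_NormedModule)).
    exists (mkposreal PI hp) => y /Rabs_lt_between Hy; symmetry; apply: I0.
    move: Hy; rewrite /minus /plus /opp /=; lra. }
  have : g PI = 0 by rewrite -(is_derive_unique _ _ _ D) (is_derive_unique _ _ _ Z).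
  rewrite /g /u cos_PI sin_PI.
  have -> : Copp C1 = mkC (-1) 0 by creal; ring. lra.
Qed.

Lemma cdiff1_scal f a z : cdiff1 f z -> cdiff1 (fun w => Cmul a (f w)) z.
Proof. exact: cdiff_scal. Qed.

Lemma disc_holo_scal f rho a : disc_holo f rho -> disc_holo (fun z => Cmul a (f z)) rho.
Proof.
  move=> [H1 [H2 H3]]; split=> //; split=> z Hz.
  - apply: clim_mul; [exact: clim_const|exact: H2].
  - by move=> Hn; apply: cdiff1_scal; apply: H3.
Qed.

(** The bound for real parts is applied to f multiplied by the conjugate of f(0), whose value at 0
    is |f(0)|^2. *)
Lemma disc_max f rho B : 0 <= B -> disc_holo f rho ->
  (forall z, Cnorm2 z = 1 -> Cnorm2 (f z) <= B * B) -> Cnorm2 (f C0) <= B * B.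
Proof.
  move=> HB H Hm.
  set c := f C0; set s := sqrt (Cnorm2 c).
  have Hc := Cnorm2_ge0 c.
  have Hs : s * s = Cnorm2 c by apply: sqrt_sqrt.
  have s0 : 0 <= s by apply: sqrt_pos.
  have := disc_Re_le (disc_holo_scal (Cconj c) H) (B := s * B).
  rewrite -/c.
  have -> : Re (Cmul (Cconj c) c) = s * s by rewrite Hs /Cnorm2 /=; ring.
  move=> K; have {}K : s * s <= s * B.
  { apply: K => z Hz; have := Hm z Hz => Hz2.
    apply: Rle_trans (Rle_abs _) _; apply: Rabs_le_sq; first by apply: Rmult_le_pos.
    have : Cnorm2 (Cmul (Cconj c) (f z)) <= s * B * (s * B).
    { rewrite Cnorm2M Cnorm2_conj -Hs; have := Cnorm2_ge0 (f z); nra. }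
    rewrite {1}/Cnorm2; have := Rle_0_sqr (Im (Cmul (Cconj c) (f z))); rewrite /Rsqr; lra. }
  rewrite -Hs; nra.
Qed.

Lemma cdiff1_id z : cdiff1 id z.
Proof. exact: cdiff_coord. Qed.
Lemma cdiff1_const c z : cdiff1 (fun _ => c) z.
Proof. exact: cdiff_const. Qed.
Lemma cdiff1_add f g z : cdiff1 f z -> cdiff1 g z -> cdiff1 (fun w => Cadd (f w) (g w)) z.
Proof. exact: cdiff_add. Qed.
Lemma cdiff1_mul f g z : cdiff1 f z -> cdiff1 g z -> cdiff1 (fun w => Cmul (f w) (g w)) z.
Proof. exact: cdiff_mul. Qed.
Lemma cdiff1_inv f z : cdiff1 f z -> f z <> C0 -> cdiff1 (fun w => Cinv (f w)) z.
Proof. exact: cdiff_inv. Qed.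

Definition is_cder (h : C -> C) (z d : C) : Prop :=
  has_grad (n := 1) (fun w => h (w ord0)) (fun _ => z) (fun _ => d).

Lemma Ceq_dec (z w : C) : {z = w} + {z <> w}.
Proof. exact: excluded_middle_informative. Qed.

Definition dslope (h : C -> C) (d z : C) : C :=
  if Ceq_dec z C0 then d else Cdiv (h z) z.

Lemma dslope_eq h d z : h C0 = C0 -> h z = Cmul (dslope h d z) z.
Proof.
  rewrite /dslope; case: Ceq_dec => [Hz|Hz] h0 /=; first by rewrite Hz h0; ring.
  by rewrite /Cdiv; field.
Qed.

Lemma dslope_cont0 h d : h C0 = C0 -> is_cder h C0 d -> ccont1 (dslope h d) C0.
Proof.
  move=> h0 [Phi [H1 H2]].
  have E : dslope h d C0 = d by rewrite /dslope; case: Ceq_dec.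
  rewrite /ccont1 E; apply/clim_eps => e He.
  have H3 := proj1 (clim_eps (FF := nb_filter _) _ _) (H1 ord0) e He.
  apply: (filter_mono (FF := nb_filter (fun _ : 'I_1 => C0)) (filter_and _ _ H2 H3)) => w [].
  rewrite big_ord1 h0 => Ew Hw.
  rewrite /dslope; case: Ceq_dec => [Hz|Hz] /=.
  - have -> : Csub d d = C0 by ring. by rewrite Cnorm2_0.
  - have -> : Cdiv (h (w ord0)) (w ord0) = Phi ord0 w by rewrite Ew; field.
    exact: Hw.
Qed.

Lemma dslope_cdiff h d z : cdiff1 h z -> z <> C0 -> cdiff1 (dslope h d) z.
Proof.
  move=> Hh Hz.
  have Hi : cdiff1 (fun w => Cmul (h w) (Cinv w)) z.
  { apply: cdiff1_mul => //; apply: cdiff1_inv => //; exact: cdiff1_id. }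
  apply: cdiff_ext Hi.
  have := cdiff_neq0 (cdiff1_id z) Hz.
  move=> Hn; apply: (filter_mono (FF := nb_filter _) Hn) => w Hw.
  by rewrite /dslope; case: Ceq_dec.
Qed.

Lemma dslope_cont h d z : h C0 = C0 -> is_cder h C0 d -> cdiff1 h z -> ccont1 (dslope h d) z.
Proof.
  move=> h0 Hd Hz; case: (Ceq_dec z C0) => [->|Hn]; first exact: dslope_cont0.
  exact/cdiff1_cont/dslope_cdiff.
Qed.


(** For |a| < 1 this is the automorphism of the unit disc that sends 0 to a. *)
Definition mobius (a w : C) : C := Cmul (Cadd w a) (Cinv (Cadd C1 (Cmul (Cconj a) w))).

Lemma mobius_den a w : Cnorm2 a < 1 -> Cnorm2 w <= 1 -> Cadd C1 (Cmul (Cconj a) w) <> C0.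
Proof.
  move=> Ha Hw H.
  have E : Cmul (Cconj a) w = Copp C1.
  { have -> : Cmul (Cconj a) w = Csub (Cadd C1 (Cmul (Cconj a) w)) C1 by ring. rewrite H; ring. }
  have := f_equal Cnorm2 E; rewrite Cnorm2M Cnorm2_conj Cnorm2_opp Cnorm2_1.
  have := Cnorm2_ge0 a; have := Cnorm2_ge0 w; nra.
Qed.

Lemma mobius_norm a w : Cnorm2 a < 1 -> Cnorm2 w <= 1 ->
  Cnorm2 (mobius a w) <= 1 /\ (Cnorm2 w = 1 -> Cnorm2 (mobius a w) = 1).
Proof.
  move=> Ha Hw; have Hd := mobius_den Ha Hw; have Hp := Cnorm2_pos Hd.
  rewrite /mobius Cnorm2M Cnorm2_inv //.
  have E : Cnorm2 (Cadd C1 (Cmul (Cconj a) w)) = Cnorm2 (Cadd w a) + (1 - Cnorm2 a) * (1 - Cnorm2 w).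
  { rewrite /Cnorm2 /=; ring. }
  split=> [|Hw1].
  - apply: (Rmult_le_reg_r (Cnorm2 (Cadd C1 (Cmul (Cconj a) w)))) => //.
    rewrite Rmult_assoc Rinv_l; [nra|lra].
  - rewrite {1}Hw1 in E; have -> : Cnorm2 (Cadd w a) = Cnorm2 (Cadd C1 (Cmul (Cconj a) w)) by rewrite E; ring.
    field; lra.
Qed.

Lemma mobius_cdiff a w : Cnorm2 a < 1 -> Cnorm2 w <= 1 -> cdiff1 (mobius a) w.
Proof.
  move=> Ha Hw; apply: cdiff1_mul.
  - apply: cdiff1_add; [exact: cdiff1_id|exact: cdiff1_const].
  - apply: cdiff1_inv; last exact: mobius_den.
    apply: cdiff1_add; first exact: cdiff1_const.
    apply: cdiff1_scal; exact: cdiff1_id.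
Qed.

(** The maximum principle at hand only bounds the value at the centre of the disc. Given z and |z| <
    r < 1, the map g = r [mobius a] with a = z / r moves the centre to z and the unit circle to |w|
    = r, where the slope is at most B / r in modulus; then r tends to 1. *)
Lemma schwarz_slope h d B : 0 <= B -> h C0 = C0 -> is_cder h C0 d ->
  (forall z, Cnorm2 z < 1 -> cdiff1 h z) ->
  (forall z, Cnorm2 z < 1 -> Cnorm2 (h z) <= B * B) ->
  forall z, Cnorm2 z < 1 -> Cnorm2 (dslope h d z) <= B * B.
Proof.
  move=> HB h0 Hd Hh Hm z Hz.
  have H2 := Cnorm2_ge0 z.
  suff Hr r : 0 < r < 1 -> Cnorm2 z < r * r -> Cnorm2 (dslope h d z) * (r * r) <= B * B.
  { apply: Rnot_lt_le => Hlt.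
    set D := Cnorm2 (dslope h d z) in Hlt Hr.
    have HD : 0 < D by nra.
    (* If the slope had squared modulus D > B^2, then both |z|^2 and B^2 / D would be below 1; the
       choice r^2 = (q + 1) / 2 exceeds both, so D r^2 > B^2. *)
    pose q := Rmax (Cnorm2 z) (B * B / D).
    have Q1 : Cnorm2 z <= q by apply: Rmax_l.
    have Q2 : B * B / D <= q by apply: Rmax_r.
    have Q3 : q < 1.
    { apply: Rmax_lub_lt => //; apply: (Rmult_lt_reg_r D) => //.
      have -> : B * B / D * D = B * B by field; lra. lra. }
    pose r := sqrt ((q + 1) / 2).
    have Hq : 0 < (q + 1) / 2 by lra.
    have Er : r * r = (q + 1) / 2 by apply: sqrt_sqrt; lra.
    have r0 : 0 < r by apply: sqrt_lt_R0.
    have := Hr r ltac:(nra) ltac:(lra).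
    rewrite Er.
    have : D * (B * B / D) <= D * q by apply: Rmult_le_compat_l; lra.
    have -> : D * (B * B / D) = B * B by field; lra.
    nra. }
  move=> Hr Hzr.
  have rr : 0 < r * r by nra.
  pose a := Cmul (RtoC (/ r)) z.
  have Ea : Cnorm2 a = Cnorm2 z / (r * r) by rewrite /a Cnorm2M Cnorm2_RtoC; field; lra.
  have Ha : Cnorm2 a < 1.
  { rewrite Ea; apply: (Rmult_lt_reg_r (r * r)) => //.
    have -> : Cnorm2 z / (r * r) * (r * r) = Cnorm2 z by field; lra. lra. }
  pose g w := Cmul (RtoC r) (mobius a w).
  have Hg w : Cnorm2 w <= 1 -> Cnorm2 (g w) < 1.
  { move=> Hw; rewrite /g Cnorm2M Cnorm2_RtoC; have := proj1 (mobius_norm Ha Hw).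
    have := Cnorm2_ge0 (mobius a w); nra. }
  have Dg w : Cnorm2 w <= 1 -> cdiff1 g w.
  { by move=> Hw; apply: cdiff1_scal; apply: mobius_cdiff. }
  have g0 : g C0 = z.
  { rewrite /g /mobius /a; have -> : Cadd C1 (Cmul (Cconj (Cmul (RtoC (/ r)) z)) C0) = C1 by ring.
    have E1 : Cinv C1 = C1 by rewrite /Cinv Cnorm2_1; creal; field.
    rewrite E1.
    have -> : Cmul (RtoC r) (Cmul (Cadd C0 (Cmul (RtoC (/ r)) z)) C1) = Cmul (Cmul (RtoC r) (RtoC (/ r))) z by ring.
    creal; field; lra. }
  (* The only zero of g is -a, which lies on the circle of squared radius |a|^2. *)
  have DH : disc_holo (fun w => dslope h d (g w)) (Cnorm2 a).
  { split=> //; split=> w Hw.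
    - apply: ccont1_comp; first by apply/cdiff1_cont/Dg.
      by apply: dslope_cont => //; apply/Hh/Hg.
    - move=> Hne; apply: cdiff1_comp; first by apply: Dg; lra.
      apply: dslope_cdiff; first by apply/Hh/Hg; lra.
      move=> Hz0; apply: Hne.
      have M0 : Cadd w a = C0.
      { have Hd1 := mobius_den Ha (proj2 Hw).
        have Hr1 : RtoC r <> C0 by move=> /(f_equal Re) /=; lra.
        have M1 := CmulI Hz0 Hr1.
        have -> : Cadd w a = Cmul (mobius a w) (Cadd C1 (Cmul (Cconj a) w)) by rewrite /mobius; field.
        rewrite M1; ring. }
      have -> : w = Copp a by have -> : w = Csub (Cadd w a) a by [ring]; rewrite M0; ring.
      exact: Cnorm2_opp. }
  have := disc_max (B := B / r) (Rle_mult_inv_pos _ _ HB (proj1 Hr)) DH.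
  rewrite g0 => K.
  have {}K : Cnorm2 (dslope h d z) <= B / r * (B / r).
  { apply: K => w Hw.
    have Hw1 : Cnorm2 w <= 1 by lra.
    have Ng : Cnorm2 (g w) = r * r.
    { rewrite /g Cnorm2M Cnorm2_RtoC (proj2 (mobius_norm Ha Hw1) Hw); ring. }
    have := Hm (g w) (Hg w Hw1).
    rewrite (dslope_eq d (g w) h0) Cnorm2M Ng => Hle.
    apply: (Rmult_le_reg_r (r * r)) => //.
    have -> : B / r * (B / r) * (r * r) = B * B by field; lra.
    exact: Hle. }
  have -> : B * B = B / r * (B / r) * (r * r) by field; lra.
  by apply: Rmult_le_compat_r; lra.
Qed.

Lemma schwarz h d B : 0 <= B -> h C0 = C0 -> is_cder h C0 d ->
  (forall z, Cnorm2 z < 1 -> cdiff1 h z) ->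
  (forall z, Cnorm2 z < 1 -> Cnorm2 (h z) <= B * B) ->
  Cnorm2 d <= B * B /\ forall z, Cnorm2 z < 1 -> Cnorm2 (h z) <= B * B * Cnorm2 z.
Proof.
  move=> HB h0 Hd Hh Hm; have S := schwarz_slope HB h0 Hd Hh Hm; split.
  - have := S C0 ltac:(rewrite Cnorm2_0; lra).
    by rewrite /dslope; case: Ceq_dec.
  - move=> z Hz; rewrite (dslope_eq d z h0) Cnorm2M.
    by apply: Rmult_le_compat_r; [exact: Cnorm2_ge0|exact: S].
Qed.

(** The slope has real part at most B on the disc and equals B at 0. The map w -> -z w fixes 0 and
    sends -1 to z, so rigidity on the circle gives real part B at z, and the modulus bound leaves no
    imaginary part. *)
Lemma schwarz_rigid h B : 0 <= B -> h C0 = C0 -> is_cder h C0 (RtoC B) ->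
  (forall z, Cnorm2 z < 1 -> cdiff1 h z) ->
  (forall z, Cnorm2 z < 1 -> Cnorm2 (h z) <= B * B) ->
  forall z, Cnorm2 z < 1 -> h z = Cmul (RtoC B) z.
Proof.
  move=> HB h0 Hd Hh Hm z Hz; have S := schwarz_slope HB h0 Hd Hh Hm.
  case: (Ceq_dec z C0) => [->|Hz0]; first by rewrite h0; ring.
  pose k := dslope h (RtoC B).
  pose g w := Cmul (Copp z) w.
  have Ng w : Cnorm2 (g w) = Cnorm2 z * Cnorm2 w by rewrite /g Cnorm2M Cnorm2_opp.
  have Hg w : Cnorm2 w <= 1 -> Cnorm2 (g w) < 1.
  { rewrite Ng; have := Cnorm2_ge0 z; have := Cnorm2_ge0 w; nra. }
  have Dg w : cdiff1 g w by apply: cdiff1_scal; exact: cdiff1_id.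
  have DH : disc_holo (fun w => k (g w)) 0.
  { split; first lra; split=> w Hw.
    - apply: ccont1_comp; first by apply/cdiff1_cont/Dg.
      by apply: dslope_cont => //; apply/Hh/Hg.
    - move=> _; apply: cdiff1_comp => //; apply: dslope_cdiff; first by apply/Hh/Hg; lra.
      apply: Cnorm2_neq0; rewrite Ng; have := Cnorm2_pos Hz0; nra. }
  have Sk w : Cnorm2 w < 1 -> Re (k w) <= B.
  { move=> Hw; apply: Rle_trans (Rle_abs _) _; apply: Rabs_le_sq => //.
    have := S w Hw; rewrite {1}/Cnorm2 -/(k w); have := Rle_0_sqr (Im (k w)); rewrite /Rsqr; lra. }
  have := disc_Re_rigid (B := B) DH _ _.
  have g0 : g C0 = C0 by rewrite /g; ring.
  have g1 : g (Copp C1) = z by rewrite /g; ring.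
  rewrite g0 g1 => R.
  have {}R : Re (k z) = B.
  { apply: R; first by move=> w Hw; apply: Sk; apply: Hg; lra.
    by rewrite /k /dslope; case: Ceq_dec. }
  have := S z Hz; rewrite /Cnorm2 -/(k z) R => Hle.
  have I0 : Im (k z) = 0 by nra.
  rewrite (dslope_eq (RtoC B) z h0) -/(k z); congr Cmul.
  by creal.
Qed.

Lemma mean_zero f : (forall z, Cnorm2 z <= 1 -> cdiff1 f z) ->
  (forall z, Cnorm2 z = 1 -> f z = C0) -> f C0 = C0.
Proof.
  move=> Hd H0.
  have DH : disc_holo f 0.
  { split; first lra; split=> z Hz; first by apply/cdiff1_cont/Hd.
    by move=> _; apply: Hd; lra. }
  have := disc_max (Rle_refl 0) DH.
  move=> K; apply: Cnorm2_eq0; have := Cnorm2_ge0 (f C0).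
  have : Cnorm2 (f C0) <= 0 * 0 by apply: K => z Hz; rewrite H0 // Cnorm2_0; lra.
  lra.
Qed.

(** * Involutions of the Lie ball fixing the origin *)

Definition vscale n (a : C) (z : vec n) : vec n := fun i => Cmul a (z i).

Lemma vnorm2_vscale n a (z : vec n) : vnorm2 (vscale a z) = Cnorm2 a * vnorm2 z.
Proof. exact: vnorm2_scale. Qed.

Lemma vbil_vscale n a (z : vec n) : vbil (vscale a z) = Cmul (Cmul a a) (vbil z).
Proof. rewrite /vbil sumC_distr; apply: eq_bigr => i _; rewrite /vscale; ring. Qed.

Lemma vbil_le n (z : vec n) : Cnorm2 (vbil z) <= vnorm2 z * vnorm2 z.
Proof. exact: cauchy_schwarz. Qed.

(** With N = |Z|^2, b = |Z Z^t|^2 and s = |a|^2, the defining expression grows by (1 - s) (N - b (1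
    + s) / 4) on passing from Z to a Z; this is nonnegative because b <= N^2 <= 2 N and s <= 1. *)
Lemma D4_scale m (Z : vec m) a : D4 Z -> Cnorm2 a <= 1 -> D4 (vscale a Z).
Proof.
  move=> [H1 H2] Ha; rewrite /D4 vnorm2_vscale vbil_vscale !Cnorm2M.
  have := vbil_le Z; have := vnorm2_ge0 Z; have := Cnorm2_ge0 a; have := Cnorm2_ge0 (vbil Z).
  move: (vnorm2 Z) (Cnorm2 (vbil Z)) (Cnorm2 a) H1 H2 Ha => N b s H1 H2 Ha Hb Hs HN HbN.
  split; first nra.
  have E : 1 - s * N + / 4 * (s * s * b) = (1 - N + / 4 * b) + (1 - s) * (N - / 4 * b * (1 + s)) by field.
  rewrite E.
  have : 0 <= (1 - s) * (N - / 4 * b * (1 + s)).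
  { apply: Rmult_le_pos; first lra.
    have : b <= 2 * N by nra.
    nra. }
  lra.
Qed.

Lemma D4_small m (Z : vec m) : vnorm2 Z < 1 -> D4 Z.
Proof. by move=> H; split; [lra|have := Cnorm2_ge0 (vbil Z); lra]. Qed.

Definition vreal n (x : vec n) : Prop := forall i, Im (x i) = 0.

Lemma vbil_real n (x : vec n) : vreal x -> vbil x = RtoC (vnorm2 x).
Proof.
  move=> H; rewrite /vbil /vnorm2 sum_RtoC; apply: eq_bigr => i _.
  rewrite /Cnorm2; creal; rewrite !H; ring.
Qed.

(** On a complex multiple of a real vector |Z Z^t| = |Z|^2, so the second defining expression is the
    square of 1 - |Z|^2 / 2 and only |Z|^2 < 2 remains. Such points reach every norm allowed in
    D^IV, which makes them the extremal directions for the Schwarz lemma. *)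
Lemma D4_real_scale m (x : vec m) a : vreal x -> Cnorm2 a * vnorm2 x < 2 -> D4 (vscale a x).
Proof.
  move=> Hx Ha; rewrite /D4 vnorm2_vscale vbil_vscale vbil_real // !Cnorm2M Cnorm2_RtoC; split=> //.
  have -> : 1 - Cnorm2 a * vnorm2 x + / 4 * (Cnorm2 a * Cnorm2 a * (vnorm2 x * vnorm2 x)) =
    (1 - Cnorm2 a * vnorm2 x / 2) * (1 - Cnorm2 a * vnorm2 x / 2) by field.
  nra.
Qed.

Lemma has_grad_linear n (l : 'I_n -> C) z :
  has_grad (fun w : vec n => \big[Cadd/C0]_(i < n) Cmul (l i) (w i)) z l.
Proof.
  exists (fun j _ => l j); split; first by move=> j; exact: clim_const.
  apply: filter_forall => w; rewrite -sumC_split; apply: eq_bigr => i _; ring.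
Qed.

Lemma mxapp_vscale m n (A : 'I_m -> 'I_n -> C) a w : mxapp A (vscale a w) = vscale a (mxapp A w).
Proof.
  apply: functional_extensionality => i; rewrite /mxapp /vscale sumC_distr.
  apply: eq_bigr => j _; ring.
Qed.

Lemma mxapp_vadd m n (A : 'I_m -> 'I_n -> C) w w' : mxapp A (vadd w w') = vadd (mxapp A w) (mxapp A w').
Proof.
  apply: functional_extensionality => i; rewrite /mxapp /vadd -sumC_split.
  apply: eq_bigr => j _; ring.
Qed.

Definition mxmul m n p (A : 'I_m -> 'I_n -> C) (B : 'I_n -> 'I_p -> C) : 'I_m -> 'I_p -> C :=
  fun i j => \big[Cadd/C0]_(l < n) Cmul (A i l) (B l j).
Definition mxone n : 'I_n -> 'I_n -> C := fun i j => if j == i then C1 else C0.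

Lemma mxapp_mxmul m n p (A : 'I_m -> 'I_n -> C) (B : 'I_n -> 'I_p -> C) w :
  mxapp (mxmul A B) w = mxapp A (mxapp B w).
Proof.
  apply: functional_extensionality => i; rewrite /mxapp /mxmul.
  transitivity (\big[Cadd/C0]_(j < p) \big[Cadd/C0]_(l < n) Cmul (A i l) (Cmul (B l j) (w j))).
  { apply: eq_bigr => j _; rewrite CmulC sumC_distr; apply: eq_bigr => l _; ring. }
  rewrite sumC_exchange; apply: eq_bigr => l _; by rewrite sumC_distr.
Qed.

Lemma mxapp_one n (w : vec n) : mxapp (@mxone n) w = w.
Proof. by apply: functional_extensionality => i; rewrite /mxapp /mxone sumC_delta. Qed.

Lemma has_jac_ray n (W : vec n) (z : vec 1) :
  has_jac (fun w : vec 1 => vscale (w ord0) W) z (fun i _ => W i).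
Proof.
  move=> i.
  have H := has_grad_mul (has_grad_coord z ord0) (has_grad_const (W i) z).
  have -> : (fun _ => W i) = (fun j : 'I_1 => Cadd (Cmul (z ord0) C0) (Cmul (W i) (if j == ord0 then C1 else C0))).
  { apply: functional_extensionality => j; rewrite ord1 eqxx; ring. }
  exact: H.
Qed.

Lemma vscale0 n (W : vec n) : vscale C0 W = fun _ => C0.
Proof. by apply: functional_extensionality => i; rewrite /vscale; ring. Qed.

Lemma slice_cdiff m (D : vec m -> Prop) (T : vec m -> vec m) (l : 'I_m -> C) W z :
  holo_on D T -> D (vscale z W) ->
  cdiff1 (fun z => \big[Cadd/C0]_(i < m) Cmul (l i) (T (vscale z W) i)) z.
Proof.
  move=> HT HD.
  apply: (cdiff_comp (F := fun w : vec 1 => vscale (w ord0) W)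
    (G := fun Z => \big[Cadd/C0]_(i < m) Cmul (l i) (T Z i)) (z := fun _ => z)).
  - by move=> i; eexists; apply: (has_jac_ray W).
  - apply: cdiff_sum => i; apply: cdiff_scal; exact: (proj1 (holo_at_cdiff _ _) (HT _ HD)).
Qed.

Lemma slice_cder m (T : vec m -> vec m) (l : 'I_m -> C) W A :
  has_jac T (fun _ => C0) A ->
  is_cder (fun z => \big[Cadd/C0]_(i < m) Cmul (l i) (T (vscale z W) i)) C0
    (\big[Cadd/C0]_(i < m) Cmul (l i) (mxapp A W i)).
Proof.
  move=> HA; rewrite -(vscale0 W) in HA.
  have H1 := has_jac_comp (has_jac_ray W (fun _ => C0)) HA.
  have H2 := has_grad_comp H1 (has_grad_linear l _).
  exact: H2.
Qed.

(** Pairing T(z W) with the conjugate of v = A W gives a function of z whose derivative at 0 is N =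
    |v|^2 and whose squared modulus is at most 2 N; the Schwarz lemma then reads N^2 <= 2 N. *)
Lemma D4_map_bound m (T : vec m -> vec m) A (W : vec m) : maps_into (@D4 m) (@D4 m) T ->
  holo_on (@D4 m) T -> T (fun _ => C0) = (fun _ => C0) -> has_jac T (fun _ => C0) A ->
  D4 W -> vnorm2 (mxapp A W) <= 2.
Proof.
  move=> HM HT H0 HA HW; set v := mxapp A W; set N := vnorm2 v.
  have HN : 0 <= N by apply: vnorm2_ge0.
  pose l i := Cconj (v i).
  have Nl : vnorm2 l = N by apply: eq_bigr => i _; rewrite /l Cnorm2_conj.
  have Hs : sqrt (2 * N) * sqrt (2 * N) = 2 * N by apply: sqrt_sqrt; lra.
  have [] := schwarz (B := sqrt (2 * N)) (sqrt_pos _) _ (slice_cder l W HA).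
  - rewrite vscale0 H0 big1 // => i _; ring.
  - move=> z Hz; apply: (slice_cdiff l HT); apply: D4_scale => //; lra.
  - move=> z Hz; rewrite Hs.
    apply: Rle_trans (cauchy_schwarz _ _) _.
    rewrite Nl Rmult_comm; apply: Rmult_le_compat_r => //; left.
    apply (proj1 (HM _ (D4_scale HW (Rlt_le _ _ Hz)))).
  - have -> : \big[Cadd/C0]_(i < m) Cmul (l i) (mxapp A W i) = RtoC N.
    { rewrite /N /vnorm2 sum_RtoC; apply: eq_bigr => i _; rewrite -Cmul_conj /l CmulC //. }
    rewrite Hs Cnorm2_RtoC => Hle _; nra.
Qed.

(* W is a point of the Shilov boundary, so z |-> dT(0) T(zW) is extremal for the Schwarz
   lemma: its derivative at 0 is W, of maximal norm. *)
Lemma involution_linear_boundary m (T : vec m -> vec m) A (W : vec m) z :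
  maps_into (@D4 m) (@D4 m) T ->
  holo_on (@D4 m) T -> T (fun _ => C0) = (fun _ => C0) -> has_jac T (fun _ => C0) A ->
  mxmul A A = @mxone m -> vreal W -> vnorm2 W = 2 -> Cnorm2 z < 1 ->
  T (vscale z W) = mxapp A (vscale z W).
Proof.
  move=> HM HT H0 HA HAA HWr HW Hz.
  have HD w : Cnorm2 w < 1 -> D4 (vscale w W) by move=> Hw; apply: D4_real_scale => //; rewrite HW; lra.
  have AAv v : mxapp A (mxapp A v) = v by rewrite -mxapp_mxmul HAA mxapp_one.
  pose H w := mxapp A (T (vscale w W)).
  have HB w : Cnorm2 w < 1 -> vnorm2 (H w) <= 2.
  { by move=> Hw; apply: (D4_map_bound HM HT H0 HA); apply: HM; apply: HD. }
  have lin (l : 'I_m -> C) w : \big[Cadd/C0]_(i < m) Cmul (l i) (H w i) =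
     \big[Cadd/C0]_(j < m) Cmul (\big[Cadd/C0]_(i < m) Cmul (l i) (A i j)) (T (vscale w W) j).
  { transitivity (\big[Cadd/C0]_(i < m) \big[Cadd/C0]_(j < m) Cmul (l i) (Cmul (A i j) (T (vscale w W) j))).
    { by apply: eq_bigr => i _; rewrite /H /mxapp sumC_distr. }
    rewrite sumC_exchange; apply: eq_bigr => j _; rewrite [RHS]CmulC sumC_distr.
    apply: eq_bigr => i _; ring. }
  have HH0 : H C0 = fun _ => C0.
  { rewrite /H vscale0 H0; apply: functional_extensionality => i; rewrite /mxapp big1 // => j _; ring. }
  have hz (l : 'I_m -> C) : \big[Cadd/C0]_(i < m) Cmul (l i) (H C0 i) = C0.
  { rewrite HH0 big1 // => i _; ring. }
  have hd (l : 'I_m -> C) w : Cnorm2 w < 1 -> cdiff1 (fun w => \big[Cadd/C0]_(i < m) Cmul (l i) (H w i)) w.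
  { move=> Hw; rewrite (functional_extensionality _ _ (lin l)).
    apply: (slice_cdiff _ HT); exact: HD. }
  have hder (l : 'I_m -> C) : is_cder (fun w => \big[Cadd/C0]_(i < m) Cmul (l i) (H w i)) C0
     (\big[Cadd/C0]_(i < m) Cmul (l i) (W i)).
  { rewrite (functional_extensionality _ _ (lin l)).
    have := slice_cder (fun j => \big[Cadd/C0]_(i < m) Cmul (l i) (A i j)) W HA.
    set X := \big[Cadd/C0]_(j < m) _.
    have -> : X = \big[Cadd/C0]_(i < m) Cmul (l i) (W i); last by [].
    rewrite -[in RHS](AAv W) /X.
    transitivity (\big[Cadd/C0]_(j < m) \big[Cadd/C0]_(i < m) Cmul (l i) (Cmul (A i j) (mxapp A W j))).
    { apply: eq_bigr => j _; rewrite CmulC sumC_distr; apply: eq_bigr => i _; ring. }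
    rewrite sumC_exchange; apply: eq_bigr => i _; by rewrite {2}/mxapp sumC_distr. }
  (* Paired with the real vector W itself, H has derivative W W^t = 2 at 0, which equals the bound
     from Cauchy-Schwarz: the rigid case of the Schwarz lemma. *)
  have K1 : \big[Cadd/C0]_(i < m) Cmul (W i) (H z i) = Cmul (RtoC 2) z.
  { have E2 : \big[Cadd/C0]_(i < m) Cmul (W i) (W i) = RtoC 2 by rewrite -HW -vbil_real.
    have D2 := hder W; rewrite E2 in D2.
    apply: (schwarz_rigid (B := 2) _ (hz W) D2 (hd W)) => //; first lra.
    move=> w Hw; apply: Rle_trans (cauchy_schwarz _ _) _; rewrite HW.
    have := HB w Hw; lra. }
  have K2 : vnorm2 (H z) <= 2 * Cnorm2 z.
  { set v := H z; set N := vnorm2 v.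
    have HN : 0 <= N by apply: vnorm2_ge0.
    pose l i := Cconj (v i).
    have Nl : vnorm2 l = N by apply: eq_bigr => i _; rewrite /l Cnorm2_conj.
    have Hs : sqrt (2 * N) * sqrt (2 * N) = 2 * N by apply: sqrt_sqrt; lra.
    have [|_ /(_ z Hz)] := schwarz (B := sqrt (2 * N)) (sqrt_pos _) (hz l) (hder l) (hd l).
    { move=> w Hw; rewrite Hs; apply: Rle_trans (cauchy_schwarz _ _) _.
      rewrite Nl Rmult_comm; apply: Rmult_le_compat_r => //; exact: HB. }
    have -> : \big[Cadd/C0]_(i < m) Cmul (l i) (H z i) = RtoC N.
    { rewrite /N /vnorm2 sum_RtoC; apply: eq_bigr => i _; rewrite -Cmul_conj /l CmulC //. }
    rewrite Hs Cnorm2_RtoC; have := Cnorm2_ge0 z => Hzz Hle.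
    case: (Rle_lt_or_eq_dec _ _ HN) => HN0; last by lra.
    apply: (Rmult_le_reg_r N) => //; lra. }
  (* The expansion of |H(z) - z W|^2 is |H(z)|^2 + 2 |z|^2 - 4 |z|^2 by [K1], and [K2] makes it
     nonpositive. So A T(z W) = z W, and a second application of A yields the claim. *)
  have K3 : vnorm2 (vsub (H z) (vscale z W)) = 0.
  { apply: Rle_antisym; last exact: vnorm2_ge0.
    have -> : vnorm2 (vsub (H z) (vscale z W)) = vnorm2 (H z) + vnorm2 (vscale z W)
      + - 2 * Re (Cmul (Cconj z) (\big[Cadd/C0]_(i < m) Cmul (W i) (H z i))).
    { rewrite sumC_distr Re_sum /vnorm2 sumR_distr -!sumR_split; apply: eq_bigr => i _.
      rewrite /vsub /vscale /Cnorm2 /=; have := HWr i => ->; ring. }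
    rewrite K1 vnorm2_vscale HW.
    have -> : Re (Cmul (Cconj z) (Cmul (RtoC 2) z)) = 2 * Cnorm2 z by rewrite /Cnorm2 /=; ring.
    lra. }
  by rewrite -[LHS]AAv -/(H z) (vsub_eq K3).
Qed.

Lemma vscaleA n a b (z : vec n) : vscale a (vscale b z) = vscale (Cmul a b) z.
Proof. by apply: functional_extensionality => i; rewrite /vscale; ring. Qed.

Lemma involution_linear_real m (T : vec m -> vec m) A (x : vec m) z :
  maps_into (@D4 m) (@D4 m) T ->
  holo_on (@D4 m) T -> T (fun _ => C0) = (fun _ => C0) -> has_jac T (fun _ => C0) A ->
  mxmul A A = @mxone m -> vreal x -> Cnorm2 z * vnorm2 x < 2 ->
  T (vscale z x) = mxapp A (vscale z x).
Proof.
  move=> HM HT H0 HA HAA Hx Hz.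
  case: (Rle_lt_or_eq_dec _ _ (vnorm2_ge0 x)) => [Hp|/esym /vnorm2_eq0 ->]; last first.
  { have -> : vscale z (fun _ : 'I_m => C0) = fun _ => C0.
      by apply: functional_extensionality => i; rewrite /vscale; ring.
    rewrite H0; apply: functional_extensionality => i; rewrite /mxapp big1 // => j _; ring. }
  pose s := sqrt (vnorm2 x / 2).
  have Hs : s * s = vnorm2 x / 2 by apply: sqrt_sqrt; lra.
  have s0 : 0 < s by apply: sqrt_lt_R0; lra.
  have -> : vscale z x = vscale (Cmul z (RtoC s)) (vscale (RtoC (/ s)) x).
  { rewrite vscaleA; congr vscale; creal; field; lra. }
  apply: involution_linear_boundary => //.
  - by move=> i; rewrite /vscale /= Hx; ring.
  - rewrite vnorm2_vscale Cnorm2_RtoC.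
    have -> : vnorm2 x = 2 * (s * s) by rewrite Hs; field.
    field; lra.
  - rewrite Cnorm2M Cnorm2_RtoC Hs; lra.
Qed.

Definition vconj n (z : vec n) : vec n := fun i => Cconj (z i).

Lemma has_jac_line n (w W : vec n) (z : vec 1) :
  has_jac (fun y : vec 1 => vadd w (vscale (y ord0) W)) z (fun i _ => W i).
Proof.
  move=> i.
  have H := has_grad_add (has_grad_const (w i) z) (has_jac_ray W z i).
  have -> : (fun _ : 'I_1 => W i) = (fun _ => Cadd C0 (W i)).
  { apply: functional_extensionality => j; ring. }
  exact: H.
Qed.

(* On the circle |z| = 1 the point w + z conj(w) is a phase times a real vector,
   so the mean value property at z = 0 propagates linearity from real vectors to w. *)
Lemma involution_linear m (T : vec m -> vec m) A (w : vec m) :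
  maps_into (@D4 m) (@D4 m) T ->
  holo_on (@D4 m) T -> T (fun _ => C0) = (fun _ => C0) -> has_jac T (fun _ => C0) A ->
  mxmul A A = @mxone m -> vnorm2 w < / 4 -> T w = mxapp A w.
Proof.
  move=> HM HT H0 HA HAA Hw.
  pose L z := vadd w (vscale z (vconj w)).
  (* For |z| <= 1 this is |w + z conj(w)|^2 <= 4 |w|^2, whence the constant 1/4 in the hypothesis:
     all these points lie in the unit ball, which D^IV contains. *)
  have NL z : Cnorm2 z <= 1 -> vnorm2 (L z) < 1.
  { move=> Hz; apply: Rle_lt_trans (vnorm2_add _ _) _; rewrite vnorm2_vscale.
    have -> : vnorm2 (vconj w) = vnorm2 w by apply: eq_bigr => i _; rewrite Cnorm2_conj.
    have := vnorm2_ge0 w; nra. }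
  have L0 : L C0 = w.
  { by apply: functional_extensionality => i; rewrite /L /vadd /vscale; ring. }
  apply: functional_extensionality => i; apply: Csub_eq0.
  rewrite -{1 2}L0.
  apply: (mean_zero (f := fun z => Csub (T (L z) i) (mxapp A (L z) i))).
  - move=> z Hz.
    apply: (cdiff_comp (F := fun y : vec 1 => L (y ord0))
      (G := fun Z => Csub (T Z i) (mxapp A Z i)) (z := fun _ => z)).
    + by move=> j; eexists; apply: has_jac_line.
    + apply: cdiff_sub.
      * apply: (proj1 (holo_at_cdiff _ _)); apply: HT; apply: D4_small; exact: NL.
      * eexists; exact: has_grad_linear.
  - move=> z Hz.
    pose b := Csqrt z.
    have Hb : Cnorm2 b = 1.
    { have := f_equal Cnorm2 (Csqrt_sq z); rewrite Cnorm2M Hz -/b.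
      have := Cnorm2_ge0 b; nra. }
    pose x : vec m := fun i => Cadd (Cmul (Cconj b) (w i)) (Cmul b (Cconj (w i))).
    have Ex : L z = vscale b x.
    { apply: functional_extensionality => j; rewrite /L /vadd /vscale /vconj /x -{1}(Csqrt_sq z) -/b.
      have -> : Cmul b (Cadd (Cmul (Cconj b) (w j)) (Cmul b (Cconj (w j)))) =
        Cadd (Cmul (Cmul b (Cconj b)) (w j)) (Cmul (Cmul b b) (Cconj (w j))) by ring.
      rewrite Cmul_conj Hb; have -> : RtoC 1 = C1 by []. ring. }
    have Hx : vreal x by move=> j; rewrite /x /=; ring.
    have Nx : Cnorm2 b * vnorm2 x < 2.
    { rewrite -vnorm2_vscale -Ex; have := NL z ltac:(lra); lra. }
    rewrite Ex (involution_linear_real HM HT H0 HA HAA Hx Nx); ring.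
Qed.

Definition vbasis m (a : 'I_m) : vec m := fun i => if i == a then C1 else C0.

Lemma mxapp_basis m n (A : 'I_m -> 'I_n -> C) a : mxapp A (vbasis a) = fun i => A i a.
Proof.
  apply: functional_extensionality => i; rewrite /mxapp /vbasis.
  rewrite -[RHS](sumC_delta a); apply: eq_bigr => j _; exact: CmulC.
Qed.

Lemma sumR_delta n (j : 'I_n) (F : 'I_n -> R) :
  \big[Rplus/0]_(i < n) ((if i == j then 1 else 0) * F i) = F j.
Proof. rewrite (sumR_D1 j) eqxx big1 => [|i /negbTE ->]; ring. Qed.

Lemma vnorm2_basis_add m (L : 'I_m) e (u : vec m) :
  vnorm2 (vadd (vbasis L) (vscale (RtoC e) u)) = 1 + 2 * e * Re (u L) + e * e * vnorm2 u.
Proof.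
  rewrite -(sumR_delta L (fun _ => 1)) -(sumR_delta L (fun i => Re (u i))) /vnorm2 !sumR_distr -!sumR_split.
  apply: eq_bigr => i _; rewrite /vadd /vscale /vbasis /Cnorm2; case: (i == L) => /=; ring.
Qed.

Lemma vbil_basis_add m (L : 'I_m) e (u : vec m) :
  vbil (vadd (vbasis L) (vscale (RtoC e) u)) =
  Cadd (Cadd C1 (Cmul (RtoC (2 * e)) (u L))) (Cmul (RtoC (e * e)) (vbil u)).
Proof.
  rewrite -[C1](sumC_delta L (fun _ => C1)) -(sumC_delta L u) /vbil !sumC_distr -!sumC_split.
  apply: eq_bigr => i _; rewrite /vadd /vscale /vbasis; case: (i == L); creal; ring.
Qed.

Lemma quadratic_limit_loc c0 c1 c2 d : 0 < d ->
  (forall e, 0 < e < d -> 0 <= c0 + e * c1 + e * e * c2) -> 0 <= c0.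
Proof.
  move=> Hd H; apply: Rnot_lt_le => Hc.
  pose q := Rabs c1 + Rabs c2 + 1.
  have Hq : 0 < q by rewrite /q; have := Rabs_pos c1; have := Rabs_pos c2; lra.
  pose e := Rmin (Rmin 1 (d / 2)) (- c0 / (2 * q)).
  have e1 : e <= Rmin 1 (d / 2) by apply: Rmin_l.
  have e3 := Rmin_l 1 (d / 2); have e4 := Rmin_r 1 (d / 2).
  have e2 : e <= - c0 / (2 * q) by apply: Rmin_r.
  have e0 : 0 < e by apply: Rmin_pos; [apply: Rmin_pos; lra|apply: Rdiv_lt_0_compat; lra].
  have := H e ltac:(lra).
  have B1 := Rle_abs c1; have B2 := Rle_abs c2.
  have : e * q <= - c0 / 2.
  { have -> : - c0 / 2 = - c0 / (2 * q) * q by field; lra.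
    apply: Rmult_le_compat_r; lra. }
  have : e * e * c2 <= e * Rabs c2.
  { apply: Rle_trans (_ : e * e * Rabs c2 <= _); first by apply: Rmult_le_compat_l; nra.
    apply: Rmult_le_compat_r; [exact: Rabs_pos|nra]. }
  have : e * c1 <= e * Rabs c1 by apply: Rmult_le_compat_l; lra.
  rewrite /q; lra.
Qed.

Lemma quadratic_limit c0 c1 c2 : (forall e, 0 < e -> 0 <= c0 + e * c1 + e * e * c2) -> 0 <= c0.
Proof. by move=> H; apply: (quadratic_limit_loc (d := 1) Rlt_0_1) => e [He _]; exact: H. Qed.

Lemma quadratic_limit_left T0 n k : 0 < T0 ->
  (forall T, 0 < T < T0 -> 0 < 1 - T * n + T * T * k) -> 0 <= 1 - T0 * n + T0 * T0 * k.
Proof.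
  move=> HT H; apply: (quadratic_limit_loc (c1 := n - 2 * T0 * k) (c2 := k) HT).
  move=> e He; have := H (T0 - e) ltac:(lra).
  have -> : 1 - T0 * n + T0 * T0 * k + e * (n - 2 * T0 * k) + e * e * k
      = 1 - (T0 - e) * n + (T0 - e) * (T0 - e) * k by ring.
  lra.
Qed.

(** Let u = A e_a. For real e, the point sqrt(S) (e_L + e e_a) lies in D^IV as soon as S (1 + e^2) <
    2, and its image sqrt(S) (e_L + e u) must lie there too. Expanded in e, the bound on the norm
    gives Re u_L = 0 at first order, and the second inequality gives at second order that the
    squares of Im u_i, i <> L, sum to at most 0. The term from Im u_L cancels, so row L is left with
    an imaginary entry. *)
Lemma column_real m (T : vec m -> vec m) A (L a : 'I_m) :
  maps_into (@D4 m) (@D4 m) T ->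
  holo_on (@D4 m) T -> T (fun _ => C0) = (fun _ => C0) -> has_jac T (fun _ => C0) A ->
  mxmul A A = @mxone m -> L != a -> (forall i, A i L = vbasis L i) ->
  Re (A L a) = 0 /\ forall i, i != L -> Im (A i a) = 0.
Proof.
  move=> HM HT H0 HA HAA HLa HL.
  pose u : vec m := fun i => A i a.
  pose U := vnorm2 u.
  have HU : 0 <= U by apply: vnorm2_ge0.
  pose Z e := vadd (vbasis L) (vscale (RtoC e) u).
  have key e S : 0 < S -> S * (1 + e * e) < 2 -> D4 (vscale (RtoC (sqrt S)) (Z e)).
  { move=> HS HS2.
    pose x := vadd (vbasis L) (vscale (RtoC e) (vbasis a)).
    have Hx : vreal x.
    { by move=> i; rewrite /x /vadd /vscale /vbasis; case: (i == L); case: (i == a) => /=; ring. }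
    have Hss : sqrt S * sqrt S = S by apply: sqrt_sqrt; lra.
    have Nx : Cnorm2 (RtoC (sqrt S)) * vnorm2 x < 2.
    { rewrite Cnorm2_RtoC Hss vnorm2_basis_add.
      have -> : vnorm2 (vbasis a) = 1.
      { rewrite -(sumR_delta a (fun _ => 1)); apply: eq_bigr => i _; rewrite /vbasis /Cnorm2.
        by case: (i == a) => /=; ring. }
      rewrite /vbasis (negbTE HLa) /=; lra. }
    have := HM _ (D4_real_scale Hx Nx).
    rewrite (involution_linear_real HM HT H0 HA HAA Hx Nx) mxapp_vscale mxapp_vadd mxapp_vscale !mxapp_basis.
    by have -> : (fun i => A i L) = vbasis L by apply: functional_extensionality. }
  have key2 e S : 0 < S -> S * (1 + e * e) < 2 ->
    S * vnorm2 (Z e) < 2 /\ 0 < 1 - S * vnorm2 (Z e) + S * S * (/ 4 * Cnorm2 (vbil (Z e))).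
  { move=> HS HS2; have Hss : sqrt S * sqrt S = S by apply: sqrt_sqrt; lra.
    have [] := key e S HS HS2.
    rewrite vnorm2_vscale vbil_vscale !Cnorm2M Cnorm2_RtoC Hss => A1 A2; split=> //.
    by apply: Rlt_le_trans A2 _; right; ring. }
  have Nb e : vnorm2 (Z e) <= 1 + e * e.
  { apply: Rnot_lt_le => Hlt; have Hn : 0 < vnorm2 (Z e) by nra.
    (* If |Z|^2 > 1 + e^2, then S = 2 / |Z|^2 is admissible, yet it gives S |Z|^2 = 2, which the
       first inequality of D^IV excludes. *)
    have [||] := key2 e (2 / vnorm2 (Z e)).
    - by apply: Rdiv_lt_0_compat; lra.
    - apply: (Rmult_lt_reg_r (vnorm2 (Z e))) => //.
      have -> : 2 / vnorm2 (Z e) * (1 + e * e) * vnorm2 (Z e) = 2 * (1 + e * e) by field; lra.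
      lra.
    - have -> : 2 / vnorm2 (Z e) * vnorm2 (Z e) = 2 by field; lra.
      lra. }
  have NZ e : vnorm2 (Z e) = 1 + 2 * e * Re (u L) + e * e * U by apply: vnorm2_basis_add.
  have Hre : Re (u L) = 0.
  { have P1 : 0 <= - Re (u L).
    { apply: (quadratic_limit (c1 := / 2) (c2 := 0)) => e He; have := Nb e; rewrite NZ; nra. }
    have P2 : 0 <= Re (u L).
    { apply: (quadratic_limit (c1 := / 2) (c2 := 0)) => e He; have := Nb (- e); rewrite NZ; nra. }
    lra. }
  split=> //.
  set t := Im (u L); set Q := vbil u.
  (* The second inequality of D^IV in the limit S -> 2 / (1 + e^2), multiplied by (1 + e^2)^2. *)
  have disc e : 0 <= (1 + e * e) * (1 + e * e) - 2 * (1 + e * e) * vnorm2 (Z e) + Cnorm2 (vbil (Z e)).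
  { have He : 0 < 1 + e * e by nra.
    have := quadratic_limit_left (T0 := 2 / (1 + e * e)) (n := vnorm2 (Z e))
      (k := / 4 * Cnorm2 (vbil (Z e))) ltac:(apply: Rdiv_lt_0_compat; lra).
    move=> K; have {}K : 0 <= 1 - 2 / (1 + e * e) * vnorm2 (Z e) +
       2 / (1 + e * e) * (2 / (1 + e * e)) * (/ 4 * Cnorm2 (vbil (Z e))).
    { apply: K => S HS; apply: (proj2 (key2 e S _ _)); first lra.
      have -> : 2 = 2 / (1 + e * e) * (1 + e * e) by field; lra.
      apply: Rmult_lt_compat_r; lra. }
    have -> : (1 + e * e) * (1 + e * e) - 2 * (1 + e * e) * vnorm2 (Z e) + Cnorm2 (vbil (Z e)) =
      ((1 + e * e) * (1 + e * e)) * (1 - 2 / (1 + e * e) * vnorm2 (Z e) +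
       2 / (1 + e * e) * (2 / (1 + e * e)) * (/ 4 * Cnorm2 (vbil (Z e)))) by field; lra.
    apply: Rmult_le_pos => //; nra. }
  (* This is the coefficient of e^2 in [disc]: the terms of order 0 and 1 cancel once Re u_L = 0, so
     division by e^2 and e -> 0 isolate it. *)
  have Hmain : 0 <= 4 * (t * t) - 2 * U + 2 * Re Q.
  { apply: (quadratic_limit (c1 := 4 * t * Im Q) (c2 := 1 - 2 * U + Cnorm2 Q)) => e He.
    have := disc e; rewrite NZ Hre.
    have -> : vbil (Z e) = mkC (1 + e * e * Re Q) (2 * e * t + e * e * Im Q).
    { rewrite /Z vbil_basis_add -/Q; creal; rewrite ?Hre -/t; ring. }
    rewrite /Cnorm2 /= => K.
    apply: (Rmult_le_reg_l (e * e)); first nra.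
    rewrite Rmult_0_r; apply: Rle_trans K _; right; ring. }
  have EU : U - Re Q = \big[Rplus/0]_(i < m) (2 * (Im (u i) * Im (u i))).
  { have -> : U = \big[Rplus/0]_(i < m) (2 * (Im (u i) * Im (u i))) + Re Q; last by ring.
    rewrite /Q /U /vnorm2 /vbil Re_sum -sumR_split; apply: eq_bigr => i _; rewrite /Cnorm2 /=; ring. }
  move=> i Hi.
  have S1 : \big[Rplus/0]_(i < m) (2 * (Im (u i) * Im (u i))) =
    2 * (t * t) + \big[Rplus/0]_(i < m | i != L) (2 * (Im (u i) * Im (u i))) by exact: sumR_D1.
  have S2 : 2 * (Im (u i) * Im (u i)) <= \big[Rplus/0]_(i < m | i != L) (2 * (Im (u i) * Im (u i))).
  { rewrite (bigD1 i) //= -{1}[2 * _]Rplus_0_r; apply: Rplus_le_compat_l.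
    apply: sumR_ge0 => j _; have := Rle_0_sqr (Im (u j)); rewrite /Rsqr; lra. }
  have : Im (u i) * Im (u i) <= 0 by lra.
  rewrite -/(u i); nra.
Qed.

(** * Jacobians and the conjugated reflection *)

Lemma has_grad_unique n (f : vec n -> C) z a b : has_grad f z a -> has_grad f z b -> a = b.
Proof.
  move=> [P [H1 H2]] [Q [H3 H4]]; apply: functional_extensionality => j.
  apply: NNPP => Hne.
  have Hd : 0 < Cnorm2 (Csub (a j) (b j)).
  { by apply: Cnorm2_pos => /Csub_eq0. }
  (* On the j-th axis both slopes coincide, and a common value within e of a_j and of b_j forces
     |a_j - b_j|^2 <= 4 e, half of itself. *)
  set e := Cnorm2 (Csub (a j) (b j)) / 8.
  have He : 0 < e by rewrite /e; lra.
  have G1 := proj1 (clim_eps (FF := nb_filter z) _ _) (H1 j) e He.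
  have G2 := proj1 (clim_eps (FF := nb_filter z) _ _) (H3 j) e He.
  have [d [dp G]] := filter_and _ _ (filter_and _ _ H2 H4) (filter_and _ _ G1 G2).
  pose t := d / 2.
  pose w := vadd z (vscale (RtoC t) (vbasis j)).
  have Hw : vnorm2 (vsub w z) < d * d.
  { rewrite /w vsub_vadd vnorm2_vscale Cnorm2_RtoC.
    have -> : vnorm2 (vbasis j) = 1.
    { rewrite -(sumR_delta j (fun _ => 1)); apply: eq_bigr => i _; rewrite /vbasis /Cnorm2.
      by case: (i == j) => /=; ring. }
    rewrite /t; nra. }
  have [[E1 E2] [B1 B2]] := G w Hw.
  have S (X : 'I_n -> vec n -> C) : \big[Cadd/C0]_(i < n) Cmul (X i w) (Csub (w i) (z i)) = Cmul (RtoC t) (X j w).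
  { rewrite -(sumC_delta j (fun i => Cmul (RtoC t) (X i w))); apply: eq_bigr => i _.
    rewrite /w /vadd /vscale /vbasis; case: (i == j); ring. }
  rewrite !S in E1 E2.
  have E : P j w = Q j w.
  { have X : Cmul (RtoC t) (Csub (P j w) (Q j w)) = C0.
    { have -> : Cmul (RtoC t) (Csub (P j w) (Q j w)) = Csub (Cadd (f z) (Cmul (RtoC t) (P j w)))
        (Cadd (f z) (Cmul (RtoC t) (Q j w))) by ring.
      rewrite -E1 -E2; ring. }
    apply: Csub_eq0; apply: (CmulI X) => /(f_equal Re) /=; rewrite /t; lra. }
  have := Cnorm2_add (Copp (Csub (P j w) (a j))) (Csub (Q j w) (b j)).
  rewrite Cnorm2_opp E.
  have -> : Cadd (Copp (Csub (Q j w) (a j))) (Csub (Q j w) (b j)) = Csub (a j) (b j) by ring.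
  rewrite E in B1; rewrite -/e /e in B1 B2 *; lra.
Qed.

Lemma has_jac_unique n m (F : vec n -> vec m) z A B : has_jac F z A -> has_jac F z B -> A = B.
Proof.
  by move=> HA HB; apply: functional_extensionality => i; apply: has_grad_unique (HA i) (HB i).
Qed.

Lemma has_jac_id n (z : vec n) : has_jac (fun w => w) z (@mxone n).
Proof. by move=> i; apply: has_grad_coord. Qed.

Lemma has_jac_ext n m (F G : vec n -> vec m) z A : nb z (fun w => F w = G w) -> has_jac F z A -> has_jac G z A.
Proof.
  move=> E H i; apply: has_grad_ext (H i).
  by apply: (filter_mono (FF := nb_filter z) E) => w ->.
Qed.

Lemma clim_vnorm2 n T (F : (T -> Prop) -> Prop) {FF : Filter F} (f : T -> vec n) (l : vec n) :
  (forall i, clim (fun x => f x i) F (l i)) -> rlim (fun x => vnorm2 (f x)) F (vnorm2 l).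
Proof.
  move=> H.
  have CZ : clim (fun x => RtoC (vnorm2 (f x))) F (RtoC (vnorm2 l)).
  { have -> : (fun x => RtoC (vnorm2 (f x))) = fun x => \big[Cadd/C0]_(i < n) RtoC (Cnorm2 (f x i)).
      by apply: functional_extensionality => W; rewrite /vnorm2 sum_RtoC.
    rewrite /vnorm2 sum_RtoC; apply: clim_sum => i; split; last exact: rlim_const.
    exact: rlim_Cnorm2 (H i). }
  exact: (proj1 CZ).
Qed.

Lemma D4_open m (Z : vec m) : D4 Z -> nb Z (@D4 m).
Proof.
  move=> [H1 H2].
  have RZ : rlim (fun W : vec m => vnorm2 W) (nb Z) (vnorm2 Z).
  { by apply: clim_vnorm2 => i; exact: clim_coord. }
  have BZ : clim (fun W : vec m => vbil W) (nb Z) (vbil Z).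
  { by apply: clim_sum => i; apply: clim_mul; exact: clim_coord. }
  have QZ : rlim (fun W : vec m => 1 - vnorm2 W + / 4 * Cnorm2 (vbil W)) (nb Z)
      (1 - vnorm2 Z + / 4 * Cnorm2 (vbil Z)).
  { apply: rlim_add; first by apply: rlim_add; [exact: rlim_const|exact: rlim_opp].
    by apply: rlim_mul; [exact: rlim_const|exact: rlim_Cnorm2]. }
  have G1 := rlim_lt (FF := nb_filter Z) RZ H1.
  have G2 := rlim_gt (FF := nb_filter Z) QZ H2.
  by apply: (filter_mono (FF := nb_filter Z) (filter_and _ _ G1 G2)) => W [].
Qed.

Definition flip m (L : 'I_m) (z : vec m) : vec m := fun i => if i == L then Copp (z i) else z i.
Definition mxflip m (L : 'I_m) : 'I_m -> 'I_m -> C :=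
  fun i j => if j == i then (if i == L then Copp C1 else C1) else C0.

Lemma has_jac_flip m (L : 'I_m) z : has_jac (flip L) z (mxflip L).
Proof.
  move=> i; rewrite /flip /mxflip; case: (i == L); last exact: has_grad_coord.
  have H := has_grad_mul (has_grad_const (Copp C1) z) (has_grad_coord z i).
  have -> : (fun j : 'I_m => if j == i then Copp C1 else C0) =
    (fun j => Cadd (Cmul (Copp C1) (if j == i then C1 else C0)) (Cmul (z i) C0)).
  { apply: functional_extensionality => j; case: (j == i); ring. }
  apply: (has_grad_ext _ H); apply: filter_forall => w; ring.
Qed.

Lemma flipK m (L : 'I_m) z : flip L (flip L z) = z.
Proof. apply: functional_extensionality => i; rewrite /flip; case: (i == L) => //; ring. Qed.

Lemma D4_flip m (L : 'I_m) z : D4 z -> D4 (flip L z).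
Proof.
  rewrite /D4.
  have -> : vnorm2 (flip L z) = vnorm2 z.
  { by apply: eq_bigr => i _; rewrite /flip; case: (i == L); rewrite ?Cnorm2_opp. }
  have -> : vbil (flip L z) = vbil z.
  { by apply: eq_bigr => i _; rewrite /flip; case: (i == L) => //; ring. }
  done.
Qed.

Lemma mxmulA m n p q (A : 'I_m -> 'I_n -> C) (B : 'I_n -> 'I_p -> C) (D : 'I_p -> 'I_q -> C) :
  mxmul A (mxmul B D) = mxmul (mxmul A B) D.
Proof.
  apply: functional_extensionality => i; apply: functional_extensionality => j; rewrite /mxmul.
  transitivity (\big[Cadd/C0]_(l < n) \big[Cadd/C0]_(r < p) Cmul (A i l) (Cmul (B l r) (D r j))).
  { by apply: eq_bigr => l _; rewrite sumC_distr. }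
  rewrite sumC_exchange; apply: eq_bigr => r _; rewrite [RHS]CmulC sumC_distr.
  apply: eq_bigr => l _; ring.
Qed.

Lemma mxmul1 m n (A : 'I_m -> 'I_n -> C) : mxmul A (@mxone n) = A.
Proof.
  apply: functional_extensionality => i; apply: functional_extensionality => j; rewrite /mxmul /mxone.
  rewrite -[RHS](sumC_delta j (A i)); apply: eq_bigr => l _; rewrite eq_sym; exact: CmulC.
Qed.

Lemma mul1mx m n (A : 'I_m -> 'I_n -> C) : mxmul (@mxone m) A = A.
Proof.
  apply: functional_extensionality => i; apply: functional_extensionality => j; rewrite /mxmul /mxone.
  exact: sumC_delta.
Qed.

Lemma reflection_conjugate m (phi : vec m -> vec m) (L : 'I_m) : is_aut (@D4 m) phi ->
  exists T : vec m -> vec m, maps_into (@D4 m) (@D4 m) T /\ holo_on (@D4 m) T /\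
   (forall Z, D4 Z -> Z L = C0 -> T (phi Z) = phi Z) /\
   (T (fun _ => C0) = (fun _ => C0) -> exists A, has_jac T (fun _ => C0) A /\
      mxmul A A = @mxone m /\ A <> @mxone m).
Proof.
  move=> [psi [Hphi [Hpsi [Mphi [Mpsi [K1 K2]]]]]].
  exists (fun Z => phi (flip L (psi Z))).
  have D0 : D4 (fun _ : 'I_m => C0) by apply: D4_small; rewrite vnorm2_0; lra.
  have HT : holo_on (@D4 m) (fun Z => phi (flip L (psi Z))).
  { move=> Z HZ; apply/holo_at_jac.
    have /holo_at_jac [Q HQ] := Hpsi _ HZ.
    have H1 := has_jac_comp HQ (has_jac_flip L (psi Z)).
    have /holo_at_jac [P HP] := Hphi _ (D4_flip L (Mpsi _ HZ)).
    eexists; exact: has_jac_comp H1 HP. }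
  split; first by move=> Z HZ; apply/Mphi/D4_flip/Mpsi.
  split=> //; split.
  { move=> Z HZ HL; rewrite K1 //; congr phi.
    apply: functional_extensionality => i; rewrite /flip; case: eqP => // ->.
    rewrite HL; ring. }
  move=> H0; set o : vec m := fun _ => C0 in H0 D0 *.
  set p := psi o.
  have Hp : D4 p by apply: Mpsi.
  (* T(0) = 0 means that the reflection fixes p, the preimage of 0. The chain rule then evaluates d
     phi at p itself, where it is inverse to d psi at 0, and this makes dT(0) a conjugate of the
     reflection. *)
  have Hfp : flip L p = p by rewrite -[LHS]K1 ?H0 //; apply: D4_flip.
  have /holo_at_jac [Q HQ] := Hpsi _ D0.
  have /holo_at_jac [P HP] := Hphi _ Hp.
  have PQ : mxmul P Q = @mxone m.
  { apply: (has_jac_unique (F := fun w => phi (psi w)) (z := o)); first exact: has_jac_comp HQ HP.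
    apply: (has_jac_ext _ (has_jac_id o)).
    by apply: (filter_mono (FF := nb_filter o) (D4_open D0)) => W HW; rewrite K2. }
  have QP : mxmul Q P = @mxone m.
  { apply: (has_jac_unique (F := fun w => psi (phi w)) (z := p)).
    - apply: (has_jac_comp HP); by rewrite K2.
    - apply: (has_jac_ext _ (has_jac_id p)).
      by apply: (filter_mono (FF := nb_filter p) (D4_open Hp)) => W HW; rewrite K1. }
  have SS : mxmul (mxflip L) (mxflip L) = @mxone m.
  { apply: (has_jac_unique (F := fun w => flip L (flip L w)) (z := o)).
    - exact: has_jac_comp (has_jac_flip L o) (has_jac_flip L _).
    - apply: (has_jac_ext _ (has_jac_id o)); apply: filter_forall => W; by rewrite flipK. }
  exists (mxmul P (mxmul (mxflip L) Q)); split; last split.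
  - have H1 := has_jac_comp HQ (has_jac_flip L p).
    apply: (has_jac_comp (F := fun Z => flip L (psi Z)) H1); by rewrite -/p Hfp.
  - have -> : mxmul (mxmul P (mxmul (mxflip L) Q)) (mxmul P (mxmul (mxflip L) Q)) =
      mxmul P (mxmul (mxmul (mxflip L) (mxmul (mxmul Q P) (mxflip L))) Q) by rewrite !mxmulA.
    by rewrite QP mul1mx SS mul1mx.
  - move=> E.
    have : mxmul Q (mxmul (mxmul P (mxmul (mxflip L) Q)) P) = mxflip L.
    { by rewrite !mxmulA QP mul1mx -mxmulA QP mxmul1. }
    rewrite E mul1mx QP => /(f_equal (fun B => Re (B L L))).
    rewrite /mxone /mxflip eqxx /=; lra.
Qed.

(** * Affine hyperplanes of the ball *)

Definition rdot N (b : 'I_N -> R) (x : vec N) : C := \big[Cadd/C0]_(j < N) Cmul (RtoC (b j)) (x j).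

Lemma rdot_scale N (b : 'I_N -> R) a x : rdot b (vscale a x) = Cmul a (rdot b x).
Proof. rewrite /rdot sumC_distr; apply: eq_bigr => j _; rewrite /vscale; ring. Qed.
Lemma rdot_add N (b : 'I_N -> R) x y : rdot b (vadd x y) = Cadd (rdot b x) (rdot b y).
Proof. rewrite /rdot -sumC_split; apply: eq_bigr => j _; rewrite /vadd; ring. Qed.

Definition rsq N (b : 'I_N -> R) : R := \big[Rplus/0]_(j < N) (b j * b j).

Lemma rdot_self N (b : 'I_N -> R) : rdot b (fun j => RtoC (b j)) = RtoC (rsq b).
Proof. rewrite /rdot /rsq sum_RtoC; apply: eq_bigr => j _; creal; ring. Qed.

(** The vector b - e_L, normal to the mirror that exchanges the unit vectors b and e_L. *)
Definition unitdiff N (b : 'I_N -> R) (L j : 'I_N) : R := b j - (if j == L then 1 else 0).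

(* When b = e_L the factor / (1 - b L) is 0, and the map is the identity. *)
Definition householder N (b : 'I_N -> R) (L : 'I_N) (x : vec N) : vec N :=
  vadd x (vscale (Copp (Cmul (RtoC (/ (1 - b L))) (rdot (unitdiff b L) x)))
    (fun j => RtoC (unitdiff b L j))).

Lemma rsq_unitdiff N (b : 'I_N -> R) L : rsq b = 1 -> rsq (unitdiff b L) = 2 * (1 - b L).
Proof.
  move=> H.
  have -> : rsq (unitdiff b L) = rsq b + -2 * b L + 1.
  { rewrite -(sumR_delta L b) -{2}(sumR_delta L (fun _ => 1)) /rsq sumR_distr -!sumR_split.
    apply: eq_bigr => j _; rewrite /unitdiff; case: (j == L); ring. }
  rewrite H; ring.
Qed.

(** Valid at y = 0 through / 0 = 0, so that the reflection is an isometric involution without a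
    separate case b = e_L. *)
Lemma inv_sq_cancel y : / y * / y * (2 * y) = 2 * / y.
Proof. case: (Req_dec y 0) => [->|H]; [rewrite Rinv_0; ring|field; lra]. Qed.

Lemma householderK N (b : 'I_N -> R) L x : rsq b = 1 -> householder b L (householder b L x) = x.
Proof.
  move=> Hb; apply: functional_extensionality => i.
  rewrite /householder !rdot_add rdot_scale rdot_self rsq_unitdiff // /vadd /vscale.
  set s := rdot _ x; set k := / (1 - b L); set v := unitdiff b L i.
  have E := inv_sq_cancel (1 - b L); rewrite -/k in E.
  have -> : RtoC (2 * (1 - b L)) = Cmul (RtoC 2) (RtoC (1 - b L)) by creal; ring.
  have EC : Cmul (Cmul (RtoC k) (RtoC k)) (Cmul (RtoC 2) (RtoC (1 - b L))) = Cmul (RtoC 2) (RtoC k).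
  { creal; nra. }
  transitivity (Cadd (x i) (Cmul (Cmul s (RtoC v)) (Csub (Cmul (Cmul (RtoC k) (RtoC k)) (Cmul (RtoC 2) (RtoC (1 - b L)))) (Cmul (RtoC 2) (RtoC k))))).
  - have -> : RtoC 2 = Cadd C1 C1 by creal; ring. ring.
  - rewrite EC; ring.
Qed.

Lemma householder_norm N (b : 'I_N -> R) L x : rsq b = 1 -> vnorm2 (householder b L x) = vnorm2 x.
Proof.
  move=> Hb; rewrite /householder.
  set s := rdot _ x; set k := / (1 - b L).
  have -> : vnorm2 (vadd x (vscale (Copp (Cmul (RtoC k) s)) (fun j => RtoC (unitdiff b L j)))) =
    vnorm2 x + (- 2 * k * Re (Cmul (Cconj s) s) + k * k * Cnorm2 s * rsq (unitdiff b L)).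
  { have -> : Re (Cmul (Cconj s) s) =
      \big[Rplus/0]_(j < N) Re (Cmul (Cconj s) (Cmul (RtoC (unitdiff b L j)) (x j)))
      by rewrite -Re_sum -sumC_distr.
    rewrite /vnorm2 /rsq !sumR_distr -!sumR_split.
    apply: eq_bigr => i _; rewrite /vadd /vscale /Cnorm2 /=; ring. }
  rewrite rsq_unitdiff //.
  have -> : Re (Cmul (Cconj s) s) = Cnorm2 s by rewrite /Cnorm2 /=; ring.
  have E := inv_sq_cancel (1 - b L); rewrite -/k in E.
  have -> : k * k * Cnorm2 s * (2 * (1 - b L)) = Cnorm2 s * (k * k * (2 * (1 - b L))) by ring.
  rewrite E; ring.
Qed.

(** The reflection is symmetric and exchanges b and e_L, so the L-th coordinate of the image of x is
    its pairing with b. In the degenerate case b_L = 1 the unit length of b forces b = e_L. *)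
Lemma householder_coord N (b : 'I_N -> R) L x : rsq b = 1 -> householder b L x L = rdot b x.
Proof.
  move=> Hb; rewrite /householder /vadd /vscale {2}/unitdiff eqxx.
  have E : rdot (unitdiff b L) x = Csub (rdot b x) (x L).
  { rewrite -(sumC_delta L x) /rdot -sum_sub; apply: eq_bigr => j _; rewrite /unitdiff.
    case: (j == L); creal; ring. }
  rewrite E; case: (Req_dec (b L) 1) => HL.
  - rewrite HL.
    have Hz j : j != L -> b j = 0.
    { move=> Hj; have H0 : 1 * 1 + \big[Rplus/0]_(i < N | i != L) (b i * b i) = 1.
      { by rewrite -[RHS]Hb -{1 2}HL; symmetry; exact: sumR_D1. }
      have : b j * b j <= \big[Rplus/0]_(i < N | i != L) (b i * b i).
      { rewrite (bigD1 j) //= -{1}[b j * b j]Rplus_0_r; apply: Rplus_le_compat_l.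
        apply: sumR_ge0 => l _; have := Rle_0_sqr (b l); rewrite /Rsqr; lra. }
      move=> H1; have : b j * b j <= 0 by lra. nra. }
    have -> : rdot b x = x L.
    { rewrite -[RHS](sumC_delta L x); apply: eq_bigr => j _; case: eqP => [->|/eqP Hj].
      - by rewrite HL; creal; ring.
      - by rewrite Hz //; creal; ring. }
    ring.
  - have -> : RtoC (b L - 1) = Copp (RtoC (1 - b L)) by creal; ring.
    have K : Cmul (RtoC (/ (1 - b L))) (RtoC (1 - b L)) = C1 by creal; field; lra.
    have -> : Cmul (Copp (Cmul (RtoC (/ (1 - b L))) (Csub (rdot b x) (x L)))) (Copp (RtoC (1 - b L)))
      = Cmul (Cmul (RtoC (/ (1 - b L))) (RtoC (1 - b L))) (Csub (rdot b x) (x L)) by ring.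
    rewrite K; ring.
Qed.

Lemma householder_cdiff n N (b : 'I_N -> R) L (f : vec n -> vec N) z i :
  (forall i, cdiff (fun w => f w i) z) -> cdiff (fun w => householder b L (f w) i) z.
Proof.
  move=> Hf; apply: cdiff_add; first exact: Hf.
  apply: cdiff_mul; last exact: cdiff_const.
  apply: cdiff_opp; apply: cdiff_scal; apply: cdiff_sum => j; apply: cdiff_scal; exact: Hf.
Qed.

(** The automorphism of the ball that sends 0 to c e_L. It carries the slice w_L = 0 onto the slice
    w_L = c, where it acts on the other coordinates as multiplication by sqrt(1 - c^2). *)
Definition ball_mobius N (c : R) (L : 'I_N) (w : vec N) : vec N := fun i =>
  Cmul (if i == L then Cadd (w L) (RtoC c) else Cmul (RtoC (sqrt (1 - c * c))) (w i))
       (Cinv (Cadd C1 (Cmul (RtoC c) (w L)))).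

Lemma ball_mobius_den c z : c * c < 1 -> Cnorm2 z < 1 -> Cadd C1 (Cmul (RtoC c) z) <> C0.
Proof.
  move=> Hc Hz; have -> : RtoC c = Cconj (RtoC c) by creal; ring.
  by apply: mobius_den; rewrite ?Cnorm2_RtoC //; lra.
Qed.

Lemma ball_coord N (w : vec N) i : ball w -> Cnorm2 (w i) < 1.
Proof. by apply: Rle_lt_trans; apply: vnorm2_coord. Qed.

Lemma ball_mobius_ball N c (L : 'I_N) w : c * c < 1 -> ball w -> ball (ball_mobius c L w).
Proof.
  move=> Hc Hw; have HL := ball_coord L Hw.
  have Hd := ball_mobius_den Hc HL; have Hp := Cnorm2_pos Hd.
  set D := Cadd C1 _ in Hd Hp.
  have Hs : sqrt (1 - c * c) * sqrt (1 - c * c) = 1 - c * c by apply: sqrt_sqrt; lra.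
  have E : vnorm2 (ball_mobius c L w) =
    (Cnorm2 (Cadd (w L) (RtoC c)) + (1 - c * c) * (vnorm2 w - Cnorm2 (w L))) * / Cnorm2 D.
  { have -> : vnorm2 w - Cnorm2 (w L) = \big[Rplus/0]_(i < N | i != L) Cnorm2 (w i).
    { rewrite /vnorm2 (sumR_D1 L); ring. }
    rewrite /vnorm2 (sumR_D1 L) sumR_distr Rmult_plus_distr_r (Rmult_comm (\big[_/_]_(_ <- _ | _) _)) sumR_distr.
    rewrite /ball_mobius eqxx -/D Cnorm2M Cnorm2_inv //; congr Rplus.
    apply: eq_bigr => i /negbTE ->; rewrite !Cnorm2M Cnorm2_inv // Cnorm2_RtoC Hs; ring. }
  have ED : Cnorm2 D = Cnorm2 (Cadd (w L) (RtoC c)) + (1 - c * c) * (1 - Cnorm2 (w L)).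
  { rewrite /D /Cnorm2 /=; ring. }
  rewrite /ball E; apply: (Rmult_lt_reg_r (Cnorm2 D)) => //.
  rewrite Rmult_assoc Rinv_l; last lra.
  rewrite /ball in Hw; rewrite ED; nra.
Qed.

Lemma ball_mobiusK N c (L : 'I_N) w : c * c < 1 -> ball w ->
  ball_mobius (- c) L (ball_mobius c L w) = w.
Proof.
  move=> Hc Hw; have HL := ball_coord L Hw.
  have Hd := ball_mobius_den Hc HL.
  have Hs : Cmul (RtoC (sqrt (1 - c * c))) (RtoC (sqrt (1 - c * c))) = Csub C1 (Cmul (RtoC c) (RtoC c)).
  { have := sqrt_sqrt (1 - c * c) ltac:(lra) => Hs; creal; lra. }
  have H1 : Csub C1 (Cmul (RtoC c) (RtoC c)) <> C0 by move=> /(f_equal Re) /=; lra.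
  have Ho : RtoC (- c) = Copp (RtoC c) by creal; ring.
  have Hd2 : Cadd C1 (Cmul (Copp (RtoC c)) (Cmul (Cadd (w L) (RtoC c)) (Cinv (Cadd C1 (Cmul (RtoC c) (w L)))))) =
     Cmul (Csub C1 (Cmul (RtoC c) (RtoC c))) (Cinv (Cadd C1 (Cmul (RtoC c) (w L)))) by field.
  apply: functional_extensionality => i; rewrite /ball_mobius eqxx Ho Hd2.
  have -> : - c * - c = c * c by ring.
  case: eqP => [->|_].
  - by field.
  - transitivity (Cmul (Cmul (RtoC (sqrt (1 - c * c))) (RtoC (sqrt (1 - c * c)))) (Cmul (w i) (Cinv (Csub C1 (Cmul (RtoC c) (RtoC c)))))).
    + by field.
    + rewrite Hs; by field.
Qed.

Lemma ball_mobius_holo N c (L : 'I_N) : c * c < 1 -> holo_on (@ball N) (ball_mobius c L).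
Proof.
  move=> Hc w Hw; apply/holo_at_cdiff => i; apply: cdiff_mul.
  - case: (i == L); first by apply: cdiff_add; [exact: cdiff_coord|exact: cdiff_const].
    by apply: cdiff_scal; exact: cdiff_coord.
  - apply: cdiff_inv; last by apply: ball_mobius_den => //; exact: ball_coord.
    apply: cdiff_add; first exact: cdiff_const. by apply: cdiff_scal; exact: cdiff_coord.
Qed.

Lemma holo_comp n m p (D : vec n -> Prop) (E : vec m -> Prop) (F : vec n -> vec m) (G : vec m -> vec p) :
  holo_on D F -> maps_into D E F -> holo_on E G -> holo_on D (fun z => G (F z)).
Proof.
  move=> HF HM HG z Hz; apply/holo_at_cdiff => i.
  apply: (cdiff_comp (F := F) (G := fun w => G w i)).
  - exact: (proj1 (holo_at_cdiff _ _) (HF z Hz)).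
  - exact: (proj1 (holo_at_cdiff _ _) (HG _ (HM z Hz))).
Qed.

Lemma holo_id n (D : vec n -> Prop) : holo_on D (fun z => z).
Proof. by move=> z _; apply/holo_at_cdiff => i; exact: cdiff_coord. Qed.

Lemma is_aut_id n (D : vec n -> Prop) : is_aut D (fun z => z).
Proof. exists (fun z => z); split; [exact: holo_id|split; [exact: holo_id|]]; rewrite /maps_into; tauto. Qed.

Lemma householder_holo N (b : 'I_N -> R) L (D : vec N -> Prop) : holo_on D (householder b L).
Proof.
  move=> z _; apply/holo_at_cdiff => i.
  apply: (@householder_cdiff N N b L (fun w => w) z i) => j; exact: cdiff_coord.
Qed.

Lemma householder_ball N (b : 'I_N -> R) L : rsq b = 1 -> maps_into (@ball N) (@ball N) (householder b L).
Proof. by move=> Hb w; rewrite /ball householder_norm. Qed.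

Lemma is_aut_affine N (b : 'I_N -> R) c L : rsq b = 1 -> c * c < 1 ->
  is_aut (@ball N) (fun w => householder b L (ball_mobius c L w)).
Proof.
  move=> Hb Hc; exists (fun w => ball_mobius (- c) L (householder b L w)).
  have Hc' : - c * - c < 1 by lra.
  split; [|split; [|split; [|split; [|split]]]].
  - apply: (holo_comp (E := @ball N)); [exact: ball_mobius_holo| |exact: householder_holo].
    by move=> z; exact: ball_mobius_ball.
  - apply: (holo_comp (E := @ball N)); [exact: householder_holo| |exact: ball_mobius_holo].
    exact: householder_ball.
  - by move=> z Hz; apply: householder_ball => //; exact: ball_mobius_ball.
  - by move=> z Hz; apply: ball_mobius_ball => //; exact: householder_ball.
  - by move=> z Hz; rewrite householderK // ball_mobiusK.
  - move=> z Hz; have := ball_mobiusK L Hc' (householder_ball L Hb Hz).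
    by rewrite Ropp_involutive => ->; rewrite householderK.
Qed.

Lemma ball0 n : ball (fun _ : 'I_n => C0).
Proof. rewrite /ball vnorm2_0; lra. Qed.

(** The reflection moves the image of F into the slice w_L = c, a ball of radius s = sqrt(1 - c^2)
    and one dimension less. Dividing the remaining coordinates by s gives a map G into the smaller
    unit ball, and [ball_mobius] restores the slice from (G, 0). *)
Lemma minimum_ball_unit n N (F : vec n -> vec N) (b : 'I_N -> R) c :
  minimum_ball F -> holo_on (@ball n) F -> maps_into (@ball n) (@ball N) F ->
  (forall z, ball z -> rdot b (F z) = RtoC c) -> rsq b = 1 -> False.
Proof.
  case: N F b => [|N] F b Hmin HF HM Hc Hb.
  { move: Hb; rewrite /rsq big_ord0; lra. }
  pose L := @ord_max N.
  have Hc1 : c * c < 1.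
  { have := HM _ (ball0 n); rewrite /ball => HF0.
    have := cauchy_schwarz (fun j => RtoC (b j)) (F (fun _ => C0)).
    rewrite -/(rdot b (F (fun _ => C0))) Hc ?Cnorm2_RtoC; last exact: ball0.
    have -> : vnorm2 (fun j => RtoC (b j)) = rsq b.
    { by apply: eq_bigr => j _; rewrite Cnorm2_RtoC. }
    rewrite Hb; lra. }
  pose s := sqrt (1 - c * c).
  have Hs : s * s = 1 - c * c by apply: sqrt_sqrt; lra.
  have s0 : 0 < s by apply: sqrt_lt_R0; lra.
  pose H z := householder b L (F z).
  have HL z : ball z -> H z L = RtoC c by move=> Hz; rewrite /H householder_coord // Hc.
  pose G z : vec N := fun j => Cmul (RtoC (/ s)) (H z (widen_ord (leqnSn N) j)).
  apply: Hmin; exists (fun z => z), (fun w => householder b L (ball_mobius c L w)), G.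
  split; first exact: is_aut_id.
  split; first exact: is_aut_affine.
  split; [|split].
  - move=> z Hz; apply/holo_at_cdiff => i; apply: cdiff_scal.
    apply: householder_cdiff => j; exact: (proj1 (holo_at_cdiff _ _) (HF z Hz)).
  - move=> z Hz; have := HM z Hz; rewrite /ball => HFz.
    have : vnorm2 (H z) < 1 by rewrite /H householder_norm.
    rewrite {1}/vnorm2 big_ord_recr /= -/L HL // Cnorm2_RtoC => Hlt.
    have -> : vnorm2 (G z) = / s * / s * \big[Rplus/0]_(i < N) Cnorm2 (H z (widen_ord (leqnSn N) i)).
    { by rewrite /vnorm2 sumR_distr; apply: eq_bigr => i _; rewrite /G Cnorm2M Cnorm2_RtoC. }
    set S := \big[Rplus/0]_(i < N) _ in Hlt *.
    apply: (Rmult_lt_reg_l (s * s)); first nra.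
    have -> : s * s * (/ s * / s * S) = S by field; lra.
    rewrite Hs; change (S + c * c < 1) in Hlt; lra.
  - move=> z Hz.
    have -> : ball_mobius c L (padzero (q := N.+1) G z) = H z; last by rewrite /H householderK.
    apply: functional_extensionality => i.
    have PL : padzero (q := N.+1) G z L = C0.
    { by rewrite /padzero insubF //= ltnn. }
    rewrite /ball_mobius PL.
    have -> : Cadd C1 (Cmul (RtoC c) C0) = C1 by ring.
    have -> : Cinv C1 = C1 by rewrite /Cinv Cnorm2_1; creal; field.
    case: eqP => [->|/eqP Hi].
    + rewrite HL //; ring.
    + have Hlt : (i < N)%N.
      { have := ltn_ord i; rewrite ltnS leq_eqVlt => /orP [/eqP E|//].
        by move/eqP: Hi; case; apply: val_inj. }
      rewrite /padzero (insubT (fun k => (k < N)%N) Hlt) /G -/s.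
      have -> : widen_ord (leqnSn N) (Sub (nat_of_ord i) Hlt) = i by apply: val_inj.
      have K : Cmul (RtoC s) (RtoC (/ s)) = C1 by creal; field; lra.
      transitivity (Cmul (Cmul (RtoC s) (RtoC (/ s))) (H z i)); first by ring.
      rewrite K; ring.
Qed.

Lemma minimum_ball_linear n N (F : vec n -> vec N) (b : 'I_N -> R) :
  minimum_ball F -> holo_on (@ball n) F -> maps_into (@ball n) (@ball N) F ->
  (forall z, ball z -> rdot b (F z) = C0) -> forall j, b j = 0.
Proof.
  move=> Hmin HF HM Hb j; apply: NNPP => Hj.
  have Hs : 0 < rsq b.
  { have := sumR_term_le (F := fun i => b i * b i) j (fun i => Rle_0_sqr (b i)); rewrite -/(rsq b) => ?.
    have : 0 < b j * b j by have := Rsqr_pos_lt _ Hj. lra. }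
  pose t := sqrt (rsq b).
  have Ht : t * t = rsq b by apply: sqrt_sqrt; lra.
  have t0 : 0 < t by apply: sqrt_lt_R0.
  apply: (minimum_ball_unit (b := fun j => / t * b j) (c := 0) Hmin HF HM).
  - move=> z Hz.
    have -> : rdot (fun j => / t * b j) (F z) = Cmul (RtoC (/ t)) (rdot b (F z)).
    { rewrite /rdot sumC_distr; apply: eq_bigr => i _; creal; ring. }
    rewrite Hb //; creal; ring.
  - have -> : rsq (fun j => / t * b j) = / t * / t * rsq b.
    { rewrite /rsq sumR_distr; apply: eq_bigr => i _; ring. }
    rewrite -Ht; field; lra.
Qed.

Lemma minimum_ball_nonconstant n N (F : vec n -> vec N) i c :
  minimum_ball F -> holo_on (@ball n) F -> maps_into (@ball n) (@ball N) F ->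
  ~ (forall z, ball z -> F z i = RtoC c).
Proof.
  move=> Hmin HF HM Hc.
  apply: (minimum_ball_unit (b := fun j => if j == i then 1 else 0) (c := c) Hmin HF HM).
  - move=> z Hz; rewrite -(Hc z Hz) -[RHS](sumC_delta i); apply: eq_bigr => j _.
    by case: (j == i).
  - rewrite -[RHS](sumR_delta i (fun _ => 1)); apply: eq_bigr => j _; case: (j == i); ring.
Qed.

(** * Polynomials, monomials and properness *)

Definition peval (l : seq R) (t : R) : R := foldr (fun a acc => a + t * acc) 0 l.
Definition polyfun (p : R -> R) : Prop := exists l, forall t, p t = peval l t.

Lemma polyfun_const c : polyfun (fun _ => c).
Proof. by exists [:: c] => t /=; ring. Qed.
Lemma polyfun_add p q : polyfun p -> polyfun q -> polyfun (fun t => p t + q t).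
Proof.
  move=> [l Hl] [k Hk].
  have [s Hs] : exists s, forall t, peval s t = peval l t + peval k t.
  { elim: l k {p q Hl Hk} => [|a l IH] k; first by exists k => t /=; ring.
    case: k => [|b k]; first by exists (a :: l) => t /=; ring.
    have [s Hs] := IH k; exists (a + b :: s) => t /=; rewrite Hs; ring. }
  by exists s => t; rewrite Hl Hk Hs.
Qed.
Lemma polyfun_scal c p : polyfun p -> polyfun (fun t => c * p t).
Proof.
  move=> [l Hl]; exists [seq c * a | a <- l] => t; rewrite Hl.
  elim: l {p Hl} => [|a l IH] /=; first by ring. rewrite -IH; ring.
Qed.
Lemma polyfun_mulX p : polyfun p -> polyfun (fun t => t * p t).
Proof. by move=> [l Hl]; exists (0 :: l) => t /=; rewrite Hl; ring. Qed.
Lemma polyfun_ext p q : (forall t, p t = q t) -> polyfun p -> polyfun q.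
Proof. by move=> E [l Hl]; exists l => t; rewrite -E. Qed.
Lemma polyfun_mul p q : polyfun p -> polyfun q -> polyfun (fun t => p t * q t).
Proof.
  move=> [l Hl] Hq; apply: (polyfun_ext (p := fun t => peval l t * q t)); first by move=> t; rewrite Hl.
  elim: l {p Hl} => [|a l IH].
  - apply: (polyfun_ext _ (polyfun_const 0)) => t /=; ring.
  - apply: (polyfun_ext _ (polyfun_add (polyfun_scal a Hq) (polyfun_mulX IH))) => t /=; ring.
Qed.
Lemma polyfun_pow d : polyfun (fun t => t ^ d).
Proof.
  elim: d => [|d IH]; first exact: polyfun_const.
  exact: polyfun_mulX.
Qed.
Lemma polyfun_sum n (p : 'I_n -> R -> R) : (forall i, polyfun (p i)) ->
  polyfun (fun t => \big[Rplus/0]_(i < n) p i t).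
Proof.
  elim: n p => [|n IH] p Hp.
  - apply: (polyfun_ext _ (polyfun_const 0)) => t; by rewrite big_ord0.
  - apply: (polyfun_ext _ (polyfun_add (Hp ord0) (IH (fun i => p (lift ord0 i)) (fun i => Hp _)))) => t.
    by rewrite big_ord_recl.
Qed.

Lemma peval_bound l : exists M, 0 <= M /\ forall t, 0 < t < 1 -> Rabs (peval l t) <= M.
Proof.
  elim: l => [|a l [M [HM H]]]; first by exists 0; split; [lra|move=> t _ /=; rewrite Rabs_R0; lra].
  exists (Rabs a + M); split; first by have := Rabs_pos a; lra.
  move=> t Ht /=; apply: Rle_trans (Rabs_triang _ _) _; apply: Rplus_le_compat_l.
  rewrite Rabs_mult (Rabs_pos_eq t); last lra.
  have := H t Ht; have := Rabs_pos (peval l t); rewrite -/(peval l t); nra.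
Qed.

(** The constant coefficient is the limit at 0 from the right, hence 0; on (0, e) the remaining
    factor t can be cancelled, and induction on the coefficient list finishes. *)
Lemma polyfun_zero p e : polyfun p -> 0 < e -> (forall t, 0 < t < e -> p t = 0) -> forall t, p t = 0.
Proof.
  move=> [l Hl] He H0 t; rewrite Hl.
  have {}H0 : forall t, 0 < t < e -> peval l t = 0 by move=> s Hs; rewrite -Hl H0.
  elim: l H0 t {p Hl} => [//|a l IH] H0 t /=.
  have [M [HM HB]] := peval_bound l.
  have Ha : a = 0.
  { apply: cond_eq => d Hd; rewrite Rminus_0_r.
    pose s := Rmin (Rmin (1 / 2) (e / 2)) (d / (2 * (M + 1))).
    have M1 := Rmin_l (Rmin (1 / 2) (e / 2)) (d / (2 * (M + 1))).
    have M2 := Rmin_r (Rmin (1 / 2) (e / 2)) (d / (2 * (M + 1))).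
    have M3 := Rmin_l (1 / 2) (e / 2); have M4 := Rmin_r (1 / 2) (e / 2).
    have s0 : 0 < s by do 2? apply: Rmin_pos; try lra; apply: Rdiv_lt_0_compat; lra.
    have := H0 s; rewrite /= -/(peval l s) => K.
    have {}K : a = - (s * peval l s) by have := K ltac:(rewrite /s in s0 *; lra); lra.
    have B := HB s ltac:(rewrite /s in s0 *; lra).
    rewrite K Rabs_Ropp Rabs_mult (Rabs_pos_eq s); last lra.
    apply: Rle_lt_trans (_ : d / (2 * (M + 1)) * (M + 1) < d).
    - apply: Rmult_le_compat; try lra; [exact: Rabs_pos|exact: M2].
    - have -> : d / (2 * (M + 1)) * (M + 1) = d / 2 by field; lra. lra. }
  rewrite Ha -/(peval l t) IH; first by ring.
  move=> s Hs; have := H0 s Hs; rewrite /= -/(peval l s) Ha => K.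
  have : s * peval l s = 0 by lra. nra.
Qed.

Lemma Cpow_scale r z d : Cpow (Cmul (RtoC r) z) d = Cmul (RtoC (r ^ d)) (Cpow z d).
Proof.
  elim: d => [|d IH] /=; first by creal; ring.
  rewrite IH; have -> : RtoC (r * r ^ d) = Cmul (RtoC r) (RtoC (r ^ d)) by creal; ring. ring.
Qed.
Lemma Cpow_conj z d : Cpow (Cconj z) d = Cconj (Cpow z d).
Proof. elim: d => [|d IH] /=; [creal; ring|rewrite IH; creal; ring]. Qed.
Lemma Cpow_C1 d : Cpow C1 d = C1.
Proof. elim: d => [//|d IH] /=; rewrite IH; ring. Qed.

Definition mdeg n (alpha : 'I_n -> nat) : nat := \sum_(j < n) alpha j.

Lemma monom_scale n (alpha : 'I_n -> nat) r z :
  monom alpha (vscale (RtoC r) z) = Cmul (RtoC (r ^ mdeg alpha)) (monom alpha z).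
Proof.
  rewrite /mdeg (big_morph (fun d => RtoC (r ^ d)) (id1 := C1) (op1 := Cmul)); first last.
  - by creal.
  - move=> x y; rewrite -plusE pow_add; creal; ring.
  rewrite -big_split; apply: eq_bigr => j _; exact: Cpow_scale.
Qed.

Lemma monom_conj n (alpha : 'I_n -> nat) z : monom alpha (vconj z) = Cconj (monom alpha z).
Proof.
  rewrite /monom (big_morph Cconj (id1 := C1) (op1 := Cmul)); first last.
  - by creal; ring.
  - by move=> x y; creal; ring.
  by apply: eq_bigr => j _; rewrite -Cpow_conj.
Qed.

Lemma monom_ones n (alpha : 'I_n -> nat) : monom alpha (fun _ => C1) = C1.
Proof. by rewrite /monom big1 // => j _; rewrite Cpow_C1. Qed.

Lemma monom_deg0 n (alpha : 'I_n -> nat) z : mdeg alpha = 0%N -> monom alpha z = C1.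
Proof.
  move=> H; rewrite /monom big1 // => j _.
  by move/eqP: H; rewrite /mdeg sum_nat_eq0 => /forallP /(_ j) /eqP ->.
Qed.

(** * Compact sets and properness *)

Lemma is_open_nb n (U : vec n -> Prop) : is_open U <-> forall z, U z -> nb z U.
Proof. by []. Qed.

Lemma compact_closed n (K : vec n -> Prop) : compact K -> is_open (fun z => ~ K z).
Proof.
  move=> HK z0 Hz0.
  have [||l Hl] := HK {e : R | 0 < e} (fun e Z => sval e < vnorm2 (vsub Z z0)).
  - move=> [e He]; apply/is_open_nb => z /= Hz.
    apply: (rlim_gt (FF := nb_filter z) _ Hz).
    apply: clim_vnorm2 => i; apply: clim_sub; [exact: clim_coord|exact: clim_const].
  - move=> z Hz.
    case: (Rle_lt_or_eq_dec _ _ (vnorm2_ge0 (vsub z z0))) => [Hp|Hp].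
    + have He : 0 < vnorm2 (vsub z z0) / 2 by lra.
      exists (exist _ _ He) => /=; lra.
    + by case: Hz0; rewrite -(vsub_eq (esym Hp)).
  - have [e [He Hm]] : exists e, 0 < e /\ forall x, List.In x l -> e <= sval x.
    { elim: l {Hl} => [|[x Hx] l [e [He IH]]]; first by exists 1; split; [lra|].
      exists (Rmin x e); split; first exact: Rmin_pos.
      move=> y /= [<-|/IH H] /=; first exact: Rmin_l.
      apply: Rle_trans H; exact: Rmin_r. }
    apply: (nb_intro He) => w Hw Kw.
    have [x [Hx Hx2]] := Hl w Kw; have := Hm x Hx; lra.
Qed.

(* The compact set pi {Z in K : |pi Z|^2 = 1 - g Z} of the ball contains F {z : M z in K}. *)
Lemma proper_of_retraction n N m (F : vec n -> vec N) (M : vec n -> vec m) (pi : vec m -> vec N)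
  (g : vec m -> R) (D : vec m -> Prop) :
  proper_map (@ball n) (@ball N) F ->
  (forall z, ball z -> forall i, cdiff (fun w => M w i) z) ->
  (forall Z i, cdiff (fun W => pi W i) Z) ->
  (forall Z, rlim g (nb Z) (g Z)) ->
  (forall Z, D Z -> 0 < g Z) ->
  (forall z, ball z -> pi (M z) = F z /\ vnorm2 (F z) = 1 - g (M z)) ->
  proper_map (@ball n) D M.
Proof.
  move=> HF HM Hpi Hg HD HMF K HKD HK.
  have Cpi Z : filterlim pi (nb Z) (nb (pi Z)).
  { by apply: filterlim_coords => i; apply: cdiff_clim; exact: Hpi. }
  have Npi Z : rlim (fun W => vnorm2 (pi W) - (1 - g W)) (nb Z) (vnorm2 (pi Z) - (1 - g Z)).
  { apply: rlim_add; first by apply: clim_vnorm2 => i; apply: cdiff_clim; exact: Hpi.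
    apply: rlim_opp; apply: rlim_add; [exact: rlim_const|apply: rlim_opp; exact: Hg]. }
  pose K2 w := exists Z, K Z /\ vnorm2 (pi Z) = 1 - g Z /\ pi Z = w.
  have HK2 : compact K2.
  { move=> I U HU Hcov.
    (* The extra index [None] carries the open set where |pi Z|^2 differs from 1 - g Z. With it the
       pulled-back cover reaches all of K, and it can be discarded on the closed part that maps onto
       [K2]. *)
    pose V (o : option I) Z := match o with Some i => U i (pi Z) | None => vnorm2 (pi Z) - (1 - g Z) <> 0 end.
    have [||l Hl] := HK (option I) V.
    - move=> [i|]; apply/is_open_nb => Z /= HZ.
      + exact: (Cpi Z _ (HU i _ HZ)).
      + case: (Rtotal_order (vnorm2 (pi Z) - (1 - g Z)) 0) => [H|[//|H]].
        * apply: (filter_mono (FF := nb_filter Z) (rlim_lt (FF := nb_filter Z) (Npi Z) H)) => W ? ?; lra.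
        * apply: (filter_mono (FF := nb_filter Z) (rlim_gt (FF := nb_filter Z) (Npi Z) H)) => W ? ?; lra.
    - move=> Z HZ; case: (Req_dec (vnorm2 (pi Z)) (1 - g Z)) => E.
      + have [i Hi] := Hcov (pi Z) (ex_intro _ Z (conj HZ (conj E erefl))).
        by exists (Some i).
      + by exists None => /=; lra.
    - exists (List.flat_map (fun o => match o with Some i => [:: i] | None => [::] end) l).
      move=> w [Z [HZ [E <-]]]; have [[i|] [Hi HV]] := Hl Z HZ; last by case: HV; lra.
      exists i; split=> //; apply/List.in_flat_map; exists (Some i); split=> //; by left. }
  have HL := HF K2 _ HK2.
  have {}HL : compact (fun z => ball z /\ K2 (F z)).
  { apply: HL => w [Z [HZ [E <-]]]; rewrite /ball E; have := HD Z (HKD Z HZ); lra. }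
  have KC := compact_closed HK.
  move=> I U HU Hcov.
  (* Here [None] carries the open set of those z in the ball with M z outside K; it completes a
     cover of the larger compact set and meets no point of the set in question. *)
  pose V (o : option I) z := match o with Some i => U i z | None => ball z /\ ~ K (M z) end.
  have [||l Hl] := HL (option I) V.
  - move=> [i|]; first exact: HU.
    apply/is_open_nb => z [Hz HKz].
    have CM : filterlim M (nb z) (nb (M z)).
    { by apply: filterlim_coords => i; apply: cdiff_clim; exact: HM. }
    have G1 := CM _ (KC _ HKz).
    have G2 : nb z (@ball n).
    { apply: (rlim_lt (FF := nb_filter z) _ Hz); apply: clim_vnorm2 => i; exact: clim_coord. }
    exact: (filter_and _ _ G2 G1).
  - move=> z [Hz _]; case: (excluded_middle_informative (K (M z))) => HKz.
    + have [i Hi] := Hcov z (conj Hz HKz); by exists (Some i).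
    + by exists None.
  - exists (List.flat_map (fun o => match o with Some i => [:: i] | None => [::] end) l).
    move=> z [Hz HKz].
    have [E1 E2] := HMF z Hz.
    have K2z : K2 (F z) by exists (M z); split=> //; rewrite E1.
    have [[i|] [Hi HV]] := Hl z (conj Hz K2z); last by case: HV.
    exists i; split=> //; apply/List.in_flat_map; exists (Some i); split=> //; by left.
Qed.

(** * The maps M *)

Lemma sum_pairs T idx (op : Monoid.com_law idx) K (G : nat -> T) :
  \big[op/idx]_(0 <= p < K.*2) G p = \big[op/idx]_(0 <= j < K) op (G j.*2) (G j.*2.+1).
Proof.
  elim: K => [|K IH]; first by rewrite !big_geq.
  by rewrite doubleS !big_nat_recr //= IH Monoid.mulmA.
Qed.

(** The layout of the coordinates of M with K = k - 1: the pair 2j, 2j+1 for j < K, the single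
    position j + K for K <= j < N, and the last position N + K. *)
Lemma split_sum T idx (op : Monoid.com_law idx) N K (G : nat -> T) : (K <= N)%N ->
  \big[op/idx]_(i < N + K.+1) G i =
  op (\big[op/idx]_(j < N | (j < K)%N) op (G j.*2) (G j.*2.+1))
     (op (\big[op/idx]_(j < N | (K <= j)%N) G (j + K)%N) (G (N + K)%N)).
Proof.
  move=> HK; rewrite addnS big_ord_recr /= Monoid.mulmA; congr (op _ _).
  rewrite -(big_mkord xpredT G) (big_cat_nat (n := K.*2)) //=; last first.
  { by rewrite -addnn leq_add2r. }
  rewrite sum_pairs; congr (op _ _).
  - by rewrite (big_nat_widen 0 K N) // big_mkord; apply: eq_bigl => j; rewrite andTb.
  - rewrite -addnn big_addn addnK (big_nat_widenl K 0 N) // big_mkord.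
    by apply: eq_bigl => j; rewrite andTb.
Qed.

Lemma split_sumR N K (G : nat -> R) : (K <= N)%N ->
  \big[Rplus/0]_(i < N + K.+1) G i =
  \big[Rplus/0]_(j < N | (j < K)%N) (G j.*2 + G j.*2.+1) +
  (\big[Rplus/0]_(j < N | (K <= j)%N) G (j + K)%N + G (N + K)%N).
Proof. exact: split_sum. Qed.
Lemma split_sumC N K (G : nat -> C) : (K <= N)%N ->
  \big[Cadd/C0]_(i < N + K.+1) G i =
  Cadd (\big[Cadd/C0]_(j < N | (j < K)%N) Cadd (G j.*2) (G j.*2.+1))
  (Cadd (\big[Cadd/C0]_(j < N | (K <= j)%N) G (j + K)%N) (G (N + K)%N)).
Proof. exact: split_sum. Qed.

Lemma sumR_cases N K (G : 'I_N -> R) :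
  \big[Rplus/0]_(j < N | (j < K)%N) G j + \big[Rplus/0]_(j < N | (K <= j)%N) G j =
  \big[Rplus/0]_(j < N) G j.
Proof.
  have := bigID (fun j : 'I_N => (j < K)%N) xpredT G (op := Rplus) (r := index_enum 'I_N).
  move=> /= ->; congr Rplus; apply: eq_bigl => j; by rewrite -leqNgt.
Qed.
Lemma sumC_cases N K (G : 'I_N -> C) :
  Cadd (\big[Cadd/C0]_(j < N | (j < K)%N) G j) (\big[Cadd/C0]_(j < N | (K <= j)%N) G j) =
  \big[Cadd/C0]_(j < N) G j.
Proof.
  have := bigID (fun j : 'I_N => (j < K)%N) xpredT G (op := Cadd) (r := index_enum 'I_N).
  move=> /= ->; congr Cadd; apply: eq_bigl => j; by rewrite -leqNgt.
Qed.

Definition vnth n (z : vec n) (p : nat) : C :=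
  match (insub p : option 'I_n) with Some i => z i | None => C0 end.

Lemma vnth_ord n (z : vec n) (i : 'I_n) : vnth z i = z i.
Proof. by rewrite /vnth valK. Qed.

Lemma vnth_cdiff n m (F : vec n -> vec m) z p : (forall i, cdiff (fun w => F w i) z) ->
  cdiff (fun w => vnth (F w) p) z.
Proof. by move=> H; rewrite /vnth; case: insubP => [i _ _|_]; [exact: H|exact: cdiff_const]. Qed.

(** Paired components enter S with weight cos(2 th) and the others with weight 1, so one weighted
    sum stands for both sums under the square root. *)
Definition lam N K th (j : 'I_N) : R := if (j < K)%N then cos (2 * th) else 1.

Definition Ssum N K th (f : vec N) : C :=
  \big[Cadd/C0]_(j < N) Cmul (RtoC (lam K th j)) (Cmul (f j) (f j)).

Definition Mlast N K th (f : vec N) : C := Csub C1 (Csqrt (Csub C1 (Ssum K th f))).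

Definition Mnat N K th (f : vec N) (p : nat) : C :=
  if (p < K.*2)%N then
    (if ~~ odd p then Cmul (RtoC (cos th)) (vnth f p./2)
     else Cmul (Cmul Ci (RtoC (sin th))) (vnth f p./2))
  else if (p < N + K)%N then vnth f (p - K) else Mlast K th f.

Lemma MmapE n N (F : vec n -> vec N) th K z : (K <= N)%N ->
  Mmap F th K.+1 z = fun i => Mnat K th (F z) i.
Proof.
  move=> HK; apply: functional_extensionality => i; rewrite /Mmap /Mnat; move: (nat_of_ord i) => p; rewrite addnS !subn1 /= mul2n.
  case: ifP => // _; case: ifP => // _.
  rewrite /Mlast; congr (Csub C1 (Csqrt _)).
  rewrite /Ssum -(sumC_cases K).
  have -> : \big[Cadd/C0]_(j < N | (j < K)%N) Cmul (RtoC (lam K th j)) (Cmul (F z j) (F z j)) =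
    Cmul (RtoC (cos (2 * th))) (\big[Cadd/C0]_(j < N | (j < K)%N) Cmul (F z j) (F z j)).
  { by rewrite sumC_distr; apply: eq_bigr => j Hj; rewrite /lam Hj. }
  have -> : \big[Cadd/C0]_(j < N | (K <= j)%N) Cmul (RtoC (lam K th j)) (Cmul (F z j) (F z j)) =
    \big[Cadd/C0]_(j < N | (K <= j)%N) Cmul (F z j) (F z j).
  { apply: eq_bigr => j Hj; rewrite /lam ltnNge Hj /=.
    have -> : RtoC 1 = C1 by []. ring. }
  have G a b : Csub (Csub C1 a) b = Csub C1 (Cadd a b) by ring.
  exact: G.
Qed.

Lemma Mnat_even N K th (f : vec N) (j : 'I_N) : (j < K)%N ->
  Mnat K th f j.*2 = Cmul (RtoC (cos th)) (f j).
Proof. by move=> Hj; rewrite /Mnat ltn_double Hj odd_double /= doubleK vnth_ord. Qed.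
Lemma Mnat_odd N K th (f : vec N) (j : 'I_N) : (j < K)%N ->
  Mnat K th f j.*2.+1 = Cmul (Cmul Ci (RtoC (sin th))) (f j).
Proof.
  move=> Hj; rewrite /Mnat ltn_Sdouble Hj /= odd_double /=.
  by rewrite uphalf_double vnth_ord.
Qed.
Lemma Mnat_mid N K th (f : vec N) (j : 'I_N) : (K <= j)%N -> Mnat K th f (j + K) = f j.
Proof.
  move=> Hj; rewrite /Mnat -addnn ltn_add2r ltnNge Hj /= ltn_add2r ltn_ord addnK vnth_ord //.
Qed.
Lemma Mnat_last N K th (f : vec N) : (K <= N)%N -> Mnat K th f (N + K) = Mlast K th f.
Proof. by move=> HK; rewrite /Mnat -addnn ltn_add2r ltnNge HK /= ltnn. Qed.

Lemma vnorm2_M n N (F : vec n -> vec N) th K z : (K <= N)%N ->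
  vnorm2 (Mmap F th K.+1 z) = vnorm2 (F z) + Cnorm2 (Mlast K th (F z)).
Proof.
  move=> HK; rewrite MmapE // /vnorm2 (split_sumR (fun p => Cnorm2 (Mnat K th (F z) p)) HK).
  rewrite Mnat_last // -Rplus_assoc -(sumR_cases K); congr (_ + _ + _).
  - apply: eq_bigr => j Hj; rewrite Mnat_even // Mnat_odd // !Cnorm2M !Cnorm2_RtoC.
    have -> : Cnorm2 Ci = 1 by rewrite /Cnorm2 /=; ring.
    have := sin2_cos2 th; rewrite /Rsqr => E.
    transitivity ((sin th * sin th + cos th * cos th) * Cnorm2 (F z j)); [ring|rewrite E; ring].
  - by apply: eq_bigr => j Hj; rewrite Mnat_mid.
Qed.

(** Without conjugation the factor i of a pair squares to -1, so the pair contributes cos^2 - sin^2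
    = cos(2 th), the weight [lam]; in the Hermitian norm the same pair contributes cos^2 + sin^2 =
    1. *)
Lemma vbil_M n N (F : vec n -> vec N) th K z : (K <= N)%N ->
  vbil (Mmap F th K.+1 z) = Cadd (Ssum K th (F z)) (Cmul (Mlast K th (F z)) (Mlast K th (F z))).
Proof.
  move=> HK; rewrite MmapE // /vbil (split_sumC (fun p => Cmul (Mnat K th (F z) p) (Mnat K th (F z) p)) HK).
  rewrite Mnat_last // CaddA /Ssum -(sumC_cases K); congr (Cadd (Cadd _ _) _).
  - apply: eq_bigr => j Hj; rewrite Mnat_even // Mnat_odd // /lam Hj cos_2a.
    have -> : RtoC (cos th * cos th - sin th * sin th) =
      Cadd (Cmul (RtoC (cos th)) (RtoC (cos th))) (Cmul (Cmul Ci Ci) (Cmul (RtoC (sin th)) (RtoC (sin th)))).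
    { creal; ring. }
    ring.
  - apply: eq_bigr => j Hj; rewrite Mnat_mid // /lam ltnNge Hj /=.
    have -> : RtoC 1 = C1 by []. ring.
Qed.

Lemma lam_bound N K th (j : 'I_N) : lam K th j * lam K th j <= 1.
Proof. by rewrite /lam; case: ifP => _; [have := COS_bound (2 * th); nra|lra]. Qed.

Lemma Ssum_bound N K th (f : vec N) : Cnorm2 (Ssum K th f) <= vnorm2 f * vnorm2 f.
Proof.
  have -> : Ssum K th f = \big[Cadd/C0]_(j < N) Cmul (Cmul (RtoC (lam K th j)) (f j)) (f j).
  { by apply: eq_bigr => j _; rewrite CmulA. }
  apply: Rle_trans (cauchy_schwarz _ _) _; apply: Rmult_le_compat_r; first exact: vnorm2_ge0.
  apply: sumR_le => j _; rewrite Cnorm2M Cnorm2_RtoC.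
  have := lam_bound K th j; have := Cnorm2_ge0 (f j); nra.
Qed.

Lemma Re_one_sub_S N K th (f : vec N) : ball f -> 0 < Re (Csub C1 (Ssum K th f)).
Proof.
  move=> Hf; have := Ssum_bound K th f; rewrite /ball in Hf; have := vnorm2_ge0 f => H0 H.
  have H1 : Cnorm2 (Ssum K th f) < 1 by nra.
  move: H1; rewrite /Cnorm2 /=; move: (Re _) (Im _) => a b; nra.
Qed.

(** The last component h is a root of X^2 - 2 X + S. Hence M M^t = S + h^2 = 2 h, and a quarter of
    |2 h|^2 cancels the |h|^2 contained in |M|^2. *)
Lemma Mlast_eq N K th (f : vec N) :
  Cmul (Mlast K th f) (Mlast K th f) = Csub (Cmul (RtoC 2) (Mlast K th f)) (Ssum K th f).
Proof.
  rewrite /Mlast; set S := Ssum K th f; set s := Csqrt (Csub C1 S).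
  have H : Cmul s s = Csub C1 S by apply: Csqrt_sq.
  have -> : S = Csub C1 (Cmul s s) by rewrite H; ring.
  have -> : RtoC 2 = Cadd C1 C1 by creal; ring. ring.
Qed.

(** The choice of branch matters here: with s = sqrt(1 - S) one has h (1 + s) = S, and Re s >= 0
    gives |1 + s| >= 1, so |h| <= |S| < 1. *)
Lemma Mlast_bound N K th (f : vec N) : ball f -> Cnorm2 (Mlast K th f) < 1.
Proof.
  move=> Hf; have HS := Ssum_bound K th f; rewrite /ball in Hf; have H0 := vnorm2_ge0 f.
  have H1 : Cnorm2 (Ssum K th f) < 1 by nra.
  set s := Csqrt (Csub C1 (Ssum K th f)).
  have Hs : 0 <= Re s by apply: Re_Csqrt_ge0.
  have E : Cmul (Mlast K th f) (Cadd C1 s) = Ssum K th f.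
  { rewrite /Mlast -/s; have -> : Cmul (Csub C1 s) (Cadd C1 s) = Csub C1 (Cmul s s) by ring.
    rewrite /s Csqrt_sq; ring. }
  have E2 : 1 <= Cnorm2 (Cadd C1 s).
  { move: Hs; move: (s) => u Hu.
    rewrite /Cnorm2 /=; have := Rle_0_sqr (0 + Im u); rewrite /Rsqr; nra. }
  move: H1; rewrite -E Cnorm2M; have := Cnorm2_ge0 (Mlast K th f); nra.
Qed.

Definition D4fun m (Z : vec m) : R := 1 - vnorm2 Z + / 4 * Cnorm2 (vbil Z).

Lemma D4fun_M n N (F : vec n -> vec N) th K z : (K <= N)%N ->
  D4fun (Mmap F th K.+1 z) = 1 - vnorm2 (F z).
Proof.
  move=> HK; rewrite /D4fun vnorm2_M // vbil_M // Mlast_eq.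
  have -> : Cadd (Ssum K th (F z)) (Csub (Cmul (RtoC 2) (Mlast K th (F z))) (Ssum K th (F z))) =
    Cmul (RtoC 2) (Mlast K th (F z)) by ring.
  rewrite Cnorm2M Cnorm2_RtoC; field.
Qed.

Lemma M_maps_into n N (F : vec n -> vec N) th K : (K <= N)%N ->
  maps_into (@ball n) (@ball N) F -> maps_into (@ball n) (@D4 (N + K.+1)) (Mmap F th K.+1).
Proof.
  move=> HK HM z Hz; have HF := HM z Hz; split.
  - rewrite vnorm2_M //; have := Mlast_bound K th HF; rewrite /ball in HF; lra.
  - rewrite -/(D4fun (Mmap F th K.+1 z)) D4fun_M //; rewrite /ball in HF; lra.
Qed.

Lemma Mnat_cdiff n N (F : vec n -> vec N) th K z p : (forall i, cdiff (fun w => F w i) z) ->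
  ball (F z) -> cdiff (fun w => Mnat K th (F w) p) z.
Proof.
  move=> HF Hb; rewrite /Mnat.
  have Hv q : cdiff (fun w => vnth (F w) q) z by apply: vnth_cdiff.
  case: (p < K.*2)%N; first by case: (odd p); apply: cdiff_scal.
  case: (p < N + K)%N => //.
  apply: cdiff_sub; first exact: cdiff_const.
  apply: cdiff_sqrt; last exact: Re_one_sub_S.
  apply: cdiff_sub; first exact: cdiff_const.
  by apply: cdiff_sum => j; apply: cdiff_scal; apply: cdiff_mul.
Qed.

Lemma M_cdiff n N (F : vec n -> vec N) th K : (K <= N)%N ->
  holo_on (@ball n) F -> maps_into (@ball n) (@ball N) F ->
  forall z, ball z -> forall i, cdiff (fun w => Mmap F th K.+1 w i) z.
Proof.
  move=> HK HF HM z Hz i.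
  have := Mnat_cdiff th K i (proj1 (holo_at_cdiff _ _) (HF z Hz)) (HM z Hz).
  apply: cdiff_ext; apply: filter_forall => w; by rewrite MmapE.
Qed.

(** A linear left inverse of F -> M on the ambient space: it reads a paired component off its cosine
    entry. It is the map [pi] of the properness argument. *)
Definition Mproj N K m th (Z : vec m) : vec N := fun j =>
  if (j < K)%N then Cmul (RtoC (/ cos th)) (vnth Z j.*2) else vnth Z (j + K).

Lemma Mproj_M n N (F : vec n -> vec N) th K z : (K <= N)%N -> cos th <> 0 ->
  Mproj K th (Mmap F th K.+1 z) = F z.
Proof.
  move=> HK Hc; apply: functional_extensionality => j; rewrite /Mproj MmapE //.
  have V p (Hp : (p < N + K.+1)%N) : vnth (fun i : 'I_(N + K.+1) => Mnat K th (F z) i) p = Mnat K th (F z) p.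
  { by rewrite /vnth (insubT (fun p => (p < N + K.+1)%N) Hp). }
  case: ifP => Hj.
  - rewrite V; last first.
    { apply: leq_trans (_ : K.*2 <= _)%N; first by rewrite ltn_double.
      by rewrite -addnn leq_add. }
    rewrite Mnat_even //; creal; field; done.
  - rewrite V; last by rewrite addnS ltnS leq_add2r ltnW.
    by rewrite Mnat_mid // leqNgt Hj.
Qed.

Lemma M_proper n N (F : vec n -> vec N) th K : (K <= N)%N -> cos th <> 0 ->
  holo_on (@ball n) F -> maps_into (@ball n) (@ball N) F ->
  proper_map (@ball n) (@ball N) F ->
  proper_map (@ball n) (@D4 (N + K.+1)) (Mmap F th K.+1).
Proof.
  move=> HK Hc HF HM HP.
  apply: (proper_of_retraction (F := F) (pi := @Mproj N K _ th) (g := @D4fun _)) => //.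
  - exact: M_cdiff.
  - move=> Z j; rewrite /Mproj.
    have V p : cdiff (fun W : vec (N + K.+1) => vnth W p) Z.
    { apply: (vnth_cdiff (F := fun W => W)) => i; exact: cdiff_coord. }
    by case: (j < K)%N => //; apply: cdiff_scal.
  - move=> Z; apply: rlim_add; first apply: rlim_add; first exact: rlim_const.
    + apply: rlim_opp; apply: (clim_vnorm2 (f := fun W => W)) => i; exact: clim_coord.
    + apply: rlim_mul; first exact: rlim_const.
      apply: rlim_Cnorm2; apply: clim_sum => i; apply: clim_mul; exact: clim_coord.
  - by move=> Z [].
  - move=> z Hz; rewrite Mproj_M // D4fun_M //; split=> //; ring.
Qed.

(** * Linear independence of the components of M near the origin *)

Definition monomial_on_ball n N (F : vec n -> vec N) (c : 'I_N -> R) (alpha : 'I_N -> 'I_n -> nat) : Prop :=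
  forall z, ball z -> forall i, F z i = Cmul (RtoC (c i)) (monom (alpha i) z).

Lemma minimum_ball_monomial n N (F : vec n -> vec N) c alpha i :
  minimum_ball F -> holo_on (@ball n) F -> maps_into (@ball n) (@ball N) F ->
  monomial_on_ball F c alpha -> c i <> 0 /\ (0 < mdeg (alpha i))%N.
Proof.
  move=> Hmin HF HM Hmon; split.
  - move=> Hc; apply: (@minimum_ball_nonconstant _ _ F i 0 Hmin HF HM) => z Hz.
    rewrite Hmon // Hc; creal; ring.
  - rewrite lt0n; apply/eqP => Hd; apply: (@minimum_ball_nonconstant _ _ F i (c i) Hmin HF HM) => z Hz.
    rewrite Hmon // monom_deg0 //; ring.
Qed.

Lemma monomial_scale n N (F : vec n -> vec N) c alpha t v i : monomial_on_ball F c alpha ->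
  ball (vscale (RtoC t) v) ->
  F (vscale (RtoC t) v) i = Cmul (RtoC (c i * t ^ mdeg (alpha i))) (monom (alpha i) v).
Proof. move=> Hmon Hb; rewrite Hmon // monom_scale; creal; ring. Qed.

Lemma nb_ray n (P : vec n -> Prop) v : nb (fun _ => C0) P ->
  exists e, 0 < e /\ forall t, 0 < t < e -> P (vscale (RtoC t) v).
Proof.
  (* The estimate is t^2 |v|^2 <= (t (|v|^2 + 1))^2 < d^2; the added 1 covers v = 0 as well. *)
  move=> [d [Hd H]]; have Hv := vnorm2_ge0 v; exists (d / (vnorm2 v + 1)).
  split; first by apply: Rdiv_lt_0_compat; lra.
  move=> t Ht; apply: H; rewrite vsub0 vnorm2_vscale Cnorm2_RtoC.
  have H1 : t * (vnorm2 v + 1) < d.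
  { have -> : d = d / (vnorm2 v + 1) * (vnorm2 v + 1) by field; lra.
    apply: Rmult_lt_compat_r; lra. }
  have H2 : t * t * vnorm2 v <= (t * (vnorm2 v + 1)) * (t * (vnorm2 v + 1)).
  { have := Rle_0_sqr t; rewrite /Rsqr => Ht2.
    have -> : t * (vnorm2 v + 1) * (t * (vnorm2 v + 1)) = t * t * ((vnorm2 v + 1) * (vnorm2 v + 1)) by ring.
    apply: Rmult_le_compat_l => //; nra. }
  have H3 : 0 < t * (vnorm2 v + 1) by apply: Rmult_lt_0_compat; lra.
  nra.
Qed.

Lemma ball_open n : nb (fun _ : 'I_n => C0) (@ball n).
Proof. by apply: (nb_intro Rlt_0_1) => w; rewrite vsub0. Qed.

(** Along a ray each f_j(t z) is f_j(z) times a power of t, so a relation near 0 is a polynomial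
    identity in t, and t = 1 extends it to the whole ball. As the coefficients of the monomials are
    real, evaluation at conj(z) gives the relation with conjugate coefficients. The real and
    imaginary parts of [beta] are then real relations, which minimality rules out. *)
Lemma components_independent n N (F : vec n -> vec N) c alpha (beta : 'I_N -> C) :
  minimum_ball F -> holo_on (@ball n) F -> maps_into (@ball n) (@ball N) F ->
  monomial_on_ball F c alpha ->
  nb (fun _ => C0) (fun z => \big[Cadd/C0]_(j < N) Cmul (beta j) (F z j) = C0) ->
  forall j, beta j = C0.
Proof.
  move=> Hmin HF HM Hmon Hnb.
  have glob z : ball z -> \big[Cadd/C0]_(j < N) Cmul (beta j) (F z j) = C0.
  { move=> Hz.
    have [e [He H]] := nb_ray z (filter_and _ _ (@ball_open n) Hnb).
    pose X j := Cmul (beta j) (Cmul (RtoC (c j)) (monom (alpha j) z)).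
    have HX t : 0 < t < e -> \big[Cadd/C0]_(j < N) Cmul (RtoC (t ^ mdeg (alpha j))) (X j) = C0.
    { move=> Ht; have [Hb E] := H t Ht; rewrite -[RHS]E; apply: eq_bigr => j _.
      rewrite (monomial_scale j Hmon Hb) /X.
      have -> : RtoC (c j * t ^ mdeg (alpha j)) = Cmul (RtoC (c j)) (RtoC (t ^ mdeg (alpha j))) by creal; ring.
      ring. }
    have P (Y : 'I_N -> R) : polyfun (fun t => \big[Rplus/0]_(j < N) (Y j * t ^ mdeg (alpha j))).
    { apply: polyfun_sum => j; apply: polyfun_scal; exact: polyfun_pow. }
    have Z (Y : 'I_N -> R) : (forall t, 0 < t < e -> \big[Rplus/0]_(j < N) (Y j * t ^ mdeg (alpha j)) = 0) ->
       \big[Rplus/0]_(j < N) Y j = 0.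
    { move=> HY; have E := polyfun_zero (P Y) He HY 1; rewrite -[RHS]E; apply: eq_bigr => j _; rewrite pow1; ring. }
    have -> : \big[Cadd/C0]_(j < N) Cmul (beta j) (F z j) = \big[Cadd/C0]_(j < N) X j.
    { by apply: eq_bigr => j _; rewrite Hmon. }
    apply: Ceq.
    - rewrite Re_sum; apply: Z => t Ht; have E := f_equal Re (HX t Ht); rewrite Re_sum /= in E.
      rewrite -[RHS]E; apply: eq_bigr => j _; rewrite /X /=; ring.
    - rewrite Im_sum; apply: Z => t Ht; have E := f_equal Im (HX t Ht); rewrite Im_sum /= in E.
      rewrite -[RHS]E; apply: eq_bigr => j _; rewrite /X /=; ring. }
  have globc z : ball z -> \big[Cadd/C0]_(j < N) Cmul (Cconj (beta j)) (F z j) = C0.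
  { move=> Hz; have Hzc : ball (vconj z).
    { by rewrite /ball; have -> : vnorm2 (vconj z) = vnorm2 z by apply: eq_bigr => i _; rewrite Cnorm2_conj. }
    have := f_equal Cconj (glob _ Hzc); rewrite sum_conj.
    have -> : Cconj C0 = C0 by creal; ring.
    move=> E; rewrite -[RHS]E; apply: eq_bigr => j _; rewrite !Hmon // monom_conj; creal; ring. }
  have H1 : forall j, Re (beta j) = 0.
  { apply: (minimum_ball_linear Hmin HF HM) => z Hz.
    transitivity (Cmul (RtoC (/ 2)) (Cadd (\big[Cadd/C0]_(j < N) Cmul (beta j) (F z j))
      (\big[Cadd/C0]_(j < N) Cmul (Cconj (beta j)) (F z j)))).
    - rewrite -sumC_split sumC_distr; apply: eq_bigr => j _; creal; field.
    - rewrite glob // globc //; ring. }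
  have H2 : forall j, Im (beta j) = 0.
  { apply: (minimum_ball_linear Hmin HF HM) => z Hz.
    transitivity (Cmul (mkC 0 (- / 2)) (Csub (\big[Cadd/C0]_(j < N) Cmul (beta j) (F z j))
      (\big[Cadd/C0]_(j < N) Cmul (Cconj (beta j)) (F z j)))).
    - rewrite -sum_sub sumC_distr; apply: eq_bigr => j _; creal; field.
    - rewrite glob // globc //; ring. }
  by move=> j; creal.
Qed.

(* If h = 1 - sqrt (1 - S) were a combination of the f_j near 0, then along the real diagonal
   1 - S(t) = (1 - X(t))^2 would hold identically for real polynomials, while S(t) -> oo. *)
Lemma last_independent n N (F : vec n -> vec N) c alpha th K (beta : 'I_N -> C) gam (j0 : 'I_N) :
  0 < cos (2 * th) ->
  minimum_ball F -> holo_on (@ball n) F -> maps_into (@ball n) (@ball N) F ->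
  monomial_on_ball F c alpha ->
  nb (fun _ => C0) (fun z => Cadd (\big[Cadd/C0]_(j < N) Cmul (beta j) (F z j))
     (Cmul gam (Mlast K th (F z))) = C0) -> gam = C0.
Proof.
  move=> Hth Hmin HF HM Hmon Hnb; apply: NNPP => Hg.
  have [e [He H]] := nb_ray (fun _ => C1) (filter_and _ _ (@ball_open n) Hnb).
  pose b j := Copp (Cmul (Cinv gam) (beta j)).
  pose d j := mdeg (alpha j).
  pose X t := \big[Rplus/0]_(j < N) (Re (b j) * (c j * t ^ d j)).
  pose S t := \big[Rplus/0]_(j < N) (lam K th j * ((c j * t ^ d j) * (c j * t ^ d j))).
  have PP j : polyfun (fun t => c j * t ^ d j) by apply: polyfun_scal; exact: polyfun_pow.
  have PX : polyfun X by apply: polyfun_sum => j; apply: polyfun_scal.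
  have PS : polyfun S by apply: polyfun_sum => j; apply: polyfun_scal; apply: polyfun_mul.
  have key t : 0 < t < e -> (1 + -1 * X t) * (1 + -1 * X t) + (S t + -1) = 0.
  { move=> Ht; have [Hb E] := H t Ht.
    set v := vscale _ _ in Hb E.
    have Fv j : F v j = RtoC (c j * t ^ d j).
    { rewrite /v (monomial_scale j Hmon Hb) monom_ones /d; ring. }
    have Eh : Mlast K th (F v) = \big[Cadd/C0]_(j < N) Cmul (b j) (F v j).
    { transitivity (Cmul (Copp (Cinv gam)) (\big[Cadd/C0]_(j < N) Cmul (beta j) (F v j))).
      - have -> : \big[Cadd/C0]_(j < N) Cmul (beta j) (F v j) = Copp (Cmul gam (Mlast K th (F v))).
        { set A := \big[Cadd/C0]_(j < N) _ in E *.
          have G x y : Cadd x y = C0 -> x = Copp y by move=> Hxy; have -> : x = Csub (Cadd x y) y by [ring]; rewrite Hxy; ring.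
          exact: G. }
        by field.
      - rewrite sumC_distr; apply: eq_bigr => j _; rewrite /b; ring. }
    have ES : Ssum K th (F v) = RtoC (S t).
    { rewrite /Ssum /S sum_RtoC; apply: eq_bigr => j _; rewrite Fv; creal; ring. }
    have EX : Re (Mlast K th (F v)) = X t.
    { rewrite Eh Re_sum; apply: eq_bigr => j _; rewrite Fv /=; ring. }
    have Hp := Re_one_sub_S K th (HM _ Hb).
    move: EX; rewrite /Mlast.
    have Hs := Re_Csqrt_pos Hp; have Hs2 := Csqrt_sq (Csub C1 (Ssum K th (F v))).
    move: Hs Hs2; move: (Csqrt (Csub C1 (Ssum K th (F v)))) => s Hs; rewrite ES => Hs2 /= EX.
    have E1 := f_equal Re Hs2; have E2 := f_equal Im Hs2; rewrite /= in E1 E2.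
    (* On the diagonal 1 - S is real, so Re s Im s = 0, while the principal root has Re s > 0. *)
    have I0 : Im s = 0.
    { have : Re s * Im s = 0 by lra. move=> /Rmult_integral [|//]; lra. }
    rewrite I0 in E1; have -> : X t = 1 - Re s by lra.
    nra. }
  have all := polyfun_zero (p := fun t => (1 + -1 * X t) * (1 + -1 * X t) + (S t + -1)) _ He key.
  have {}all t : (1 + -1 * X t) * (1 + -1 * X t) + (S t + -1) = 0.
  { apply: all; apply: polyfun_add.
    - by apply: polyfun_mul; apply: polyfun_add; try exact: polyfun_const; apply: polyfun_scal.
    - by apply: polyfun_add => //; exact: polyfun_const. }
  have lp j : 0 < lam K th j by rewrite /lam; case: (j < K)%N => //; lra.
  have [cn dn] := minimum_ball_monomial j0 Hmin HF HM Hmon.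
  have q0 : 0 < lam K th j0 * (c j0 * c j0).
  { apply: Rmult_lt_0_compat => //; have := Rsqr_pos_lt _ cn; done. }
  set q := lam K th j0 * (c j0 * c j0) in q0.
  (* Chosen so that q t = q + 2. All weights are positive and the degree of f_(j0) is at least 1, so
     S(t) >= q t^2 > 1, which contradicts S(t) = 1 - (1 - X(t))^2. *)
  pose t := 1 + 2 / q.
  have t1 : 1 < t by rewrite /t; have : 0 < 2 / q by [apply: Rdiv_lt_0_compat; lra]; lra.
  have Ht : t <= t ^ d j0.
  { rewrite -{1}(pow_1 t); apply: Rle_pow; first lra. by apply/leP. }
  have Sb : q * (t ^ d j0 * t ^ d j0) <= S t.
  { have := sumR_term_le (F := fun j => lam K th j * ((c j * t ^ d j) * (c j * t ^ d j))) j0.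
    move=> K1; apply: Rle_trans (K1 _); first by right; rewrite /q; ring.
    move=> j; apply: Rmult_le_pos; first by left.
    exact: Rle_0_sqr. }
  have qt : q * t = q + 2 by rewrite /t; field; lra.
  have : q * (t * t) <= q * (t ^ d j0 * t ^ d j0) by apply: Rmult_le_compat_l; nra.
  have := all t; have := Rle_0_sqr (1 + -1 * X t); rewrite /Rsqr.
  nra.
Qed.

(** Both entries of a pair are multiples of the same f_j, so a relation forces only their
    combination with cos(th) and i sin(th) to vanish. To separate the two coefficients, their
    reality has to come from elsewhere. *)
Lemma M_relation n N (F : vec n -> vec N) c alpha th K (a : vec (N + K.+1)) (j0 : 'I_N) :
  (K <= N)%N -> 0 < cos (2 * th) ->
  minimum_ball F -> holo_on (@ball n) F -> maps_into (@ball n) (@ball N) F ->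
  monomial_on_ball F c alpha ->
  nb (fun _ => C0) (fun z => \big[Cadd/C0]_(i < N + K.+1) Cmul (a i) (Mmap F th K.+1 z i) = C0) ->
  vnth a (N + K) = C0 /\
  (forall j : 'I_N, (K <= j)%N -> vnth a (j + K) = C0) /\
  (forall j : 'I_N, (j < K)%N ->
     Cadd (Cmul (RtoC (cos th)) (vnth a j.*2)) (Cmul (Cmul Ci (RtoC (sin th))) (vnth a j.*2.+1)) = C0).
Proof.
  move=> HK Hth Hmin HF HM Hmon Hnb.
  pose beta (j : 'I_N) := if (j < K)%N then
    Cadd (Cmul (RtoC (cos th)) (vnth a j.*2)) (Cmul (Cmul Ci (RtoC (sin th))) (vnth a j.*2.+1))
    else vnth a (j + K).
  have E z : \big[Cadd/C0]_(i < N + K.+1) Cmul (a i) (Mmap F th K.+1 z i) =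
    Cadd (\big[Cadd/C0]_(j < N) Cmul (beta j) (F z j)) (Cmul (vnth a (N + K)) (Mlast K th (F z))).
  { rewrite MmapE //.
    have -> : \big[Cadd/C0]_(i < N + K.+1) Cmul (a i) (Mnat K th (F z) i) =
      \big[Cadd/C0]_(i < N + K.+1) (fun p => Cmul (vnth a p) (Mnat K th (F z) p)) i.
    { by apply: eq_bigr => i _; rewrite vnth_ord. }
    rewrite (split_sumC (fun p => Cmul (vnth a p) (Mnat K th (F z) p)) HK) Mnat_last // CaddA -(sumC_cases K); congr (Cadd (Cadd _ _) _).
    - apply: eq_bigr => j Hj; rewrite /beta Hj Mnat_even // Mnat_odd //; ring.
    - by apply: eq_bigr => j Hj; rewrite /beta ltnNge Hj Mnat_mid. }
  have Hnb2 : nb (fun _ => C0) (fun z => Cadd (\big[Cadd/C0]_(j < N) Cmul (beta j) (F z j))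
     (Cmul (vnth a (N + K)) (Mlast K th (F z))) = C0).
  { by apply: (filter_mono (FF := nb_filter (fun _ : 'I_n => C0)) Hnb) => z; rewrite E. }
  have Ha := last_independent j0 Hth Hmin HF HM Hmon Hnb2.
  have Hb := components_independent (beta := beta) Hmin HF HM Hmon.
  have {}Hb : forall j, beta j = C0.
  { apply: Hb; apply: (filter_mono (FF := nb_filter (fun _ : 'I_n => C0)) Hnb2) => z E2; rewrite -[RHS]E2 Ha.
    set A := \big[Cadd/C0]_(j < N) _; have G x y : x = Cadd x (Cmul C0 y) by ring. exact: G. }
  split=> //; split=> j Hj.
  - by have := Hb j; rewrite /beta ltnNge Hj.
  - by have := Hb j; rewrite /beta Hj.
Qed.

(** * Minimality of M *)

Lemma padzero_last n m (G : vec n -> vec m) z : padzero (q := m.+1) G z ord_max = C0.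
Proof. by rewrite /padzero insubF //= ltnn. Qed.

Lemma padzero_widen n m (G : vec n -> vec m) z i :
  padzero (q := m.+1) G z (widen_ord (leqnSn m) i) = G z i.
Proof.
  rewrite /padzero (insubT (fun k => (k < m)%N) (ltn_ord i)).
  by congr (G z _); apply: val_inj.
Qed.

Lemma vnorm2_padzero n m (G : vec n -> vec m) z : vnorm2 (padzero (q := m.+1) G z) = vnorm2 (G z).
Proof.
  rewrite {1}/vnorm2 big_ord_recr /= padzero_last Cnorm2_0 Rplus_0_r.
  by apply: eq_bigr => i _; rewrite padzero_widen.
Qed.

Lemma vbil_padzero n m (G : vec n -> vec m) z : vbil (padzero (q := m.+1) G z) = vbil (G z).
Proof.
  rewrite {1}/vbil big_ord_recr /= padzero_last Cmul0l CaddC Cadd0.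
  by apply: eq_bigr => i _; rewrite padzero_widen.
Qed.

Lemma padzero_D4 n m (G : vec n -> vec m.-1) (L : 'I_m) z : nat_of_ord L = m.-1 -> D4 (G z) ->
  D4 (padzero (q := m) G z) /\ padzero (q := m) G z L = C0.
Proof.
  case: m L G => [[]//|m] L G /= HL.
  have -> : L = ord_max by apply: val_inj.
  by rewrite /D4 (vnorm2_padzero (G : vec n -> vec m)) (vbil_padzero (G : vec n -> vec m))
    (padzero_last (G : vec n -> vec m)).
Qed.

Lemma M_minimum n N (F : vec n -> vec N) c alpha th K (j0 : 'I_N) :
  (K <= N)%N -> 0 < th < PI / 4 ->
  minimum_ball F -> holo_on (@ball n) F -> maps_into (@ball n) (@ball N) F ->
  monomial_on_ball F c alpha -> minimum_IV (Mmap F th K.+1).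
Proof.
  move=> HK Hth Hmin HF HM Hmon [psi [phi [G [Hpsi [Hphi [HG [MG HFG]]]]]]].
  have Hc2 : 0 < cos (2 * th) by apply: cos_gt_0; lra.
  have Hc : 0 < cos th by apply: cos_gt_0; lra.
  have Hs : 0 < sin th by apply: sin_gt_0; lra.
  set m := (N + K.+1)%N in phi G Hphi HG MG HFG.
  have Lp : (N + K < m)%N by rewrite /m addnS.
  pose L := Ordinal Lp.
  have [T [MT [HT [Tfix HA]]]] := reflection_conjugate L Hphi.
  have TM z : ball z -> T (Mmap F th K.+1 z) = Mmap F th K.+1 z.
  { move=> Hz; case: (Hpsi) => psi' [_ [_ [Mpsi _]]].
    have HGz := MG _ (Mpsi z Hz).
    have [D0 DL] := padzero_D4 (L := L) (etrans (esym (f_equal predn (addnS N K))) erefl) HGz.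
    rewrite (HFG z Hz); exact: Tfix. }
  have F0 : F (fun _ => C0) = fun _ => C0.
  { apply: functional_extensionality => i.
    have [_ Hd] := minimum_ball_monomial i Hmin HF HM Hmon.
    have := monomial_scale (t := 0) (v := fun _ => C0) i Hmon.
    have -> : vscale (RtoC 0) (fun _ : 'I_n => C0) = fun _ => C0.
    { apply: functional_extensionality => k; rewrite /vscale; ring. }
    move=> /(_ (ball0 n)) ->; rewrite pow_i; last exact/leP.
    creal; ring. }
  have M0 : Mmap F th K.+1 (fun _ => C0) = fun _ => C0.
  { have := vnorm2_M F th (fun _ => C0) HK.
    have E : Ssum K th (fun _ : 'I_N => C0) = C0 by rewrite /Ssum big1 // => j _; ring.
    rewrite F0 vnorm2_0 /Mlast E.
    have -> : Csub C1 (Csqrt (Csub C1 C0)) = C0.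
    { have -> : Csub C1 C0 = C1 by ring.
      have Hp := @Re_Csqrt_pos C1 Rlt_0_1; have := Csqrt_sq C1.
      move: (Csqrt C1) Hp => s Hp H.
      have E1 := f_equal Re H; have E2 := f_equal Im H; rewrite /= in E1 E2.
      creal; nra. }
    rewrite Cnorm2_0 Rplus_0_r; exact: vnorm2_eq0. }
  have T0 : T (fun _ => C0) = fun _ => C0 by rewrite -M0 TM //; exact: ball0.
  have [A [JA [AA A1]]] := HA T0.
  have AM : nb (fun _ => C0) (fun z => mxapp A (Mmap F th K.+1 z) = Mmap F th K.+1 z).
  { have G1 : nb (fun _ => C0) (fun z => vnorm2 (Mmap F th K.+1 z) < / 4).
    { have R : rlim (fun z => vnorm2 (Mmap F th K.+1 z)) (nb (fun _ => C0)) (vnorm2 (Mmap F th K.+1 (fun _ => C0))).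
      { apply: clim_vnorm2 => i; apply: cdiff_clim; apply: M_cdiff => //; exact: ball0. }
      apply: (rlim_lt (FF := nb_filter _) R); rewrite M0 vnorm2_0; lra. }
    apply: (filter_mono (FF := nb_filter (fun _ : 'I_n => C0)) (filter_and _ _ (@ball_open n) G1)) => z [Hz Hn].
    by rewrite -(involution_linear MT HT T0 JA AA Hn) TM. }
  (* Row i of A - 1. As A fixes M(z) for z near 0, every such row is a linear relation among the
     components of M. *)
  pose a i : vec m := fun p => Csub (A i p) (mxone i p).
  have rel i := M_relation (a := a i) j0 HK Hc2 Hmin HF HM Hmon.
  have {}rel i : vnth (a i) (N + K) = C0 /\
    (forall j : 'I_N, (K <= j)%N -> vnth (a i) (j + K) = C0) /\
    (forall j : 'I_N, (j < K)%N ->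
     Cadd (Cmul (RtoC (cos th)) (vnth (a i) j.*2)) (Cmul (Cmul Ci (RtoC (sin th))) (vnth (a i) j.*2.+1)) = C0).
  { apply: rel; apply: (filter_mono (FF := nb_filter (fun _ : 'I_n => C0)) AM) => z E.
    transitivity (Csub (mxapp A (Mmap F th K.+1 z) i) (mxapp (@mxone m) (Mmap F th K.+1 z) i)).
    - rewrite /mxapp -sum_sub; apply: eq_bigr => p _; rewrite /a; ring.
    - rewrite E mxapp_one; ring. }
  have vntho i (p : 'I_m) q : nat_of_ord p = q -> vnth (a i) q = a i p by move=> <-; rewrite vnth_ord.
  have AL i : A i L = vbasis L i.
  { apply: Csub_eq0; have [H _] := rel i; rewrite -[RHS]H (vntho i L) // /a /mxone /vbasis eq_sym //. }
  apply: A1; apply: functional_extensionality => i; apply: functional_extensionality => p.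
  apply: Csub_eq0; rewrite -/(a i p).
  (* Subtracting the real identity matrix keeps the reality off row L, and in row L its entry is 0
     because r <> L. *)
  have real_col (r : 'I_m) : r != L -> (i == L -> Re (a i r) = 0) /\ (i != L -> Im (a i r) = 0).
  { move=> Hr; rewrite eq_sym in Hr.
    have [H1 H2] := column_real MT HT T0 JA AA Hr AL.
    split=> [/eqP ->|Hi]; rewrite /a /mxone /=.
    - rewrite eq_sym (negbTE Hr) /= H1; ring.
    - rewrite H2 //; case: (r == i) => /=; ring. }
  case: (ltnP p K.*2) => HpK; last first.
  - case: (ltngtP p (N + K)) => HpN.
    + have Hj : (p - K < N)%N by rewrite ltn_subLR ?(addnC K) //; apply: leq_trans HpK; rewrite -addnn leq_addr.
      have [_ [H _]] := rel i.
      have := H (Ordinal Hj); rewrite /= => H'.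
      rewrite -(vntho i p (p - K + K)%N).
      * by apply: H'; rewrite leq_subRL ?addnn //; apply: leq_trans HpK; rewrite -addnn leq_addr.
      * by rewrite subnK //; apply: leq_trans HpK; rewrite -addnn leq_addr.
    + by move: HpN; rewrite ltnNge -ltnS -addnS ltn_ord.
    + by have [H _] := rel i; rewrite -[RHS]H (vntho i p).
  - have Hj2 : (p./2 < K)%N by rewrite ltn_half_double.
    have Hj : (p./2 < N)%N by apply: leq_trans HK.
    have He : (p./2.*2 < m)%N.
    { apply: leq_trans (_ : K.*2 <= _)%N; first by rewrite ltn_double.
      by rewrite -addnn leq_add. }
    have Ho : (p./2.*2.+1 < m)%N.
    { apply: leq_trans (_ : K.*2 <= _)%N; first by rewrite ltn_Sdouble.
      by rewrite -addnn leq_add. }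
    have ne (q : nat) (Hq : (q < m)%N) : (q < K.*2)%N -> Ordinal Hq != L.
    { move=> Hq2; apply/eqP => /(f_equal (@nat_of_ord m)) /= E; move: Hq2.
      by rewrite E -addnn ltn_add2r ltnNge HK. }
    have [_ [_ /(_ (Ordinal Hj) Hj2)]] := rel i; rewrite /=.
    rewrite (vntho i (Ordinal He)) // (vntho i (Ordinal Ho)) // => E.
    have [R1 I1] := real_col (Ordinal He) (ne _ He ltac:(by rewrite ltn_double)).
    have [R2 I2] := real_col (Ordinal Ho) (ne _ Ho ltac:(by rewrite ltn_Sdouble)).
    (* The relation is cos(th) u + i sin(th) w = 0 with u and w both real, or both imaginary when i
       = L. In either case one summand is real and the other imaginary, so both vanish. *)
    have Hz : a i (Ordinal He) = C0 /\ a i (Ordinal Ho) = C0.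
    { move: E R1 I1 R2 I2; move: (a i (Ordinal He)) (a i (Ordinal Ho)) => u w E R1 I1 R2 I2.
      have E1 := f_equal Re E; have E2 := f_equal Im E; rewrite /= in E1 E2.
      case: (boolP (i == L)) => Hi.
      - have r1 := R1 Hi; have r2 := R2 Hi; rewrite r1 r2 in E1 E2.
        split; creal; nra.
      - have i1 := I1 Hi; have i2 := I2 Hi; rewrite i1 i2 in E1 E2.
        split; creal; nra. }
    have Hp := odd_double_half p.
    case: (boolP (odd p)) Hp => Hodd /= Hp.
    + have -> : p = Ordinal Ho by apply: val_inj => /=; rewrite -{1}Hp add1n.
      exact: (proj2 Hz).
    + have -> : p = Ordinal He by apply: val_inj => /=; rewrite -{1}Hp add0n.
      exact: (proj1 Hz).
Qed.

Theorem mainTheorem4 (n N : nat) (F : vec n -> vec N)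
  (c : 'I_N -> R) (alpha : 'I_N -> 'I_n -> nat) (th : R) (k : nat) :
  (1 <= n)%N -> (n <= N)%N ->
  holo_on (@ball n) F -> maps_into (@ball n) (@ball N) F ->
  proper_map (@ball n) (@ball N) F -> minimum_ball F ->
  (forall z, ball z -> forall i, F z i = Cmul (RtoC (c i)) (monom (alpha i) z)) ->
  0 < th < PI / 4 ->
  (1 <= k)%N -> (k <= N + 1)%N ->
  holo_on (@ball n) (Mmap F th k) /\
  maps_into (@ball n) (@D4 (N + k)) (Mmap F th k) /\
  proper_map (@ball n) (@D4 (N + k)) (Mmap F th k) /\
  minimum_IV (Mmap F th k).
Proof.
  move=> Hn HnN HF HM HP Hmin Hmon Hth; case: k => [//|K] _; rewrite addn1 ltnS => HK.
  have Hc : cos th <> 0 by have : 0 < cos th by [apply: cos_gt_0; lra]; lra.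
  split; [|split; [|split]].
  - by move=> z Hz; apply/holo_at_cdiff => i; apply: M_cdiff.
  - exact: M_maps_into.
  - exact: M_proper.
  (* From 1 <= n <= N comes a component f_0, whose square makes S grow in the independence
     argument. *)
  - exact: (M_minimum (Ordinal (leq_trans Hn HnN)) HK Hth Hmin HF HM Hmon).
Qed.
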